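(* Let $\mathbf F\in\mathbb R^d$ be a constant vector. Let $S\subset\mathbb R^d$ be a smooth $(d-1)$-dimensional hypersurface with unit normal $\boldsymbol n(\boldsymbol x)$ such that $\mathbf F\cdot\boldsymbol n(\boldsymbol x)\neq 0$ for all $\boldsymbol x\in S$, and assume that $S$ is globally transverse to the flow generated by $\mathbf F$, in the sense that $$\Phi:S\times\mathbb R\to\mathbb R^d,\qquad \Phi(y,s)=y+s\mathbf F,$$ is a $C^1$-diffeomorphism. For $\boldsymbol x\in\mathbb R^d$ write uniquely $\boldsymbol x=\pi(\boldsymbol x)+\tau(\boldsymbol x)\mathbf F$ with $\pi(\boldsymbol x)\in S$ and $\tau(\boldsymbol x)\in\mathbb R$. Let $\boldsymbol h\in L^2(\mathbb R^d;\mathbb R^d)$. (i) There exists a function $\boldsymbol v\in L^2_{\mathrm{loc}}(\mathbb R^d;\mathbb R^d)$ such that $(\mathbf F\cdot\nabla)\boldsymbol v=\boldsymbol h$ in the sense of distributions. Moreover, for any $\boldsymbol v_S\in L^2(S;\mathbb R^d)$, the function $$\boldsymbol v(\boldsymbol x)=\boldsymbol v_S(\pi(\boldsymbol x))+\int_0^{\tau(\boldsymbol x)}\boldsymbol h(\pi(\boldsymbol x)+s\mathbf F)\,ds$$ defines a distributional solution of $(\mathbf F\cdot\nabla)\boldsymbol v=\boldsymbol h$ with trace $\boldsymbol v|_S=\boldsymbol v_S$. (ii) For each prescribed trace $\boldsymbol v_S\in L^2(S;\mathbb R^d)$, there is at most one $\boldsymbol v\in L^2_{\mathrm{loc}}(\mathbb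 R^d;\mathbb R^d)$ such that $(\mathbf F\cdot\nabla)\boldsymbol v=\boldsymbol h$ in the sense of distributions and $\boldsymbol v|_S=\boldsymbol v_S$. (iii) Let $\boldsymbol v\in L^2_{\mathrm{loc}}(\mathbb R^d;\mathbb R^d)$ be a solution of $(\mathbf F\cdot\nabla)\boldsymbol v=\boldsymbol h$. If in addition $\nabla\cdot\boldsymbol h=0$ on $\mathbb R^d$ and $\nabla\cdot\boldsymbol v=0$ on $S$, then $\nabla\cdot\boldsymbol v=0$ on $\mathbb R^d$ (in the sense of distributions).
   Context: Throughout, $d\in\{2,3\}$. The operator $(\mathbf F\cdot\nabla)=\sum_{i=1}^d F_i\partial_{x_i}$ acts componentwise on vector fields, and differential equations are understood in $\mathcal D'(\mathbb R^d)$. $L^2(S;\mathbb R^d)$ is taken with respect to surface measure on $S$. Trace: if $\boldsymbol v\in L^2_{\mathrm{loc}}(\mathbb R^d;\mathbb R^d)$ satisfies $(\mathbf F\cdot\nabla)\boldsymbol v=\boldsymbol h$ with $\boldsymbol h\in L^2$, then (after modification on a null set) for a.e. $y\in S$ the function $s\mapsto\boldsymbol v(y+s\mathbf F)$ is absolutely continuous on bounded intervals; the trace $\boldsymbol v|_S$ is $y\mapsto\boldsymbol v(y+s\mathbf F)|_{s=0}$, and equality of traces is a.e. on $S$. Divergence on $S$: when $\nabla\cdot\boldsymbol h=0$, the distribution $u=\nabla\cdot\boldsymbol v$ satisfies $(\mathbf F\cdot\nabla)u=0$, so its pullback by $\Phi$ has the form $u_S\otimes 1$ for a unique distribution $u_S$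 on $S$; ''$\nabla\cdot\boldsymbol v=0$ on $S$'' means $u_S=0$. *)

(* Defs.v *)
From HB Require Import structures.
From mathcomp Require Import all_boot all_order all_algebra.
From mathcomp Require Import all_classical all_reals all_analysis.
From mathcomp Require Import measurable_realfun.
Set Implicit Arguments.
Unset Strict Implicit.
Unset Printing Implicit Defensive.
Import Order.TTheory GRing.Theory Num.Theory.
Import numFieldNormedType.Exports.
Local Open Scope classical_set_scope.
Local Open Scope ring_scope.

Fact rV_display : measure_display. Proof. exact: default_measure_display. Qed.

HB.instance Definition _ (R : realType) (n : nat) :=
  @isMeasurable.Build rV_display 'rV[R]_n
    <<s @open 'rV[R]_n >> (@sigma_algebra0 _ setT _)
    (@sigma_algebraC _ _) (@sigma_algebra_bigcup _ setT _).

(* Iterated integration over the coordinates, first coordinate outermost. *)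
Fixpoint lebesgue_rV (R : realType) (n : nat) : set 'rV[R]_n -> \bar R :=
  match n with
  | 0 => fun A => \d_(0 : 'rV[R]_0) A
  | n'.+1 => fun A => (\int[@lebesgue_measure R]_x
      @lebesgue_rV R n' [set y | A (row_mx x%:M y : 'rV[R]_(1 + n'))])%E
  end.
Arguments lebesgue_rV : clear implicits.

Section lebesgue_rV.
Variable R : realType.

Lemma measurable_open_rV n (U : set 'rV[R]_n) : open U -> measurable U.
Proof. exact: sub_sigma_algebra. Qed.

Lemma open_bigcup_rat_ball n (U : set 'rV[R]_n) : open U ->
  exists P : set ('rV[rat]_n * rat), U = \bigcup_(p in P)
     ball (map_mx ratr p.1 : 'rV[R]_n) (ratr p.2).
Proof.
move=> oU; exists [set p | ball (map_mx ratr p.1 : 'rV[R]_n) (ratr p.2) `<=` U].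
apply/seteqP; split=> [x Ux|x [p /=]]; last exact.
have /nbhs_ballP[e /= e0 xeU] : nbhs x U by exact: open_nbhs_nbhs.
have [q /andP[q0 qe]] : exists q : rat, (0 < ratr q :> R) && (ratr q < e / 2).
  have /rat_in_itvoo[q] : (0 : R) < e / 2 by rewrite divr_gt0.
  by rewrite in_itv/= => qe; exists q.
have /choice[c xc] : forall i, exists c : rat, ball (x ord0 i) (ratr q : R) (ratr c).
  move=> i; have : x ord0 i - ratr q < x ord0 i + ratr q by rewrite ltrBlDr -addrA ltrDl addr_gt0.
  by move/rat_in_itvoo => [c cx]; exists c; rewrite ball_itv.
exists (\row_i c i, q) => /=; last first.
  by split=> // i j; rewrite !mxE (ord1 i); apply/ball_sym; exact: xc.
move=> y [_ qy]; apply: xeU; rewrite (splitr e).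
split; first by rewrite -splitr.
move=> i j; apply: (@ball_triangle _ R (ratr (c j) : R)).
  by rewrite (ord1 i); apply: le_ball (xc j); exact: ltW.
by have := qy i j; rewrite !mxE; apply: le_ball; exact: ltW.
Qed.

Lemma preimage_row_mx_ball n (c : 'rV[R]_(1 + n)) r : 0 < r ->
  (fun p : R * 'rV[R]_n => row_mx p.1%:M p.2 : 'rV[R]_(1 + n)) @^-1` ball c r =
  ball (c ord0 ord0 : R) r `*` ball (rsubmx c : 'rV[R]_n) r.
Proof.
move=> r0; apply/seteqP; split=> [[x y] [_ /= cxy]|[x y] [/= cx [_ cy]]].
  split=> /=.
    have := cxy ord0 (lshift n ord0).
    rewrite row_mxEl mxE eqxx mulr1n.
    by congr (ball (c _ _) _ _); apply: val_inj.
  by split=> // i j; have := cxy i (rshift 1 j); rewrite row_mxEr mxE.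
split=> // i j; rewrite (ord1 i); case: (split_ordP j) => k ->.
  rewrite (ord1 k) row_mxEl mxE eqxx mulr1n.
  by rewrite (_ : lshift n ord0 = ord0)//; apply: val_inj.
by rewrite row_mxEr; have := cy ord0 k; rewrite mxE.
Qed.

Lemma measurable_row_mx n : measurable_fun [set: R * 'rV[R]_n]
  (fun p => row_mx p.1%:M p.2 : 'rV[R]_(1 + n)).
Proof.
apply: (@measurability _ _ _ _ _ _ (@open 'rV[R]_(1 + n))) => //.
move=> _ [U oU <-]; rewrite setTI.
have [P ->] := open_bigcup_rat_ball oU.
rewrite bigcup_mkcond preimage_bigcup.
apply: countable_bigcupT_measurable => // -[c r]; case: ifPn => _; last first.
  by rewrite preimage_set0.
have [r0|r0] := ltP 0 (ratr r : R).
  rewrite preimage_row_mx_ball//; apply: measurableX.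
    exact: measurable_ball.
  by apply: measurable_open_rV; exact: ball_open.
rewrite (_ : _ @^-1` _ = set0)//; apply/seteqP; split=> // x [/= r0'].
by rewrite ltNge r0 in r0'.
Qed.

Section row_mx_measure.
Variables (n : nat) (m : {sigma_finite_measure set 'rV[R]_n -> \bar R}).
Hypothesis m_ball : forall (x : 'rV[R]_n) (r : R), (m (ball x r) < +oo)%E.

Let f (p : R * 'rV[R]_n) : 'rV[R]_n.+1 := row_mx p.1%:M p.2.
Let mf : measurable_fun setT f. Proof. exact: measurable_row_mx. Qed.

Definition row_mx_measure : set 'rV[R]_n.+1 -> \bar R :=
  pushforward (@lebesgue_measure R \x m)%E f.

Let measure0 : row_mx_measure set0 = 0%E.
Proof. by rewrite /row_mx_measure /pushforward preimage_set0 measure0. Qed.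

Let measure_ge0 A : (0 <= row_mx_measure A)%E.
Proof. exact: measure_ge0. Qed.

Let measure_sigma_additive : semi_sigma_additive row_mx_measure.
Proof.
have mfT A : measurable A -> measurable (f @^-1` A).
  by move=> mA; rewrite -[X in measurable X]setTI; exact: mf.
move=> A mA tA mUA; rewrite /row_mx_measure /pushforward preimage_bigcup.
apply: measure_semi_sigma_additive.
- by move=> k; exact: mfT.
- apply/trivIsetP => /= i j _ _ ij; rewrite -preimage_setI.
  by move/trivIsetP : tA => /(_ _ _ _ _ ij) ->//; rewrite preimage_set0.
- by rewrite -preimage_bigcup; exact: mfT.
Qed.

HB.instance Definition _ := isMeasure.Build _ _ _ row_mx_measure
  measure0 measure_ge0 measure_sigma_additive.

Lemma row_mx_measure_ball (x : 'rV[R]_n.+1) (r : R) : (row_mx_measure (ball x r) < +oo)%E.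
Proof.
have [r0|r0] := ltP 0 r; last first.
  rewrite (_ : ball x r = set0) ?measure0//.
  by apply/seteqP; split=> // y [+ _]; rewrite ltNge r0.
rewrite /row_mx_measure /pushforward /f preimage_row_mx_ball//.
rewrite product_measure1E//; last 2 first.
  exact: measurable_ball.
  by apply: measurable_open_rV; exact: ball_open.
apply: lte_mul_pinfty; [by []| |exact: m_ball].
by rewrite [X in X \is a _]lebesgue_measure_ball ?ltW.
Qed.

Lemma row_mx_measure_sigma_finite : sigma_finite setT row_mx_measure.
Proof.
exists (fun k : nat => ball (0 : 'rV[R]_n.+1) k.+1%:R) => [|k].
  apply/seteqP; split=> // x _; exists (Num.truncn `|x|) => //.
  by rewrite -ball_normE/= sub0r normrN truncnS_gt.
by split; [apply: measurable_open_rV; exact: ball_open|exact: row_mx_measure_ball].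
Qed.

End row_mx_measure.

Lemma lebesgue_rV_sfP n :
  exists m : {sigma_finite_measure set 'rV[R]_n -> \bar R},
  (lebesgue_rV R n = m :> (set 'rV[R]_n -> \bar R)) /\
  (forall (x : 'rV[R]_n) (r : R), (m (ball x r) < +oo)%E).
Proof.
elim: n => [|n [m [mE mfin]]].
  exists (\d_(0 : 'rV[R]_0)); split=> // x r.
  by rewrite /= diracE ltry.
pose mu_sf := Measure_isSigmaFinite.Build _ _ _ (row_mx_measure m)
  (row_mx_measure_sigma_finite mfin).
pose mu : {sigma_finite_measure set 'rV[R]_n.+1 -> \bar R} :=
  HB.pack (row_mx_measure m) mu_sf.
exists mu; split=> [|x r]; last exact: row_mx_measure_ball.
apply/funext => A; rewrite /= /row_mx_measure /pushforward /product_measure1 /=.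
apply: eq_integral => x _ /=; rewrite mE; congr (m _).
by apply/seteqP; split=> y; rewrite /xsection/= inE.
Qed.

Let lebesgue_rV0 n : lebesgue_rV R n set0 = 0%E.
Proof. by have [m [-> _]] := lebesgue_rV_sfP n; exact: measure0. Qed.

Let lebesgue_rV_ge0 n A : (0 <= lebesgue_rV R n A)%E.
Proof. by have [m [-> _]] := lebesgue_rV_sfP n; exact: measure_ge0. Qed.

Let lebesgue_rV_sigma_additive n : semi_sigma_additive (lebesgue_rV R n).
Proof.
have [m [-> _]] := lebesgue_rV_sfP n.
exact: measure_semi_sigma_additive.
Qed.

HB.instance Definition _ n := isMeasure.Build _ _ _ (lebesgue_rV R n)
  (@lebesgue_rV0 n) (@lebesgue_rV_ge0 n) (@lebesgue_rV_sigma_additive n).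

Let lebesgue_rV_sigma_finite n : sigma_finite setT (lebesgue_rV R n).
Proof. by have [m [-> _]] := lebesgue_rV_sfP n; exact: sigma_finiteT. Qed.

HB.instance Definition _ n := Measure_isSigmaFinite.Build _ _ _
  (lebesgue_rV R n) (@lebesgue_rV_sigma_finite n).

Lemma lebesgue_rV_ball n (x : 'rV[R]_n) (r : R) : 0 < r ->
  lebesgue_rV R n (ball x r) = ((r *+ 2) ^+ n)%:E.
Proof.
move=> r0; elim: n x => [|n IH] x.
  rewrite /= diracE mem_set// (_ : 0 = x); first exact: ballxx.
  by apply/rowP => -[].
rewrite /=; have [m [mE _]] := lebesgue_rV_sfP n.
transitivity (row_mx_measure m (ball x r)).
  rewrite /row_mx_measure /pushforward /product_measure1.
  apply: eq_integral => y _; rewrite mE; congr (m _).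
  by apply/seteqP; split=> z; rewrite /xsection/= inE.
rewrite /row_mx_measure /pushforward preimage_row_mx_ball//.
rewrite product_measure1E; [|exact: measurable_ball
  |by apply: measurable_open_rV; exact: ball_open].
rewrite -mE IH exprS EFinM; congr (_ * _)%E.
by rewrite [LHS]lebesgue_measure_ball ?ltW.
Qed.

End lebesgue_rV.

Section regularity.
Variables (R : realType) (V W : normedModType R).

Definition iter_derive (vs : seq V) (f : V -> W) : V -> W :=
  foldr (fun v g => 'D_v g) f vs.

(* C^oo on an open set of a finite-dimensional space: all the iterated
   directional derivatives are differentiable there. *)
Definition smooth_on (U : set V) (f : V -> W) :=
  forall vs x, U x -> differentiable (iter_derive vs f) x.

Definition C1_on (U : set V) (f : V -> W) :=
  forall x, U x ->
    differentiable f x /\ forall v, {for x, continuous ('D_v f)}.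

(* Absolute continuity on [a, b]. *)
Definition abs_continuous (a b : R) (f : R -> W) :=
  forall e : R, 0 < e -> exists2 delta : R, 0 < delta &
    forall (k : nat) (l r : 'I_k -> R),
      (forall i, a <= l i /\ l i <= r i /\ r i <= b) ->
      (forall i j, i != j -> r i <= l j \/ r j <= l i) ->
      \sum_(i < k) (r i - l i) < delta ->
      \sum_(i < k) `|f (r i) - f (l i)| < e.

End regularity.

Section integration.
Variables (R : realType) (d : nat).

Definition dot (x y : 'rV[R]_d) : R := \sum_(i < d) x 0 i * y 0 i.

(* Vector fields are Borel representatives; every class modulo null sets has
   one. *)
Definition L2 (mu : {measure set 'rV[R]_d -> \bar R}) (D : set 'rV[R]_d)
    (f : 'rV[R]_d -> 'rV[R]_d) :=
  measurable_fun D f /\ (\int[mu]_(x in D) (dot (f x) (f x))%:E < +oo)%E.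

Definition L2loc (f : 'rV[R]_d -> 'rV[R]_d) :=
  measurable_fun setT f /\
  forall K, compact K ->
    (\int[lebesgue_rV R d]_(x in K) (dot (f x) (f x))%:E < +oo)%E.

(* The signed integral of f from 0 to t. *)
Definition integral_from0 (f : R -> R) (t : R) : R :=
  if 0 <= t then \int[lebesgue_measure]_(s in `[0, t]) f s
  else - \int[lebesgue_measure]_(s in `[t, 0]) f s.

End integration.

Section distributions.
Variables (R : realType) (d : nat).
Implicit Types (phi : 'rV[R]_d -> R) (T : ('rV[R]_d -> R) -> R).
Implicit Types (F : 'rV[R]_d) (v h : 'rV[R]_d -> 'rV[R]_d).

Definition test_function phi :=
  smooth_on setT phi /\
  exists2 K, compact K & forall x, ~ K x -> phi x = 0.

Definition partial (i : 'I_d) phi : 'rV[R]_d -> R := 'D_(delta_mx 0 i) phi.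

(* A distribution is given by its values; only those at test functions
   matter. *)
Definition eq_distr T1 T2 := forall phi, test_function phi -> T1 phi = T2 phi.

Definition distr_of (f : 'rV[R]_d -> R) phi : R :=
  \int[lebesgue_rV R d]_x (f x * phi x).

Definition distr_partial (i : 'I_d) T phi : R := - T (partial i phi).

Definition distr_div v phi : R :=
  \sum_(i < d) distr_partial i (distr_of (fun x => v x 0 i)) phi.

(* (F . nabla) v = h in D', componentwise. *)
Definition solves F v h := forall i : 'I_d,
  eq_distr
    (fun phi => \sum_(j < d) F 0 j *
       distr_partial j (distr_of (fun x => v x 0 i)) phi)
    (distr_of (fun x => h x 0 i)).

End distributions.

Section hypersurface.
Variables (R : realType) (d : nat).
Implicit Types (S : set 'rV[R]_d) (F : 'rV[R]_d).
Implicit Types (V : set 'rV[R]_d.-1) (gamma : 'rV[R]_d.-1 -> 'rV[R]_d).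

(* A smooth immersion of the open set V which is a homeomorphism onto an open
   subset of S (last condition: gamma maps open sets to relatively open
   sets). *)
Definition local_param S V gamma :=
  [/\ open V,
      smooth_on V gamma,
      {in V &, injective gamma},
      forall u, V u -> row_free ('J gamma u) &
      forall W, open W -> W `<=` V ->
        exists2 U, open U & gamma @` W = S `&` U].

Definition smooth_hypersurface S := forall x, S x ->
  exists V gamma, local_param S V gamma /\ (gamma @` V) x.

Definition unit_normal S (n : 'rV[R]_d -> 'rV[R]_d) :=
  (forall x, S x -> dot (n x) (n x) = 1) /\
  (forall V gamma, local_param S V gamma ->
   forall u w, V u -> dot (n (gamma u)) ('D_w gamma u) = 0).

(* The surface measure, seen as a Borel measure on R^d carried by S: in each
   local parametrization it has density sqrt (det (Dgamma Dgamma^T)) (rows of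
   'J are the partial derivatives). These conditions determine it uniquely. *)
Definition surface_measure S (sigma : {measure set 'rV[R]_d -> \bar R}) :=
  (forall A, measurable A -> A `&` S = set0 -> sigma A = 0%E) /\
  (forall V gamma, local_param S V gamma ->
   forall A, measurable A -> A `<=` gamma @` V ->
   sigma A = \int[lebesgue_rV R d.-1]_(u in V `&` gamma @^-1` A)
     (Num.sqrt (\det ('J gamma u *m ('J gamma u)^T)))%:E)%E.

Definition flow F (p : 'rV[R]_d * R) : 'rV[R]_d := p.1 + p.2 *: F.

(* flow F is a C^1 diffeomorphism from S x R onto R^d. As S is embedded, a map
   into S x R is C^1 iff it is C^1 as a map into R^d x R. *)
Definition flow_C1_diffeo S F :=
  [/\ set_bij (S `*` setT) setT (flow F),
      forall V gamma, local_param S V gamma ->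
        C1_on (V `*` setT)
          (fun p : 'rV[R]_d.-1 * R => flow F (gamma p.1, p.2)) &
      exists2 g : 'rV[R]_d -> 'rV[R]_d * R, C1_on setT g &
        forall x, S (g x).1 /\ flow F (g x) = x].

(* v|_S = vS for a solution v of (F . nabla) v = h; w is the representative of
   v that is absolutely continuous along almost every line. *)
Definition has_trace S (sigma : {measure set 'rV[R]_d -> \bar R}) F
    (v vS : 'rV[R]_d -> 'rV[R]_d) :=
  exists2 w : 'rV[R]_d -> 'rV[R]_d,
    {ae lebesgue_rV R d, forall x, w x = v x} &
    {ae sigma, forall y, S y ->
      (forall a b : R, abs_continuous a b (fun s : R => w (y + s *: F))) /\
      w y = vS y}.

(* vS (pi x) + int_0^(tau x) h (pi x + s F) ds. *)
Definition transport F (pi : 'rV[R]_d -> 'rV[R]_d) (tau : 'rV[R]_d -> R)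
    (h vS : 'rV[R]_d -> 'rV[R]_d) (x : 'rV[R]_d) : 'rV[R]_d :=
  vS (pi x) +
  \row_(i < d) integral_from0 (fun s => h (pi x + s *: F) 0 i) (tau x).

End hypersurface.

Section distributions_on_hypersurface.
Variables (R : realType) (d : nat).
Implicit Types (S : set 'rV[R]_d) (F : 'rV[R]_d).
Implicit Types (V : set 'rV[R]_d.-1) (gamma : 'rV[R]_d.-1 -> 'rV[R]_d).
Implicit Types (phi : 'rV[R]_d -> R) (psi : 'rV[R]_d * R -> R).
Implicit Types (T TS : ('rV[R]_d -> R) -> R).

(* Functions on S (resp. S x R) with compact support are represented by their
   extension by 0 to R^d (resp. R^d x R). *)
Definition test_function_on S phi :=
  (exists K, [/\ compact K, K `<=` S & forall x, ~ K x -> phi x = 0]) /\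
  (forall V gamma, local_param S V gamma -> smooth_on V (phi \o gamma)).

Definition test_function_on_cylinder S psi :=
  (exists K, [/\ compact K, K `<=` S `*` setT & forall p, ~ K p -> psi p = 0]) /\
  (forall V gamma, local_param S V gamma ->
   smooth_on (V `*` setT)
     (fun p : 'rV[R]_d.-1 * R => psi (gamma p.1, p.2))).

(* phi_ k --> 0 in the space of test functions on S. *)
Definition test_cvg0 S (phi_ : nat -> 'rV[R]_d -> R) :=
  (exists K, [/\ compact K, K `<=` S & forall k x, ~ K x -> phi_ k x = 0]) /\
  (forall V gamma, local_param S V gamma ->
   forall vs L, compact L -> L `<=` V ->
   forall e : R, 0 < e -> \forall k \near \oo,
     forall u, L u -> `|iter_derive vs (phi_ k \o gamma) u| < e).

Definition distribution_on S TS :=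
  (forall (a : R) phi1 phi2, test_function_on S phi1 -> test_function_on S phi2 ->
     TS (fun x => a * phi1 x + phi2 x) = a * TS phi1 + TS phi2) /\
  (forall phi_ : nat -> 'rV[R]_d -> R,
     (forall k, test_function_on S (phi_ k)) -> test_cvg0 S phi_ ->
     TS (phi_ k) @[k --> \oo] --> 0).

(* Pullback by Phi (y, s) = y + s F of a distribution on R^d to S x R, where
   functions are identified with distributions through dx on R^d and through
   d(sigma) ds on S x R: |F . n| is the Jacobian of Phi, and (pi, tau) its
   inverse. *)
Definition pullback F (n pi : 'rV[R]_d -> 'rV[R]_d) (tau : 'rV[R]_d -> R)
    T psi : R :=
  T (fun x => psi (pi x, tau x) / `|dot F (n (pi x))|).

Definition tensor_one TS psi : R :=
  TS (fun y => \int[lebesgue_measure]_s psi (y, s)).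

(* "T = 0 on S" for a distribution T on R^d with (F . nabla) T = 0: the
   distribution TS on S such that the pullback of T is TS (x) 1, which is
   unique, vanishes. *)
Definition vanishes_on S F (n pi : 'rV[R]_d -> 'rV[R]_d) (tau : 'rV[R]_d -> R)
    T :=
  forall TS, distribution_on S TS ->
    (forall psi, test_function_on_cylinder S psi ->
       pullback F n pi tau T psi = tensor_one TS psi) ->
    forall phi, test_function_on S phi -> TS phi = 0.

End distributions_on_hypersurface.

(* Main.v *)
(* On almost every line parallel to [F] the field [h] is locally square
   integrable, so the transport formula is absolutely continuous there and its
   increments along [F] are line integrals of [h]. A field with this property
   solves the equation because a test function and its derivative along [F] are
   related by integrals over short segments, which Fubini's theorem moves from
   the test function to the field.

   Null sets pass between the hypersurface and the space through the charts
   [(u, s) |-> gamma u + s F], which are bi-Lipschitz locally; that Lipschitz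
   maps enlarge Lebesgue measure at most by a constant factor replaces the
   change of variables formula.

   The difference of two solutions is invariant under every translation along
   [F], hence constant on almost every line, and equal traces make it vanish.

   The divergence [T] of a solution kills every [F]-derivative of a test function
   when [h] is divergence free. A test function whose integrals along all the
   lines vanish is such a derivative, so [T] only sees the line integrals of a
   test function, that is, it comes from a distribution on the hypersurface. *)
Require Import Defs.
From HB Require Import structures.
From mathcomp Require Import all_boot all_order all_algebra.
From mathcomp Require Import all_classical all_reals all_analysis.
From mathcomp Require Import ring lra measurable_realfun.
Set Implicit Arguments.
Unset Strict Implicit.
Unset Printing Implicit Defensive.
Import Order.TTheory GRing.Theory Num.Theory.
Import numFieldNormedType.Exports.
Local Open Scope classical_set_scope.
Local Open Scope ring_scope.

(** * Functions with finitely many derivatives *)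

(** The inverse of the flow is given as a $C^1$ map and the normal as a mere function, yet test
    functions have to be carried to the cylinder over [S] and divided by |F . n|. So [pi] and [tau]
    are shown to be smooth in charts: a continuous inverse of a differentiable map with invertible
    differential is differentiable, and its derivatives are again smooth functions of the chart
    coordinate. The factor |F . n| is then expressed through the gradient of [tau]. Integrals over
    parallel segments do the work of convolution: they are smooth, their means over short segments
    tend to the test function, and they express translations and mixed derivatives. Vanishing on the
    hypersurface quantifies over the distributions whose product with 1 is the pullback, so one of
    them has to be exhibited, continuity included. It spreads a test function of [S] along the lines
    by a bump in [tau]. A divergence pairs with first derivatives only, so continuity comes down to
    their uniform convergence on one compact set. *)

Section ksmooth.
Variables (R : realType) (V W : normedModType R).
Implicit Types (U : set V) (f g : V -> W).

(** Product and chain rules turn a derivative into a sum of products, which the list of directions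
    in [smooth_on] does not follow. With a bound on the order, every closure property is an
    induction on [k]. *)
Fixpoint ksmooth (k : nat) U f : Prop :=
  (forall x, U x -> differentiable f x) /\
  match k with 0 => True | k'.+1 => forall v, ksmooth k' U ('D_v f) end.

Lemma ksmooth_diff k U f x : ksmooth k U f -> U x -> differentiable f x.
Proof. by move=> sf Ux; case: k sf => [|k] [df _]; exact: df. Qed.

Lemma ksmoothD k U f v : ksmooth k.+1 U f -> ksmooth k U ('D_v f).
Proof. by case=> _; apply. Qed.

(** [iter_derive] applies the last direction of its list first, whence the use of [rcons] and of
    induction from the right. *)
Lemma ksmoothP U f : smooth_on U f <-> forall k, ksmooth k U f.
Proof.
split=> [sf k|sf vs].
  elim: k f sf => [|k IH] f sf; (split; first exact: (sf [::])) => // v.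
  apply: IH => vs x Ux.
  by have := sf (rcons vs v) x Ux; rewrite /iter_derive foldr_rcons.
suff [k] : exists k, forall f, ksmooth k U f ->
    forall x, U x -> differentiable (iter_derive vs f) x by apply.
elim/last_ind: vs => [|vs v [k IH]].
  by exists 0%N => g [].
exists k.+1 => g [_ /(_ v)]; rewrite /iter_derive foldr_rcons.
exact: IH.
Qed.

Lemma near_eq_diff f g x : (\forall y \near x, f y = g y) ->
  differentiable f x -> differentiable g x /\ forall v, 'D_v f x = 'D_v g x.
Proof.
move=> fg df.
have fgx : f x = g x by exact: nbhs_singleton fg.
have dg : continuous ('d f x) /\ g \o shift x = cst (g x) + 'd f x +o_ 0 id.
  split; first exact: diff_continuous.
  have : f \o shift x = cst (f x) + 'd f x +o_ 0 id by exact: diff_locally.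
  move/eqaddoP => H; apply/eqaddoP => e e0; have := H e e0.
  have fg' : \forall h \near (0 : V), f (h + x) = g (h + x).
    by move: fg; rewrite (near_shift 0) subr0.
  apply: filterS2 fg' => h /= fgh.
  by rewrite !fctE /= fgh fgx.
have dE : 'd g x = 'd f x :> (V -> W) by apply: diff_unique; case: dg.
have dg' : differentiable g x by apply/diff_locallyP; rewrite dE.
split; first exact: dg'.
by move=> v; have := congr1 (fun k => k v) dE; rewrite -(deriveE v df) -(deriveE v dg') => ->.
Qed.

(** The difference quotients agree near 0, hence so do their limits, even where these are only
    default values; differentiability plays no part here. *)
Lemma near_eq_derive_val f g x v : (\forall y \near x, f y = g y) ->
  'D_v f x = 'D_v g x.
Proof.
move=> fg; rewrite /derive; congr (lim _).
have fgx : f x = g x by exact: nbhs_singleton fg.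
have c : (h *: v + x) @[h --> 0^'] --> x.
  apply: (@cvg_trans _ ((fun h : R => h *: v + x) @ nbhs 0)).
    by apply: cvg_fmap2; exact: cvg_within.
  rewrite -{2}(add0r x) -(scale0r v).
  by apply: cvgD; [apply: cvgZr_tmp; exact: cvg_id|exact: cvg_cst].
have fg' : {near 0^', (fun h : R => h^-1 *: ((f \o shift x) (h *: v) - f x)) =1
   (fun h => h^-1 *: ((g \o shift x) (h *: v) - g x))}.
  have := c _ fg; rewrite /= => H; near=> h.
  rewrite /= fgx; congr (_ *: (_ - _)).
  by near: h.
apply/seteqP; split; apply: near_eq_cvg => //.
by apply: filterS fg' => h ->.
Unshelve. all: by end_near. Qed.

Lemma eq_ksmooth k U f g : open U -> {in U, f =1 g} ->
  ksmooth k U f -> ksmooth k U g.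
Proof.
move=> oU; elim: k f g => [|k IH] f g fg [df sf];
  have fgn x : U x -> \forall y \near x, f y = g y.
- by move=> Ux; apply: filterS (open_nbhs_nbhs (conj oU Ux)) => y Uy; apply: fg; rewrite inE.
- by split=> // x Ux; have [] := near_eq_diff (fgn x Ux) (df x Ux).
- by move=> Ux; apply: filterS (open_nbhs_nbhs (conj oU Ux)) => y Uy; apply: fg; rewrite inE.
split=> [x Ux|v]; first by have [] := near_eq_diff (fgn x Ux) (df x Ux).
apply: (IH ('D_v f)); last exact: sf.
by move=> x /set_mem Ux; exact: near_eq_derive_val (fgn x Ux).
Qed.

(** Entry point of the induction steps: a formula for the derivative that is valid on [U] only is
    enough. *)
Lemma ksmoothS k U f : open U -> (forall x, U x -> differentiable f x) ->
  (forall v, exists2 g, ksmooth k U g & {in U, 'D_v f =1 g}) ->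
  ksmooth k.+1 U f.
Proof.
move=> oU df sf; split=> // v.
by have [g sg fg] := sf v; apply: eq_ksmooth sg => // x Ux; rewrite fg.
Qed.

Lemma ksmoothW k U f : ksmooth k.+1 U f -> ksmooth k U f.
Proof.
by elim: k f => [|k IH] f [df sf]; split=> // v; apply: IH.
Qed.

Lemma ksmooth_le j k U f : (j <= k)%N -> ksmooth k U f -> ksmooth j U f.
Proof.
by move=> jk; rewrite -(subnK jk); elim: (k - j)%N => // i IH /ksmoothW.
Qed.

Lemma sub_ksmooth k U U' f : U' `<=` U -> ksmooth k U f -> ksmooth k U' f.
Proof.
move=> UU'; elim: k f => [|k IH] f [df sf]; (split=> [x /UU'|]; first exact: df) => // v.
by apply: IH; exact: sf.
Qed.

Lemma ksmooth_local k U f :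
  (forall x, U x -> exists2 U', U' x & ksmooth k U' f) -> ksmooth k U f.
Proof.
elim: k f => [|k IH] f H; (split=> [x /H[U' U'x [+ _]]|]; first exact) => // v.
by apply: IH => x /H[U' U'x [_ sf]]; exists U' => //; exact: sf.
Qed.

Lemma ksmooth_cst k U (c : W) : open U -> ksmooth k U (fun=> c).
Proof.
move=> oU; elim: k c => [|k IH] c.
  by split=> // x _; exact: differentiable_cst.
apply: ksmoothS => // v.
by exists (fun=> 0) => // x _; rewrite derive_cst.
Qed.

Lemma ksmooth_lin k U (f : {linear V -> W}) : open U -> continuous f ->
  ksmooth k U f.
Proof.
move=> oU cf; have df x : differentiable f x by exact: linear_differentiable.
case: k => [|k]; first by split=> // x _; exact: df.
apply: ksmoothS => // v; exists (fun=> f v) => [|x _]; first exact: ksmooth_cst.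
by rewrite deriveE// diff_lin.
Qed.

Lemma ksmooth_add k U f g : open U -> ksmooth k U f -> ksmooth k U g ->
  ksmooth k U (fun x => f x + g x).
Proof.
move=> oU; elim: k f g => [|k IH] f g [df sf] [dg sg].
  by split=> // x Ux; apply: differentiableD; [exact: df|exact: dg].
apply: ksmoothS => // [x Ux|v].
  by apply: differentiableD; [exact: df|exact: dg].
exists (fun x => 'D_v f x + 'D_v g x); first by apply: IH; [exact: sf|exact: sg].
move=> x /set_mem Ux; apply: deriveD.
  by apply: diff_derivable; exact: df.
by apply: diff_derivable; exact: dg.
Qed.

End ksmooth.

Section ksmooth_scalar.
Variables (R : realType) (V : normedModType R).
Implicit Types (U : set V) (f g : V -> R).

Lemma ksmooth_mul k U f g : open U -> ksmooth k U f -> ksmooth k U g ->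
  ksmooth k U (fun x => f x * g x).
Proof.
move=> oU; elim: k f g => [|k IH] f g sf sg.
  by case: sf sg => df _ [dg _]; split=> // x Ux;
    apply: differentiableM; [exact: df|exact: dg].
have [[df _] [dg _]] := (sf, sg).
apply: ksmoothS => // [x Ux|v].
  by apply: differentiableM; [exact: df|exact: dg].
exists (fun x => f x * 'D_v g x + g x * 'D_v f x).
  apply: ksmooth_add => //; apply: IH; by [exact: ksmoothW|exact: ksmoothD].
move=> x /set_mem Ux; apply: deriveM.
  by apply: diff_derivable; exact: df.
by apply: diff_derivable; exact: dg.
Qed.

Lemma ksmooth_scale k U (c : R) f : open U -> ksmooth k U f ->
  ksmooth k U (fun x => c * f x).
Proof. by move=> oU sf; apply: ksmooth_mul => //; exact: ksmooth_cst. Qed.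

Lemma ksmooth_opp k U f : open U -> ksmooth k U f -> ksmooth k U (fun x => - f x).
Proof.
move=> oU /(ksmooth_scale (-1) oU); apply: eq_ksmooth => // x _.
by rewrite mulN1r.
Qed.

Lemma ksmooth_sub k U f g : open U -> ksmooth k U f -> ksmooth k U g ->
  ksmooth k U (fun x => f x - g x).
Proof. by move=> oU sf sg; apply: ksmooth_add => //; exact: ksmooth_opp. Qed.

Lemma ksmooth_inv k U f : open U -> (forall x, U x -> f x != 0) ->
  ksmooth k U f -> ksmooth k U (fun x => (f x)^-1).
Proof.
move=> oU f0; elim: k f f0 => [|k IH] f f0 sf.
  by case: sf => df _; split=> // x Ux; apply: differentiableV; [exact: df|exact: f0].
have [df _] := sf; apply: ksmoothS => // [x Ux|v].
  by apply: differentiableV; [exact: df|exact: f0].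
exists (fun x => - ((f x)^-1 * (f x)^-1) * 'D_v f x).
  apply: ksmooth_mul => //; last exact: ksmoothD.
  have sfi : ksmooth k U (fun x => (f x)^-1) by apply: IH => //; exact: ksmoothW.
  by apply: ksmooth_opp => //; exact: ksmooth_mul.
move=> x /set_mem Ux; rewrite deriveV; last 2 first.
- exact: f0.
- by apply: diff_derivable; exact: df.
by rewrite expr2 invfM.
Qed.

Lemma ksmooth_sum k U (I : Type) (s : seq I) (P : pred I) (f : I -> V -> R) :
  open U -> (forall i, P i -> ksmooth k U (f i)) ->
  ksmooth k U (fun x => \sum_(i <- s | P i) f i x).
Proof.
move=> oU sf; elim: s => [|i s IH].
  by apply: eq_ksmooth (ksmooth_cst k 0 oU) => // x _; rewrite big_nil.
have [Pi|/negPf Pi] := boolP (P i).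
  apply: eq_ksmooth (ksmooth_add oU (sf i Pi) IH) => // x _.
  by rewrite big_cons Pi.
by apply: eq_ksmooth IH => // x _; rewrite big_cons Pi.
Qed.

Lemma ksmooth_prod k U (I : Type) (s : seq I) (P : pred I) (f : I -> V -> R) :
  open U -> (forall i, P i -> ksmooth k U (f i)) ->
  ksmooth k U (fun x => \prod_(i <- s | P i) f i x).
Proof.
move=> oU sf; elim: s => [|i s IH].
  by apply: eq_ksmooth (ksmooth_cst k (1 : R) oU) => // x _; rewrite big_nil.
have [Pi|/negPf Pi] := boolP (P i).
  apply: eq_ksmooth (ksmooth_mul oU (sf i Pi) IH) => // x _.
  by rewrite big_cons Pi.
by apply: eq_ksmooth IH => // x _; rewrite big_cons Pi.
Qed.

Lemma ksmooth_det k U n (A : V -> 'M[R]_n) : open U ->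
  (forall i j, ksmooth k U (fun x => A x i j)) ->
  ksmooth k U (fun x => \det (A x)).
Proof.
move=> oU sA; rewrite /determinant; apply: ksmooth_sum => // s _.
by apply: ksmooth_scale => //; exact: ksmooth_prod.
Qed.

(** Cramer's rule: the entries of the inverse are cofactors divided by the determinant. *)
Lemma ksmooth_invmx k U n (A : V -> 'M[R]_n) : open U ->
  (forall x, U x -> A x \in unitmx) ->
  (forall i j, ksmooth k U (fun x => A x i j)) ->
  forall i j, ksmooth k U (fun x => invmx (A x) i j).
Proof.
move=> oU uA sA i j.
have : ksmooth k U (fun x => (\det (A x))^-1 * \adj (A x) i j).
  apply: ksmooth_mul => //.
    apply: ksmooth_inv => //; last exact: ksmooth_det.
    by move=> x /uA; rewrite unitmxE unitfE.
  have : ksmooth k U (fun x => cofactor (A x) j i).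
    rewrite /cofactor; apply: ksmooth_scale => //; apply: ksmooth_det => // i' j'.
    by apply: eq_ksmooth (sA (lift j i') (lift i j')) => // x _; rewrite !mxE.
  by apply: eq_ksmooth => // x _; rewrite mxE.
by apply: eq_ksmooth => // x /set_mem /uA Ax; rewrite /invmx Ax !mxE.
Qed.

Lemma ksmooth_sqrt k U f : open U -> (forall x, U x -> 0 < f x) ->
  ksmooth k U f -> ksmooth k U (fun x => Num.sqrt (f x)).
Proof.
move=> oU f0.
have dsq g x : 0 < g x -> differentiable g x ->
    differentiable (fun x : V => Num.sqrt (g x)) x /\
    forall v, 'D_v (fun x => Num.sqrt (g x)) x = (2 * Num.sqrt (g x))^-1 * 'D_v g x.
  move=> gx0 dg.
  have ds := is_derive1_sqrt gx0.
  have dd : differentiable (@Num.sqrt R) (g x).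
    by apply/derivable1_diffP; exact: ex_derive.
  have dc : differentiable ((@Num.sqrt R) \o g) x by exact: differentiable_comp.
  split=> // v; rewrite deriveE// diff_comp//= diff1E//= derive1E derive_val.
  by rewrite (deriveE _ dg) [RHS]mulrC.
elim: k f f0 => [|k IH] f f0 sf.
  by case: sf => df _; split=> // x Ux; have [] := dsq f x (f0 x Ux) (df x Ux).
have [df _] := sf; apply: ksmoothS => // [x Ux|v].
  by have [] := dsq f x (f0 x Ux) (df x Ux).
exists (fun x => (2 * Num.sqrt (f x))^-1 * 'D_v f x).
  apply: ksmooth_mul => //; last exact: ksmoothD.
  apply: ksmooth_inv => //.
    by move=> x /f0 fx; rewrite mulf_neq0// gt_eqF// sqrtr_gt0.
  by apply: ksmooth_scale => //; apply: IH => //; exact: ksmoothW.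
move=> x /set_mem Ux.
by have [_ ->] := dsq f x (f0 x Ux) (df x Ux).
Qed.

End ksmooth_scalar.

(** * Chain rule and differentiability of an inverse map *)

Section composition.
Variables (R : realType) (Z X : normedModType R).

Lemma linear_approx_diff (f : Z -> X) (x : Z) (L : {linear Z -> X}) :
  continuous L ->
  (forall e : R, 0 < e ->
    \forall h \near 0, `|f (h + x) - f x - L h| <= e * `|h|) ->
  differentiable f x /\ forall v, 'D_v f x = L v.
Proof.
move=> cL fL.
have H : f \o shift x = cst (f x) + L +o_ 0 id.
  apply/eqaddoP => e /fL; apply: filterS => h.
  by rewrite /= !fctE /cst /= opprD addrA.
have dE : 'd f x = L :> (Z -> X) by apply: diff_unique.
have df : differentiable f x by apply/diff_locallyP; rewrite dE.
by split=> // v; rewrite deriveE// dE.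
Qed.

Lemma diff_sum_scale (I : Type) (s : seq I) (e : I -> X) (g : I -> Z -> R) z :
  (forall i, differentiable (g i) z) ->
  differentiable (fun z => \sum_(i <- s) g i z *: e i) z /\
  forall v, 'D_v (fun z => \sum_(i <- s) g i z *: e i) z =
            \sum_(i <- s) 'D_v (g i) z *: e i.
Proof.
move=> dg; elim: s => [|i s [IHd IH]].
  rewrite (_ : (fun z : Z => _) = cst 0); last by apply/funext => y; rewrite big_nil.
  by split=> [|v]; [exact: differentiable_cst|rewrite derive_cst big_nil].
have di : differentiable (fun z => g i z *: e i) z by exact: differentiableZl.
rewrite (_ : (fun z : Z => _) = (fun z => g i z *: e i) +
    (fun z => \sum_(j <- s) g j z *: e j)); last first.
  by apply/funext => y; rewrite big_cons.
split=> [|v]; first exact: differentiableD.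
rewrite deriveD; [|exact: diff_derivable..].
by rewrite IH big_cons (deriveE _ di) diffZl// (deriveE _ (dg i)).
Qed.

(** The inner map is a combination of fixed vectors with scalar coefficients, so that the chain rule
    only produces products of scalar functions. Row vectors, product spaces and the line are all
    covered by this form. *)
Lemma ksmooth_comp k (I : finType) (e : I -> X) (g : I -> Z -> R) (G : Z -> X)
    (U : set Z) (U' : set X) (f : X -> R) : open U ->
  (forall z, U z -> G z = \sum_i g i z *: e i) ->
  (forall z, U z -> U' (G z)) ->
  (forall i, ksmooth k U (g i)) -> ksmooth k U' f -> ksmooth k U (f \o G).
Proof.
move=> oU GE GU sg sf.
pose H := fun z => \sum_i g i z *: e i.
suff : ksmooth k U (f \o H).
  by apply: eq_ksmooth => // z /set_mem Uz; rewrite /= GE.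
have {GU} HU z : U z -> U' (H z) by move=> Uz; rewrite /H -GE//; exact: GU.
elim: k f sg sf => [|k IH] f sg sf;
    have dH z : U z -> differentiable H z /\
        forall v, 'D_v H z = \sum_i 'D_v (g i) z *: e i
      by move=> Uz; apply: diff_sum_scale => i; exact: ksmooth_diff (sg i) Uz.
  split=> // z Uz; apply: differentiable_comp; first by case: (dH z Uz).
  by apply: ksmooth_diff sf _; exact: HU.
apply: ksmoothS => // [z Uz|v].
  apply: differentiable_comp; first by case: (dH z Uz).
  by apply: ksmooth_diff sf _; exact: HU.
exists (fun z => \sum_i 'D_v (g i) z * ('D_(e i) f \o H) z).
  apply: ksmooth_sum => // i _; apply: ksmooth_mul => //; first exact: ksmoothD.
  apply: IH; last exact: ksmoothD.
  by move=> j; exact: ksmoothW.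
move=> z /set_mem Uz; have [dHz DH] := dH z Uz.
have dfz : differentiable f (H z) by apply: ksmooth_diff sf _; exact: HU.
rewrite deriveE; last exact: differentiable_comp.
rewrite diff_comp//= -(deriveE _ dHz) DH linear_sum; apply: eq_bigr => i _ /=.
by rewrite linearZ/= (deriveE _ dfz).
Qed.

(* [T] inverts [P] near [y0] and is continuous there; no open mapping argument
   is needed because [T] is given. *)
Lemma diff_inverse (P : X -> Z) (T : Z -> X) (y0 : Z) (L : {linear Z -> X}) :
  continuous L -> {for y0, continuous T} -> differentiable P (T y0) ->
  (forall k, L ('d P (T y0) k) = k) -> (\forall y \near y0, P (T y) = y) ->
  differentiable T y0 /\ forall v, 'D_v T y0 = L v.
Proof.
move=> cL cT dP LK PT.
have [C C0 LC] := linear_lipschitz cL.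
have PT0 : P (T y0) = y0 by exact: nbhs_singleton PT.
apply: linear_approx_diff => // e e0.
(* The first bound lets [|k| <= |L h| + |k| / 2] be solved into [|k| <= 2 * C * |h|]; the second
   then makes the error [C * eps * |k|] at most [e * |h|]. *)
have [eps eps0 [epsC epse]] : exists2 eps : R, 0 < eps &
    C * eps <= 2^-1 /\ C * C * 2 * eps <= e.
  exists (Num.min ((2 * C)^-1) (e / (C * C * 2))).
    by rewrite lt_min invr_gt0 mulr_gt0//= divr_gt0// !mulr_gt0.
  split.
    rewrite (le_trans (_ : _ <= C * (2 * C)^-1))//.
      by rewrite ler_wpM2l ?(ltW C0)// ge_min lexx.
    by rewrite invfM mulrCA divff ?mulr1// gt_eqF.
  rewrite -ler_pdivlMl ?mulr_gt0// [leRHS]mulrC.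
  by rewrite ge_min lexx orbT.
have kc : (fun h => T (h + y0) - T y0) h @[h --> 0] --> (0 : X).
  rewrite -(subrr (T y0)); apply: cvgB; last exact: cvg_cst.
  have sc : (h + y0) @[h --> (0 : Z)] --> 0 + y0.
    by apply: cvgD; [exact: cvg_id|exact: cvg_cst].
  by rewrite add0r in sc; exact: (cvg_comp (fun h : Z => h + y0) T sc cT).
have /eqaddoP/(_ eps eps0)/kc/= Pk' := diff_locally dP.
near=> h.
have : `|P ((T (h + y0) - T y0) + T y0) -
    (P (T y0) + 'd P (T y0) (T (h + y0) - T y0))| <= eps * `|T (h + y0) - T y0|.
  by near: h.
have PTh : P (T (h + y0)) = h + y0.
  by near: h; move: PT; rewrite (near_shift 0) subr0.
set k := T (h + y0) - T y0.
have kE : k + T y0 = T (h + y0) by rewrite /k subrK.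
rewrite kE PTh PT0 opprD addrA addrK => Pk.
have Lk : `|L h - k| <= C * (eps * `|k|).
  rewrite -{1}(LK k) -linearB; apply: (le_trans (LC _)).
  by rewrite ler_wpM2l// ltW.
have k2 : `|k| <= 2 * C * `|h|.
  have : `|k| <= `|L h| + `|L h - k|.
    rewrite -{1}(subKr (L h) k); exact: ler_normB.
  have := LC h; move: Lk.
  have : C * (eps * `|k|) <= 2^-1 * `|k| by rewrite mulrA ler_wpM2r.
  by lra.
rewrite -/k distrC.
apply: (le_trans Lk); apply: (le_trans (_ : _ <= C * (eps * (2 * C * `|h|)))).
  by rewrite ler_pM2l// ler_pM2l.
rewrite (_ : _ * _ = C * C * 2 * eps * `|h|); last by ring.
by rewrite ler_wpM2r.
Unshelve. all: by end_near. Qed.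

End composition.

(** * Mean value theorem in several variables *)

Section mean_value.
Variables (R : realType).

Lemma mean_value (V : normedModType R) (f : V -> R) (x v : V) :
  (forall t : R, 0 <= t <= 1 -> differentiable f (x + t *: v)) ->
  exists2 t : R, 0 <= t <= 1 & f (x + v) - f x = 'D_v f (x + t *: v).
Proof.
move=> df.
have dg (t : R) : 0 <= t <= 1 ->
    is_derive t 1 (fun t : R => f (x + t *: v)) ('D_v f (x + t *: v)).
  move=> t01.
  have dd : differentiable (fun t : R => t *: v) t by exact: differentiableZl.
  have dl : is_derive t 1 (fun t : R => x + t *: v) v.
    rewrite -[X in is_derive _ _ _ X]add0r.
    apply: is_deriveD; apply: DeriveDef; first exact: diff_derivable.
    by rewrite (deriveE _ dd) diffZl//= diff_val scale1r.
  have dl' : differentiable (fun t : R => x + t *: v) t.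
    by apply/derivable1_diffP; exact: ex_derive.
  have dc : differentiable (f \o (fun t : R => x + t *: v)) t.
    by apply: differentiable_comp => //; exact: df.
  apply: DeriveDef; first exact: diff_derivable.
  rewrite -[X in 'D_1 X t]/(f \o (fun t : R => x + t *: v)) deriveE//.
  rewrite diff_comp//=; last exact: df.
  by rewrite -(deriveE _ dl') derive_val deriveE//; exact: df.
have [|t||t tin tE] := @MVT_segment R (fun t => f (x + t *: v))
    (fun t => 'D_v f (x + t *: v)) 0 1.
- exact: ler01.
- by rewrite in_itv/= => /andP[t0 t1]; apply: dg; rewrite !ltW.
- apply: derivable_within_continuous => t; rewrite in_itv/= => t01.
  by have [] := dg _ t01.
- by exists t => //; move: tE; rewrite scale1r scale0r addr0 subr0 mulr1.
Qed.

Variable n : nat.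

Lemma derive_coord (f : 'rV[R]_n -> R) x (v : 'rV[R]_n) : differentiable f x ->
  'D_v f x = \sum_i v 0 i * 'D_(delta_mx 0 i) f x.
Proof.
move=> df; rewrite deriveE// {1}(row_sum_delta v) linear_sum.
by apply: eq_bigr => i _; rewrite linearZ/= deriveE.
Qed.

Lemma coord_le_norm (v : 'rV[R]_n) i : `|v 0 i| <= `|v|.
Proof.
by rewrite [leRHS]mx_normrE (le_bigmax _ (fun ij : 'I_1 * 'I_n => `|v ij.1 ij.2|) (0, i)).
Qed.

Lemma derive_coord_dist (f : 'rV[R]_n -> R) x y (v : 'rV[R]_n) :
  differentiable f x -> differentiable f y ->
  `|'D_v f x - 'D_v f y| <=
  `|v| * \sum_i `|'D_(delta_mx 0 i) f x - 'D_(delta_mx 0 i) f y|.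
Proof.
move=> dfx dfy; rewrite !derive_coord// -sumrB mulr_sumr.
apply: (le_trans (ler_norm_sum _ _ _)); apply: ler_sum => i _.
by rewrite -mulrBr normrM ler_wpM2r// coord_le_norm.
Qed.

End mean_value.

(** * Integrals along parallel segments *)

Lemma cvg_sumr (R : realType) (V : normedModType R) T (F : set_system T)
    (FF : Filter F) (I : Type) (s : seq I) (f : I -> T -> V) (a : I -> V) :
  (forall i, f i x @[x --> F] --> a i) ->
  (\sum_(i <- s) f i x) @[x --> F] --> \sum_(i <- s) a i.
Proof.
by move=> fa; apply: (@cvg_big _ _ _ _ _ _ _ F _ _ _ FF) => //; exact: add_continuous.
Qed.

Section lipschitz.
Variables (R : realType) (n : nat).

Lemma ball_segment (V : normedModType R) (x y z : V) (r t : R) :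
  ball x r y -> ball x r z -> 0 <= t <= 1 -> ball x r (y + t *: (z - y)).
Proof.
rewrite -ball_normE/= => xy xz /andP[t0 t1].
have -> : x - (y + t *: (z - y)) = (1 - t) *: (x - y) + t *: (x - z).
  rewrite scalerBl scale1r -addrA [- _ + _]addrC -scalerBr opprB.
  rewrite [x - z + _]addrC subrKA opprD addrA -scalerN opprB.
  by [].
apply: (le_lt_trans (ler_normD _ _)); rewrite !normrZ.
rewrite (ger0_norm t0) ger0_norm ?subr_ge0//.
have [->|tn0] := eqVneq t 0; first by rewrite subr0 mul1r mul0r addr0.
have tp : 0 < t by rewrite lt_neqAle eq_sym tn0.
have A : (1 - t) * `|x - y| <= (1 - t) * r by rewrite ler_wpM2l ?subr_ge0// ltW.
have B : t * `|x - z| < t * r by rewrite ltr_pM2l.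
by lra.
Qed.

Lemma norm_coord_le (v : 'rV[R]_n) (c : R) : 0 <= c ->
  (forall i, `|v 0 i| <= c) -> `|v| <= c.
Proof.
move=> c0 vc; rewrite [leLHS]mx_normrE; apply: bigmax_le => // -[i j] _ /=.
by rewrite (ord1 i).
Qed.

(** Mean value theorem on segments inside a ball where the partial derivatives stay bounded. For the
    sup norm the relevant bound is the sum of their absolute values. *)
Lemma ksmooth_lipschitz (I : finType) (f : I -> 'rV[R]_n -> R) U x :
  open U -> U x -> (forall i, ksmooth 1 U (f i)) ->
  exists L r, [/\ 0 < L, 0 < r, ball x r `<=` U &
    forall y z, ball x r y -> ball x r z ->
      forall i, `|f i y - f i z| <= L * `|y - z| ].
Proof.
move=> oU Ux sf.
pose N i y := \sum_j `|'D_(delta_mx 0 j) (f i) y|.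
(* Strictly larger than each [N i x], so that continuity gives [N i <= L] near [x]; the leading 1
   keeps it positive when the family is empty. *)
pose L := 1 + \sum_i (N i x + 1).
have N0 i y : 0 <= N i y by apply: sumr_ge0.
have NL : \forall y \near x, forall i, N i y <= L.
  have := @filter_forall _ _ (fun i y => N i y <= L) (nbhs x) _; apply => i.
  have cN : {for x, continuous (N i)}.
    apply: (@cvg_sumr _ _ _ (nbhs x) _) => j.
    have cD : {for x, continuous ('D_(delta_mx 0 j) (f i))}.
      apply: differentiable_continuous.
      exact: ksmooth_diff (ksmoothD (delta_mx 0 j) (sf i)) Ux.
    exact: (cvg_norm cD).
  have : N i x < L.
    rewrite /L (bigD1 i)//=.
    have : 0 <= \sum_(k | k != i) (N k x + 1) by apply: sumr_ge0 => k _; rewrite addr_ge0.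
    by lra.
  by move=> /(cvgr_lt _ cN); apply: filterS => y /ltW.
have : nbhs x ([set y | forall i, N i y <= L] `&` U).
  by apply: filterI => //; exact: open_nbhs_nbhs.
move=> /nbhs_ballP[r /= r0 rU].
exists L, r; split=> //.
- by rewrite /L ltr_pwDl// sumr_ge0// => i _; rewrite addr_ge0.
- by move=> y /rU[].
move=> y z xy xz i.
have seg t : 0 <= t <= 1 -> ball x r (z + t *: (y - z)) by exact: ball_segment.
have [t|t t01] := @mean_value _ _ (f i) z (y - z).
  by move=> /seg/rU[_ Ut]; exact: ksmooth_diff (sf i) Ut.
rewrite [z + (_ - _)]addrC subrK => ->.
have /rU[NLt Ut] := seg t t01.
rewrite derive_coord; last exact: ksmooth_diff (sf i) Ut.
apply: (le_trans (ler_norm_sum _ _ _)).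
apply: (@le_trans _ _ (`|y - z| * N i (z + t *: (y - z)))).
  by rewrite /N mulr_sumr ler_sum// => j _; rewrite normrM ler_wpM2r// coord_le_norm.
by rewrite mulrC ler_wpM2r.
Qed.

End lipschitz.

Lemma Rintegral_sum d (T : measurableType d) (R : realType)
    (mu : {measure set T -> \bar R}) (D : set T) (I : Type) (s : seq I)
    (f : I -> T -> R) : measurable D ->
  (forall i, mu.-integrable D (EFin \o f i)) ->
  mu.-integrable D (EFin \o (fun x => \sum_(i <- s) f i x)) /\
  \int[mu]_(x in D) (\sum_(i <- s) f i x) = \sum_(i <- s) \int[mu]_(x in D) f i x.
Proof.
move=> mD fi; elim: s => [|i s [IHi IH]].
  rewrite (_ : (fun x => _) = cst 0); last by apply/funext => x; rewrite big_nil.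
  by rewrite big_nil Rintegral_cst// mul0r; split => //; exact: integrable0.
rewrite (_ : (fun x => _) = (fun x => f i x + \sum_(j <- s) f j x)); last first.
  by apply/funext => x; rewrite big_cons.
rewrite RintegralD// big_cons IH; split=> //.
exact: (integrableD mD (fi i) IHi).
Qed.

Section line_integral.
Variables (R : realType) (n : nat).
Implicit Types (f : 'rV[R]_n -> R) (e v z : 'rV[R]_n).

(* Used to differentiate under the integral sign: all the segments being
   parallel, every derivative of [f] is integrated along the same lines. *)
Definition line_int e (B : R) f z : R :=
  \int[lebesgue_measure]_(r in `[0, B]) f (z + r *: e).

Lemma affine_continuous (V : normedModType R) (z e : V) :
  continuous (fun r : R => z + r *: e).
Proof.
move=> r; apply: cvgD; first exact: cvg_cst.
by apply: cvgZr_tmp; exact: cvg_id.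
Qed.

Lemma line_continuous f e z : continuous f -> continuous (fun r : R => f (z + r *: e)).
Proof.
move=> cf r; apply: (cvg_comp (fun r : R => z + r *: e) f); last exact: cf.
exact: affine_continuous.
Qed.

Lemma line_integrable f e z B : continuous f ->
  lebesgue_measure.-integrable `[0, B] (EFin \o (fun r : R => f (z + r *: e))).
Proof.
move=> cf; apply: continuous_compact_integrable; first exact: segment_compact.
by apply: continuous_subspaceT; exact: line_continuous.
Qed.

Lemma ksmooth_continuous k f : ksmooth k setT f -> continuous f.
Proof. by move=> sf x; apply: differentiable_continuous; exact: ksmooth_diff sf _. Qed.

(** The first-order error of [f] is uniformly small along the compact segment, and integrating it
    costs a factor [B]. The candidate differential is written with the integrals of the partial
    derivatives, which makes its linearity and continuity evident. *)
Lemma line_int_diff f e B z : 0 <= B -> ksmooth 1 setT f ->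
  differentiable (line_int e B f) z /\
  forall v, 'D_v (line_int e B f) z = line_int e B ('D_v f) z.
Proof.
move=> B0 sf.
have df x : differentiable f x by exact: ksmooth_diff sf _.
have cD v : continuous ('D_v f) by exact: ksmooth_continuous (ksmoothD v sf).
have cf : continuous f by exact: ksmooth_continuous sf.
pose c := \col_i line_int e B ('D_(delta_mx 0 i) f) z.
pose L : 'rV[R]_n -> R := fun k => (k *m c) 0 0.
have LE k : L k = line_int e B ('D_k f) z.
  rewrite /L mxE /line_int.
  under [RHS]eq_Rintegral do rewrite derive_coord//.
  have [//|i|_ ->] := @Rintegral_sum _ _ R lebesgue_measure `[0, B] _ (index_enum 'I_n)
    (fun i r => k 0 i * 'D_(delta_mx 0 i) f (z + r *: e)).
    by apply: (integrableZl _ (k 0 i) (line_integrable e z B (cD (delta_mx 0 i)))).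
  apply: eq_bigr => i _; rewrite mxE RintegralZl//.
  exact: (line_integrable e z B (cD _)).
have Llin : linear L.
  by move=> a u v; rewrite /L mulmxDl -scalemxAl !mxE.
pose Ll := GRing.isLinear.Build _ _ _ _ L Llin.
pose LL : {linear 'rV[R]_n -> R} := HB.pack L Ll.
have cL : continuous LL.
  move=> k; rewrite /LL/= /L.
  have -> : (fun k : 'rV[R]_n => (k *m c) 0 0) = (fun k => \sum_j k 0 j * c j 0).
    by apply/funext => j; rewrite mxE.
  apply: (@cvg_sumr _ _ _ (nbhs k) _) => j.
  by apply: cvgMl; exact: coord_continuous.
have [] := @linear_approx_diff _ _ _ (line_int e B f) z LL cL; last first.
  by move=> ? H; split=> // v; rewrite H -LE.
move=> eps eps0.
pose d := eps / (B + 1) / (n%:R + 1) / 2.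
have d0 : 0 < d by rewrite !divr_gt0// ltr_wpDl// ler0n.
have key : \forall k \near (0 : 'rV[R]_n), `[0, B] `<=` (fun r : R =>
    `|f (k + z + r *: e) - f (z + r *: e) - 'D_k f (z + r *: e)| <=
    eps / (B + 1) * `|k|).
  have /compact_near_coveringP ncov := @segment_compact R 0 B.
  have := ncov _ (nbhs (0 : 'rV[R]_n)) (fun k r =>
    `|f (k + z + r *: e) - f (z + r *: e) - 'D_k f (z + r *: e)| <=
    eps / (B + 1) * `|k|) _.
  apply => r0 _ /=.
  have nb : \forall y \near z + r0 *: e, forall i,
      `|'D_(delta_mx 0 i) f y - 'D_(delta_mx 0 i) f (z + r0 *: e)| <= d.
    have := @filter_forall _ _ (fun i y => `|'D_(delta_mx 0 i) f y -
      'D_(delta_mx 0 i) f (z + r0 *: e)| <= d) (nbhs (z + r0 *: e)) _.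
    apply => i.
    have /cvgrPdist_le/(_ d d0) := cD (delta_mx 0 i) (z + r0 *: e).
    by apply: filterS => y; rewrite distrC.
  have /nbhs_ballP[rho /= rho0 rhoP] := nb.
  have cr : \forall r \near r0, ball (z + r0 *: e) (rho / 2) (z + r *: e).
    have := @affine_continuous _ z e r0.
    move=> /cvgrPdist_lt/(_ (rho / 2)); rewrite divr_gt0// => /(_ isT).
    by rewrite -ball_normE.
  have k0 : \forall k \near (0 : 'rV[R]_n), `|k| < rho / 2.
    by apply: (@nbhs0_lt R 'rV[R]_n); exact: divr_gt0.
  near=> r k => /=.
  have kr : `|k| < rho / 2.
    by near: k; exact: k0.
  have br : ball (z + r0 *: e) (rho / 2) (z + r *: e) by near: r.
  have bk : forall t, 0 <= t <= 1 -> ball (z + r0 *: e) rho (z + r *: e + t *: k).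
    move=> t /andP[t0 t1]; rewrite (splitr rho).
    apply: (ball_triangle br); rewrite -ball_normE/= opprD addrA subrr sub0r normrN.
    rewrite normrZ ger0_norm//; apply: le_lt_trans kr.
    by rewrite ler_piMl.
  have [t|t t01] := @mean_value _ _ f (z + r *: e) k; first by move=> _; exact: df.
  rewrite [k + z]addrC addrAC => ->.
  apply: (le_trans (derive_coord_dist _ (df _) (df _))).
  rewrite mulrC ler_wpM2r//.
  apply: (@le_trans _ _ (\sum_(i < n) (d + d))).
    apply: ler_sum => i _.
    rewrite -(subrKA ('D_(delta_mx 0 i) f (z + r0 *: e))).
    apply: (le_trans (ler_normD _ _)); apply: lerD; first exact: (rhoP _ (bk t t01)).
    rewrite distrC; apply: (rhoP _ _).
    by apply: le_ball br; rewrite ler_pdivrMr// ler_pMr// ler1n.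
  rewrite sumr_const card_ord /d -splitr -[leLHS]mulr_natr -[leLHS]mulrA.
  rewrite ler_piMr//.
    by rewrite divr_ge0// ?ltW// ltr_wpDl.
  by rewrite mulrC ler_pdivrMr ?ltr_wpDl// mul1r lerDl.
apply: filterS key => k key.
rewrite [LL k]LE.
rewrite /line_int -RintegralB//; last 2 first.
- exact: line_integrable.
- exact: line_integrable.
rewrite -RintegralB//; last 2 first.
- exact: (integrableB _ (line_integrable e (k + z) B cf) (line_integrable e z B cf)).
- exact: (line_integrable e z B (cD k)).
have int3 : lebesgue_measure.-integrable `[0, B] (EFin \o (fun r : R =>
   f (k + z + r *: e) - f (z + r *: e) - 'D_k f (z + r *: e))).
  exact: (integrableB _ (integrableB _ (line_integrable e (k + z) B cf)
    (line_integrable e z B cf)) (line_integrable e z B (cD k))).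
apply: (le_trans (le_normr_Rintegral _ int3)) => //.
apply: (@le_trans _ _ (\int[lebesgue_measure]_(r in `[0, B]) (cst (eps / (B + 1) * `|k|) r))).
  apply: le_Rintegral => //.
  + exact: integrable_norm.
  + apply: continuous_compact_integrable; first exact: segment_compact.
    by apply: continuous_subspaceT => ?; exact: cvg_cst.
rewrite Rintegral_cst//= lebesgue_measure_itv/= lte_fin.
case: ifPn => [Bp|_]; last by rewrite mulr0 mulr_ge0// ltW.
rewrite -EFinD/= subr0.
rewrite -!mulrA ler_pM2l// mulrCA ler_piMr//.
by rewrite mulrC ler_pdivrMr ?ltr_wpDl// mul1r lerDl.
Unshelve. all: by end_near. Qed.

Lemma line_derivable f e z t : differentiable f (z + t *: e) ->
  is_derive t 1 (fun r : R => f (z + r *: e)) ('D_e f (z + t *: e)).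
Proof.
move=> df.
have dd : differentiable (fun t : R => t *: e) t by exact: differentiableZl.
have dl : is_derive t 1 (fun t : R => z + t *: e) e.
  rewrite -[X in is_derive _ _ _ X]add0r.
  apply: is_deriveD; apply: DeriveDef; first exact: diff_derivable.
  by rewrite (deriveE _ dd) diffZl//= diff_val scale1r.
have dl' : differentiable (fun t : R => z + t *: e) t.
  by apply/derivable1_diffP; exact: ex_derive.
have dc : differentiable (f \o (fun t : R => z + t *: e)) t.
  exact: differentiable_comp.
apply: DeriveDef; first exact: diff_derivable.
rewrite -[X in 'D_1 X t]/(f \o (fun t : R => z + t *: e)) deriveE//.
rewrite diff_comp//=.
by rewrite -(deriveE _ dl') derive_val deriveE.
Qed.

Lemma line_int_derive f e B z : 0 <= B -> ksmooth 1 setT f ->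
  line_int e B ('D_e f) z = f (z + B *: e) - f z.
Proof.
rewrite le_eqVlt => /predU1P[<- _|B0 sf].
  by rewrite /line_int set_itv1 Rintegral_set1 scale0r addr0 subrr.
have df x : differentiable f x by exact: ksmooth_diff sf _.
have cf : continuous f by exact: ksmooth_continuous sf.
have cD : continuous ('D_e f) by exact: ksmooth_continuous (ksmoothD e sf).
have cw : {within `[0, B], continuous (fun r : R => 'D_e f (z + r *: e))}.
  by apply: continuous_subspaceT; exact: (@line_continuous _ e z cD).
have dF : derivable_oo_LRcontinuous (fun r : R => f (z + r *: e)) 0 B.
  split.
  + by move=> t _; have [] := line_derivable (df (z + t *: e)).
  + by apply: cvg_at_right_filter; exact: (@line_continuous _ e z cf).
  + by apply: cvg_at_left_filter; exact: (@line_continuous _ e z cf).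
rewrite /line_int /Rintegral (continuous_FTC2 B0 cw dF)/=; first by rewrite scale0r addr0.
move=> t _; rewrite derive1E.
by have [_ ->] := line_derivable (df (z + t *: e)).
Qed.

Lemma ksmooth_line_int k e B f : 0 <= B -> ksmooth k.+1 setT f ->
  ksmooth k setT (line_int e B f).
Proof.
move=> B0; elim: k f => [|k IH] f sf.
  by split=> // x _; have [] := line_int_diff e x B0 sf.
have s1 : ksmooth 1 setT f by exact: ksmooth_le sf.
apply: ksmoothS => [|x _|v]; first exact: openT.
  by have [] := line_int_diff e x B0 s1.
exists (line_int e B ('D_v f)).
  by apply: IH; exact: ksmoothD.
by move=> x _; have [_ ->] := line_int_diff e x B0 s1.
Qed.

(* Schwarz's theorem: the derivative along [e] is the rate of growth of a line
   integral along [e], which can be differentiated along [v] under the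
   integral sign. *)
Lemma derive_comm f e v z : ksmooth 2 setT f ->
  'D_v ('D_e f) z = 'D_e ('D_v f) z.
Proof.
move=> sf.
have sD w : ksmooth 1 setT ('D_w f) by exact: ksmoothD.
have cDD w w' : continuous ('D_w ('D_w' f)).
  exact: ksmooth_continuous (ksmoothD w (sD w')).
have df x : differentiable f x by exact: ksmooth_diff sf _.
(* The segment starts at [z - e], so that [z] is its interior point [r = 1], where the vanishing
   primitive of [g] has a two-sided derivative. *)
pose g r : R := 'D_v ('D_e f) (z - e + r *: e) - 'D_e ('D_v f) (z - e + r *: e).
have intg B : 0 <= B -> \int[lebesgue_measure]_(r in `[0, B]) g r = 0.
  move=> B0; rewrite /g RintegralB//; last 2 first.
  - exact: (line_integrable e _ B (cDD _ _)).
  - exact: (line_integrable e _ B (cDD _ _)).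
  apply/eqP; rewrite subr_eq0; apply/eqP.
  rewrite [RHS](line_int_derive e (z - e) B0 (sD v)).
  rewrite -[LHS]/(line_int e B ('D_v ('D_e f)) (z - e)).
  have [_ <-] := line_int_diff e (z - e) B0 (sD e).
  have -> : line_int e B ('D_e f) = (fun x => f (x + B *: e)) - f.
    by apply/funext => x; rewrite line_int_derive//; exact: ksmoothW.
  have ds : is_derive (z - e) v (fun x => f (x + B *: e)) ('D_v f (z - e + B *: e)).
    have dsh : is_diff (z - e) (fun x : 'rV[R]_n => x + B *: e) (id + cst 0).
      by apply: is_diffD.
    have dc : differentiable (f \o (fun x : 'rV[R]_n => x + B *: e)) (z - e).
      by apply: differentiable_comp => //; exact: df.
    apply: DeriveDef; first exact: diff_derivable.
    rewrite -[X in 'D_v X _]/(f \o (fun x : 'rV[R]_n => x + B *: e)) deriveE//.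
    rewrite (diff_comp _ (df _))//= diff_val/=.
    by rewrite (deriveE _ (df _)) fctE /cst addr0.
  rewrite deriveB; [|exact: ex_derive|exact: diff_derivable].
  by rewrite derive_val.
have cg : continuous g.
  move=> r; apply: cvgB; first exact: (@line_continuous _ e (z - e) (cDD v e) r).
  exact: (@line_continuous _ e (z - e) (cDD e v) r).
have int2 : lebesgue_measure.-integrable `[0, 2] (EFin \o g).
  apply: continuous_compact_integrable; first exact: segment_compact.
  exact: continuous_subspaceT.
have [_] := @continuous_FTC1_closed R g 0 1 2 (ltr_nat _ 1 2) int2 ltr01 (cg 1).
rewrite derive1E => gE.
have : 'D_1 (fun x : R => \int[lebesgue_measure]_(t in `[0, x]) g t) 1 = 0 :> R.
  rewrite (@near_eq_derive_val _ _ _ _ (cst 0)) ?derive_cst//.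
  near=> x; apply: intg.
  apply: ltW; near: x; exact: lt_nbhsr.
rewrite gE /g scale1r subrK => /eqP; rewrite subr_eq0 => /eqP.
exact.
Unshelve. all: by end_near. Qed.

End line_integral.

(** * Bump functions *)

Section bump.
Variable R : realType.

(* The derivatives of [exp (-1/t)] are combinations of the functions
   [t^-n exp (-1/t)], all of them extended by 0 to [t <= 0]. *)
Definition flat (n : nat) (t : R) : R :=
  if 0 < t then t ^- n * expR (- t^-1) else 0.

Lemma flat_ge0 n t : 0 <= flat n t.
Proof.
rewrite /flat; case: ifPn => // t0.
by rewrite mulr_ge0 ?invr_ge0 ?exprn_ge0 ?expR_ge0// ltW.
Qed.

Lemma flat_npos n t : t <= 0 -> flat n t = 0.
Proof. by rewrite /flat leNgt => /negPf ->. Qed.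

(** One term of the exponential series gives $e^{1/t} \ge t^{-(n+2)} / (n+2)!$ for positive $t$. The
    two extra powers of $t$ make the derivative at 0 vanish. *)
Lemma flat_le n t : flat n t <= n.+2`!%:R * t ^+ 2.
Proof.
rewrite /flat; case: ifPn => t0; last by rewrite mulr_ge0 ?sqr_ge0 ?ler0n.
have tn0 : t != 0 by rewrite gt_eqF.
have f0 : 0 < n.+2`!%:R :> R by rewrite ltr0n fact_gt0.
have ti0 : 0 <= t^-1 by rewrite invr_ge0 ltW.
have : t^-1 ^+ n.+2 / n.+2`!%:R <= expR t^-1.
  by apply: le_trans (expR_ge1Dxn n.+1 ti0); rewrite lerDr.
rewrite ler_pdivrMr// => H.
rewrite expRN ler_pdivrMr ?expR_gt0//.
have -> : t ^- n = t ^+ 2 * t^-1 ^+ n.+2.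
  by rewrite -(addn2 n) exprD mulrCA -exprMn divff// expr1n mulr1 exprVn.
have : t ^+ 2 * t^-1 ^+ n.+2 <= t ^+ 2 * (expR t^-1 * n.+2`!%:R).
  by rewrite ler_pM2l// exprn_gt0.
by move/le_trans; apply; rewrite le_eqVlt; apply/orP; left; apply/eqP; ring.
Qed.

Lemma flat_diff n t : differentiable (flat n) t /\
  forall v, 'D_v (flat n) t = v * (flat n.+2 t - n%:R * flat n.+1 t).
Proof.
have [t0|t0|<-] := ltgtP 0 t.
- pose g s : R := (s ^+ n)^-1 * expR (- s^-1).
  have tn0 : t != 0 by rewrite gt_eqF.
  have tnn0 : t ^+ n != 0 by rewrite expf_neq0.
  have dg : is_derive t 1 g (flat n.+2 t - n%:R * flat n.+1 t).
    have d1 : is_derive t 1 (fun s : R => (s ^+ n)^-1) (- (t ^+ n) ^- 2 *: (n%:R * t ^+ n.-1)).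
      apply: is_deriveV => //.
      have := DeriveDef (@exprn_derivable R n t 1) (exp_derive n t 1).
      by rewrite /= [_ *: 1]mulr1.
    have d2 : is_derive t 1 (fun s : R => - s^-1) (- (- t ^- 2 *: 1)).
      by apply: is_deriveN; apply: is_deriveV.
    have d3 : is_derive t 1 (fun s : R => expR (- s^-1)) (expR (- t^-1) * - (- t ^- 2 *: 1)).
      exact: (is_derive1_comp (is_derive_expR _) d2).
    apply: is_derive_eq (is_deriveM d1 d3) _; rewrite /flat t0 /=.
    rewrite /GRing.scale/= !mulr1 !exprS; case: n {d1 g} tnn0 => [|m] tnn0 /=.
      by rewrite !mul0r expr0; field.
    by rewrite !exprS in tnn0 *; have : t ^+ m != 0 by [rewrite expf_neq0]; move=> ?; field; apply/andP; split.
  have gf : \forall s \near t, g s = flat n s.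
    by near=> s; rewrite /g /flat ifT//; near: s; exact: lt_nbhsr.
  have dgt : differentiable g t by apply/derivable1_diffP; exact: ex_derive.
  have [df Df] := near_eq_diff gf dgt; split=> // v.
  by rewrite -Df deriveE// diff1E//= derive1E derive_val.
- have gf : \forall s \near t, cst 0 s = flat n s.
    near=> s; rewrite /cst flat_npos//; near: s.
    have := @lt_nbhsl R t 0 t0; apply: filterS => s; exact: ltW.
  have [df Df] := near_eq_diff gf (differentiable_cst 0 t); split=> // v.
  by rewrite -Df derive_cst !flat_npos ?ltW// mulr0 subr0 mulr0.
- have [||df Df] := @linear_approx_diff R R R (flat n) 0 \0.
  + exact: cst_continuous.
  + move=> e e0; near=> h; rewrite addr0 (@flat_npos n 0)// !subr0/=.
    rewrite ger0_norm ?flat_ge0//; apply: (le_trans (flat_le _ _)).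
    rewrite -(real_normK (num_real h)) expr2 mulrA.
    rewrite ler_wpM2r// mulrC -ler_pdivlMr ?ltr0n ?fact_gt0//.
    near: h; apply: (@nbhs0_le R R); rewrite divr_gt0// ltr0n fact_gt0.
  + by split=> // v; rewrite Df/= !flat_npos// mulr0 subr0 mulr0.
Unshelve. all: by end_near. Qed.

Lemma ksmooth_flat k n : ksmooth k setT (flat n).
Proof.
elim: k n => [|k IH] n; first by split=> // x _; have [] := flat_diff n x.
apply: ksmoothS => [|x _|v]; first exact: openT.
  by have [] := flat_diff n x.
exists (fun t => v * (flat n.+2 t - n%:R * flat n.+1 t)).
  have oT : open [set: R] by exact: openT.
  exact: (ksmooth_scale v oT (ksmooth_sub oT (IH n.+2) (ksmooth_scale n%:R oT (IH n.+1)))).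
by move=> x _; have [] := flat_diff n x.
Qed.

Lemma ksmooth_comp1 (V : normedModType R) k (U : set V) (g : V -> R) (f : R -> R) :
  open U -> ksmooth k U g -> ksmooth k setT f -> ksmooth k U (f \o g).
Proof.
move=> oU sg sf.
apply: (@ksmooth_comp R V R k unit (fun=> 1) (fun=> g) g U setT) => // z _.
by rewrite big_const card_unit/= addr0 [RHS]mulr1.
Qed.

Lemma flat0_le1 t : flat 0 t <= 1.
Proof.
rewrite /flat expr0 invr1 mul1r; case: ifPn => // t0.
by rewrite expR_le1 oppr_le0 invr_ge0 ltW.
Qed.

Lemma flat0_gt0 t : 0 < t -> 0 < flat 0 t.
Proof. by move=> t0; rewrite /flat t0 expr0 invr1 mul1r expR_gt0. Qed.

Lemma flat0_cvg1 t : 0 < t -> flat 0 (k%:R * t) @[k --> \oo] --> (1 : R).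
Proof.
move=> t0.
have : expR (- (k.+1%:R^-1 * t^-1)) @[k --> \oo] --> expR (0 : R).
  have H : (- (k.+1%:R^-1 * t^-1)) @[k --> \oo] --> (- (0 * t^-1) : R).
    by apply: cvgN; apply: cvgM; [exact: cvg_harmonic|exact: cvg_cst].
  rewrite mul0r oppr0 in H.
  exact: (cvg_comp _ _ H (@continuous_expR R 0)).
rewrite expR0 => H; rewrite -(cvg_shiftS (fun k => flat 0 (k%:R * t))).
apply: cvg_trans H; apply: near_eq_cvg; apply: nearW => k.
by rewrite /= /flat mulr_gt0// expr0 invr1 mul1r invfM.
Qed.

Variable n : nat.

(** Balls of the sup norm are cubes, hence one factor for each face. As [k] grows the bumps tend to
    the indicator function of the ball; a nonpositive radius, whose ball is empty, gives 0. *)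
Definition box_bump (c : 'rV[R]_n) (r : R) (k : nat) (x : 'rV[R]_n) : R :=
  if 0 < r then
    \prod_i (flat 0 (k%:R * (x 0 i - c 0 i + r)) *
             flat 0 (k%:R * (c 0 i + r - x 0 i)))
  else 0.

Lemma ksmooth_coord j (U : set 'rV[R]_n) i : open U -> ksmooth j U (fun x => x 0 i).
Proof.
move=> oU.
have clin : linear (fun x : 'rV[R]_n => x 0 i) by move=> a u v; rewrite !mxE.
pose Ll := GRing.isLinear.Build _ _ _ _ (fun x : 'rV[R]_n => x 0 i) clin.
pose LL : {linear 'rV[R]_n -> R} := HB.pack (fun x : 'rV[R]_n => x 0 i) Ll.
have := @ksmooth_lin R _ _ j U LL oU; apply; exact: coord_continuous.
Qed.

Lemma ksmooth_box_bump j c r k : ksmooth j setT (box_bump c r k).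
Proof.
have oT : open [set: 'rV[R]_n] by exact: openT.
case r0 : (0 < r); last first.
  have -> : box_bump c r k = (fun=> 0) by apply/funext => x; rewrite /box_bump r0.
  exact: ksmooth_cst.
have -> : box_bump c r k = (fun x : 'rV[R]_n => \prod_i
    (flat 0 (k%:R * (x 0 i - c 0 i + r)) * flat 0 (k%:R * (c 0 i + r - x 0 i)))).
  by apply/funext => x; rewrite /box_bump r0.
apply: ksmooth_prod => // i _; apply: ksmooth_mul => //.
  apply: (ksmooth_comp1 (g := fun x : 'rV[R]_n => k%:R * (x 0 i - c 0 i + r))) => //.
    apply: ksmooth_scale => //; apply: ksmooth_add => //; last exact: ksmooth_cst.
    by apply: ksmooth_sub => //; [exact: ksmooth_coord|exact: ksmooth_cst].
  exact: ksmooth_flat.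
apply: (ksmooth_comp1 (g := fun x : 'rV[R]_n => k%:R * (c 0 i + r - x 0 i))) => //.
  apply: ksmooth_scale => //; apply: ksmooth_sub => //; first exact: ksmooth_cst.
  exact: ksmooth_coord.
exact: ksmooth_flat.
Qed.

Lemma box_bump_itv c r k x : 0 <= box_bump c r k x <= 1.
Proof.
rewrite /box_bump; case: ifPn => r0; last by rewrite lexx ler01.
rewrite prodr_ge0/=; last by move=> i _; rewrite mulr_ge0 ?flat_ge0.
by apply: Num.Theory.prodr_ile1 => i _; rewrite mulr_ge0 ?flat_ge0//= mulr_ile1 ?flat_ge0 ?flat0_le1.
Qed.

Lemma ball_coordP (c : 'rV[R]_n) (r : R) x : 0 < r ->
  ball c r x <-> forall i, c 0 i - r < x 0 i < c 0 i + r.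
Proof.
move=> r0; split=> [[_ cx] i|cx].
  have := cx 0 i; rewrite /ball/= ltr_distlC => /andP[H1 H2].
  by rewrite H1.
split=> // i j; rewrite (ord1 i); have := cx j.
by rewrite /ball/= ltr_distlC.
Qed.

Lemma box_bump_out c r k x : ~ ball c r x -> box_bump c r k x = 0.
Proof.
rewrite /box_bump; case: ifPn => // r0 ncx.
have [i Hi] : exists i, ~ (c 0 i - r < x 0 i < c 0 i + r).
  by apply/existsNP => H; apply: ncx; apply/(ball_coordP _ _ r0).
rewrite (bigD1 i)//=; move/negP: Hi; rewrite negb_and -!leNgt => /orP[H|H].
  rewrite (_ : flat 0 _ = 0) ?mul0r// flat_npos//.
  by rewrite mulr_ge0_le0//; lra.
rewrite (_ : flat 0 (_ * (_ + _ - _)) = 0) ?mulr0 ?mul0r// flat_npos//.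
by rewrite mulr_ge0_le0//; lra.
Qed.

Lemma box_bump_in c r x : ball c r x -> box_bump c r k x @[k --> \oo] --> (1 : R).
Proof.
move=> cx; have r0 : 0 < r by case: cx.
rewrite /box_bump r0.
have p1 : \prod_(i < n) (1 * 1 : R) = 1 by rewrite big1// => i _; rewrite mulr1.
rewrite -[X in _ --> X]p1.
apply: (@cvg_big R 'I_n *%R 1 xpredT (@mul_continuous R) nat \oo (index_enum 'I_n) _ _ _).
move=> i _; apply: cvgM; apply: flat0_cvg1;
  by move/(ball_coordP _ _ r0) : cx => /(_ i)/andP[]; lra.
Qed.

(** An open set is a countable union of rational balls. With bumps $w_j$ on these balls, $1 -
    \prod_j (1 - w_j)$ lies between 0 and 1, vanishes off the union, and tends to 1 as soon as one
    of the bumps does. *)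
Lemma open_bump (U : set 'rV[R]_n) : open U ->
  exists W : nat -> 'rV[R]_n -> R,
  [/\ forall k j, ksmooth j setT (W k),
      forall k x, 0 <= W k x <= 1,
      forall k x, ~ U x -> W k x = 0 &
      forall x, U x -> W k x @[k --> \oo] --> (1 : R)].
Proof.
move=> /open_bigcup_rat_ball[P UE].
(* Indices that encode no ball of the family receive radius -1, that is, an empty ball. *)
pose cr (j : nat) : 'rV[R]_n * R :=
  if unpickle j is Some p then
    if p \in P then (map_mx ratr p.1, ratr p.2) else (0, -1)
  else (0, -1).
have Ucr j x : ball (cr j).1 (cr j).2 x -> U x.
  rewrite UE /cr; case: unpickle => [p|] /=; last by case; rewrite ltr0N1.
  by case: ifPn => [/set_mem Pp px|_ []/=]; [exists p|rewrite ltr0N1].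
have Ucr' x : U x -> exists j, ball (cr j).1 (cr j).2 x.
  by rewrite UE => -[p Pp px]; exists (pickle p); rewrite /cr pickleK mem_set.
pose w k j := box_bump (cr j).1 (cr j).2 k.
have w01 k j x : 0 <= 1 - w k j x <= 1.
  by have /andP[w0 w1] := box_bump_itv (cr j).1 (cr j).2 k x; rewrite subr_ge0 w1 gerBl.
have p0 k x : 0 <= \prod_(j < k) (1 - w k j x).
  by apply: prodr_ge0 => i _; case/andP: (w01 k i x).
exists (fun k x => 1 - \prod_(j < k) (1 - w k j x)).
have oT : open [set: 'rV[R]_n] by exact: openT.
split=> [k j|k x|k x nUx|x Ux].
- apply: ksmooth_sub => //; first exact: ksmooth_cst.
  apply: ksmooth_prod => // i _; apply: ksmooth_sub => //; first exact: ksmooth_cst.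
  exact: ksmooth_box_bump.
- by rewrite subr_ge0 gerBl p0 andbT; apply: Num.Theory.prodr_ile1 => i _; exact: w01.
- rewrite big1 ?subrr// => i _; rewrite /w box_bump_out ?subr0//.
  by move/Ucr.
- have [j jx] := Ucr' x Ux.
  have H := box_bump_in jx.
  have H1 : (1 - w k j x) @[k --> \oo] --> (0 : R).
    by rewrite -(subrr 1); apply: cvgB => //; exact: cvg_cst.
  rewrite -[X in _ --> X](subr0 1); apply: cvgB; first exact: cvg_cst.
  apply: (squeeze_cvgr _ (cvg_cst 0) H1).
  near=> k; rewrite p0/=.
  have jk : (j < k)%N by near: k; exact: nbhs_infty_gt.
  rewrite (bigD1 (Ordinal jk))//= ler_piMr//; first by case/andP: (w01 k j x).
  by apply: Num.Theory.prodr_ile1 => i _; exact: w01.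
Unshelve. all: by end_near. Qed.

End bump.

Lemma cvge_near_lt (R : realType) T (F : set_system T) (FF : Filter F)
    (u : T -> \bar R) (l e : \bar R) : u @ F --> l -> (l < e)%E ->
  \forall x \near F, (u x < e)%E.
Proof.
move=> ul le; have := ul [set y | (y < e)%E]; apply.
by apply: open_nbhs_nbhs; split => //; exact: open_ereal_lt_ereal.
Qed.

(** * Lebesgue measure on row vectors *)

Section rV_measurable.
Variables (R : realType) (n : nat).

Lemma measurable_closed_rV (C : set 'rV[R]_n) : closed C -> measurable C.
Proof.
by move=> cC; rewrite -(setCK C); apply: measurableC; apply: measurable_open_rV; exact: closed_openC.
Qed.

Lemma continuous_rV_measurable (f : 'rV[R]_n -> R) : continuous f ->
  measurable_fun setT f.
Proof.
move=> cf; apply: (measurability _ (RGenOInfty.measurableE R)) => _ [_ [x ->] <-].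
rewrite setTI; apply: measurable_open_rV.
by apply: open_comp => [y _|]; [exact: cf|exact: rray_open].
Qed.

Lemma measurable_coord i : measurable_fun setT (fun x : 'rV[R]_n => x 0 i).
Proof. by apply: continuous_rV_measurable; exact: coord_continuous. Qed.

Lemma measurable_rV d (T : measurableType d) (D : set T) (f : T -> 'rV[R]_n) :
  measurable D -> (forall i, measurable_fun D (fun x => f x 0 i)) ->
  measurable_fun D f.
Proof.
move=> mD mf.
apply: (@measurability _ _ _ _ _ _ (@open 'rV[R]_n)) => //.
move=> _ [U oU <-].
have [P ->] := open_bigcup_rat_ball oU.
rewrite bigcup_mkcond preimage_bigcup setI_bigcupr.
apply: countable_bigcupT_measurable => // -[c r]; case: ifPn => _; last first.
  by rewrite preimage_set0 setI0.
have [r0|r0] := ltP 0 (ratr r : R); last first.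
  rewrite (_ : _ @^-1` _ = set0) ?setI0//; apply/seteqP; split=> // x [/= r0'].
  by rewrite ltNge r0 in r0'.
set b := ball _ _.
have -> : D `&` f @^-1` b = \bigcap_i (D `&` (fun x => f x 0 i) @^-1`
    `](map_mx ratr c 0 i - ratr r), (map_mx ratr c 0 i + ratr r)[) `&` D.
  apply/seteqP; split=> [x [Dx /(ball_coordP _ _ r0) bx]|x [H Dx]].
    by split=> // i _; split=> //=; rewrite in_itv/=; exact: bx.
  split=> //; apply/(ball_coordP _ _ r0) => i.
  by have [_ /=] := H i I; rewrite in_itv.
apply: measurableI => //.
apply: fin_bigcap_measurable => [|i _]; first exact: finite_finset.
exact: mf.
Qed.

End rV_measurable.

(** * Outer regularity and comparison of measures with Lebesgue measure *)

Section outer_regularity.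
Variables (R : realType) (n : nat) (mu : {measure set 'rV[R]_n -> \bar R}).
Hypothesis mu_fin : (mu setT < +oo)%E.

Let fin A : measurable A -> (mu A < +oo)%E.
Proof.
by move=> mA; apply: le_lt_trans mu_fin; apply: le_measure; rewrite ?inE.
Qed.

(** Approximation from both sides, since this form passes to complements and the regular sets thus
    form a sigma-algebra. *)
Definition regular (A : set 'rV[R]_n) := forall e : R, 0 < e ->
  exists C U, [/\ closed C, open U, C `<=` A, A `<=` U & (mu (U `\` C) < e%:E)%E].

(** The points at distance at least [1 / (k + 1)] from the complement of [U], as the complement of a
    union of balls so as to be visibly closed. *)
Definition erosion (U : set 'rV[R]_n) (k : nat) :=
  ~` (\bigcup_(y in ~` U) ball y k.+1%:R^-1).

Lemma closed_erosion U k : closed (erosion U k).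
Proof.
apply: open_closedC; apply: bigcup_open => y _.
exact: ball_open.
Qed.

Lemma erosion_sub U k x : erosion U k x -> ball x k.+1%:R^-1 `<=` U.
Proof.
move=> Ux y xy; apply: contrapT => nUy; apply: Ux; exists y => //.
exact: ball_sym.
Qed.

Lemma erosion_nd U : nondecreasing_seq (erosion U).
Proof.
move=> k l kl; apply/subsetPset => x Ux [y nUy yx]; apply: Ux; exists y => //.
by apply: le_ball yx; rewrite lef_pV2 ?posrE ?ltr0n// ler_nat.
Qed.

Lemma erosion_bigcup U : open U -> \bigcup_k erosion U k = U.
Proof.
move=> oU; apply/seteqP; split=> [x [k _ /erosion_sub]|x Ux].
  by apply; apply: ballxx; rewrite invr_gt0 ltr0n.
have /nbhs_ballP[e /= e0 xe] : nbhs x U by exact: open_nbhs_nbhs.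
exists (Num.truncn e^-1) => // -[y nUy /ball_sym yx]; apply: nUy; apply: xe.
apply: le_ball yx; rewrite -[leRHS]invrK lef_pV2 ?posrE ?invr_gt0 ?ltr0n//.
by rewrite ltW// truncnS_gt.
Qed.

Lemma open_regular U : open U -> regular U.
Proof.
move=> oU e e0.
have mer k : measurable (erosion U k) by apply: measurable_closed_rV; exact: closed_erosion.
have mU : measurable U by exact: measurable_open_rV.
pose D k := U `\` erosion U k.
have D0 : \bigcap_k D k = set0.
  apply/seteqP; split=> // x H.
  have [Ux _] := H 0%N I; rewrite -(erosion_bigcup oU) in Ux.
  by have [k _ kx] := Ux; have [] := H k I.
have : mu \o D @ \oo --> mu (\bigcap_k D k).
  apply: nonincreasing_cvg_mu => [|k||k l kl].
  - by apply: fin; exact: measurableD.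
  - exact: measurableD.
  - by rewrite D0.
  - apply/subsetPset => x [Ux nx]; split=> // kx; apply: nx.
    by have /subsetPset := erosion_nd U kl; apply.
rewrite D0 measure0 => cD.
have [k _ /(_ k (leqnn k)) ke] := cvge_near_lt _ cD (e0 : (0 < e%:E)%E).
exists (erosion U k), U; split=> //.
- exact: closed_erosion.
- by move=> x /erosion_sub; apply; apply: ballxx; rewrite invr_gt0 ltr0n.
Qed.

Lemma outer_regular A : measurable A -> regular A.
Proof.
suff : <<s @open 'rV[R]_n >> `<=` regular by apply.
apply: smallest_sub; last by move=> U; exact: open_regular.
split=> [e e0|B rB e e0|B rB e e0].
- have o0 := @open0 'rV[R]_n; have c0 := @closed0 'rV[R]_n.
  by exists set0, set0; split=> //; rewrite setD0 measure0 lte_fin.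
- have [C [U [cC oU CB BU UC]]] := rB e e0.
  exists (~` U), (~` C); split.
  + exact: open_closedC.
  + exact: closed_openC.
  + by rewrite setTD; exact: subsetC.
  + by rewrite setTD; exact: subsetC.
  + by rewrite setDE setCK setIC -setDE.
(* These errors add up to at most [e / 2]; the other half pays for replacing the countable union of
   closed sets, which need not be closed, by a finite one. *)
have e2 i : 0 < e / (2 ^ i.+2)%:R by rewrite divr_gt0// ltr0n expn_gt0.
have /choice[CU CUP] : forall i, exists CU : set 'rV[R]_n * set 'rV[R]_n,
    [/\ closed CU.1, open CU.2, CU.1 `<=` B i, B i `<=` CU.2 &
     (mu (CU.2 `\` CU.1) < (e / (2 ^ i.+2)%:R)%:E)%E].
  by move=> i; have [C [U H]] := rB i _ (e2 i); exists (C, U).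
pose U := \bigcup_i (CU i).2.
have oU : open U by apply: bigcup_open => i _; case: (CUP i).
have mU := measurable_open_rV oU.
have mC i : measurable (CU i).1 by apply: measurable_closed_rV; case: (CUP i).
have mUi i : measurable (CU i).2 by apply: measurable_open_rV; case: (CUP i).
pose K N := \big[setU/set0]_(i < N) (CU i).1.
have mK N : measurable (K N) by apply: bigsetU_measurable.
pose D N := U `\` K N.
have mD N : measurable (D N) by apply: measurableD.
have mDD : measurable (\bigcap_N D N) by apply: bigcapT_measurable.
have cD : mu \o D @ \oo --> mu (\bigcap_k D k).
  apply: nonincreasing_cvg_mu => // [|k l kl]; first exact: fin.
  apply/subsetPset => x [Ux nx]; split=> // kx; apply: nx.
  move: kx; rewrite /K -!(bigcup_mkord _ (fun i => (CU i).1)) => -[i /= ik ix].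
  by exists i => //=; exact: leq_trans ik kl.
have Dle : (mu (\bigcap_k D k) <= (e / 2)%:E)%E.
  have sub : \bigcap_k D k `<=` \bigcup_i ((CU i).2 `\` (CU i).1).
    move=> x H; have [[i _ ix] _] := H 0%N I; exists i => //; split=> // iC.
    have [_] := H i.+1 I; apply; rewrite /K -(bigcup_mkord _ (fun i => (CU i).1)).
    by exists i => /=.
  have mUC i : measurable ((CU i).2 `\` (CU i).1) by exact: measurableD.
  have H := @measure_sigma_subadditive _ _ _ mu _ _ mUC mDD sub.
  apply: (le_trans H).
  apply: (@le_trans _ _ (\sum_(0 <= i <oo) (e / 2 / (2 ^ i.+1)%:R)%:E)%E).
    apply: lee_nneseries => // i _; case: (CUP i) => _ _ _ _ /ltW/le_trans; apply.
    by rewrite lee_fin expnS natrM invfM mulrA.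
  by apply: (epsilon_trick0 xpredT); rewrite divr_ge0// ltW.
have [N _ /(_ N (leqnn N)) NDe] : \forall N \near \oo, ((mu \o D) N < e%:E)%E.
  apply: (cvge_near_lt _ cD); apply: (le_lt_trans Dle).
  by rewrite lte_fin ltr_pdivrMr// ltr_pMr// ltr1n.
exists (K N), U; split=> //.
- by apply: closed_bigsetU => i _; case: (CUP i).
- move=> x; rewrite /K -(bigcup_mkord _ (fun i => (CU i).1)) => -[i _ ix].
  by exists i => //; case: (CUP i) => _ _ CB _ _; exact: CB.
- by move=> x [i _ Bx]; exists i => //; case: (CUP i) => _ _ _ BU _; exact: BU.
Qed.

End outer_regularity.

Section comparison.
Variables (R : realType) (n : nat) (nu : {measure set 'rV[R]_n -> \bar R}).
Local Notation leb := (lebesgue_rV R n).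

Variable C : R.
Hypothesis C0 : 0 <= C.
Hypothesis nu_ball : forall x r, 0 < r -> (nu (ball x r) <= (C * (r *+ 2) ^+ n)%:E)%E.

(* The set is covered by the balls of radius [s] centered at the points of a
   shifted grid of mesh [s]; the balls of radius [s / 2] are disjoint. *)
Lemma grid_le (A U : set 'rV[R]_n) (s : R) : 0 < s -> measurable A -> open U ->
  (forall x, A x -> ball x (s + s) `<=` U) ->
  (nu A <= (C * 2 ^+ n)%:E * leb U)%E.
Proof.
move=> s0 mA oU AU.
pose fl (x : 'rV[R]_n) : 'rV[int]_n := \row_i Num.floor (x 0 i / s).
pose c (p : 'rV[int]_n) : 'rV[R]_n := \row_i (((p 0 i)%:~R + 2^-1) * s).
pose P : set 'rV[int]_n := [set p | exists2 x, A x & fl x = p].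
have s20 : 0 < s / 2 by rewrite divr_gt0.
have flc x : forall i, `|c (fl x) 0 i - x 0 i| <= s / 2.
  move=> i; rewrite /c /fl !mxE.
  have := floor_itv (x 0 i / s); rewrite intrD.
  rewrite ler_pdivlMr// ltr_pdivrMr// => /andP[H1 H2].
  by rewrite ler_norml; apply/andP; split; lra.
(* [pickle_inv] is injective where it is defined, so distinct indices never name the same cell; the
   disjointness of the small balls relies on it. *)
pose Bs (r : R) (j : nat) : set 'rV[R]_n :=
  if pickle_inv j is Some p then (if p \in P then ball (c p) r else set0) else set0.
have mB r j : measurable (Bs r j).
  rewrite /Bs; case: pickle_inv => [p|] //; case: ifPn => // _.
  by apply: measurable_open_rV; exact: ball_open.
have AB : A `<=` \bigcup_j Bs s j.
  move=> x Ax; exists (pickle (fl x)) => //; rewrite /Bs pickleK_inv mem_set; last by exists x.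
  apply/(ball_coordP _ _ s0) => i; have := flc x i.
  by rewrite ler_norml => /andP[H1 H2]; apply/andP; split; lra.
have BU : \bigcup_j Bs (s / 2) j `<=` U.
  move=> y [j _]; rewrite /Bs; case: pickle_inv => [p|] //; case: ifPn => // /set_mem[x Ax xp].
  move=> /(ball_coordP _ _ s20) cy; apply: (AU x Ax).
  apply/(ball_coordP _ _ (addr_gt0 s0 s0)) => i.
  have := flc x i; have := cy i; rewrite -xp ler_norml => /andP[H1 H2] /andP[H3 H4].
  by apply/andP; split; lra.
have tB : trivIset setT (Bs (s / 2)).
  move=> i j _ _ [y []]; rewrite /Bs.
  case Ei : (pickle_inv i) => [p|] //; case: ifPn => // _ /(ball_coordP _ _ s20) py.
  case Ej : (pickle_inv j) => [q|] //; case: ifPn => // _ /(ball_coordP _ _ s20) qy.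
  have pq : p = q.
    apply/rowP => k; have := py k; have := qy k; rewrite /c !mxE.
    move: (p 0 k) (q 0 k) (y 0 k) => a b z.
    move=> /andP[H1 H2] /andP[H3 H4].
    have F a' : (a'%:~R + 2^-1) * s - s / 2 < z -> z < (a'%:~R + 2^-1) * s + s / 2 ->
        Num.floor (z / s) = a'.
      move=> L1 L2; apply: floor_def; rewrite intrD.
      rewrite ler_pdivlMr// ltr_pdivrMr//; apply/andP; split; lra.
    by rewrite -(F a)// -(F b).
  have := @pickle_invK 'rV[int]_n i; have := @pickle_invK 'rV[int]_n j.
  by rewrite Ei Ej pq /= => <- <-.
have mU : measurable U by exact: measurable_open_rV.
have H := @measure_sigma_subadditive _ _ _ nu _ _ (mB s) mA AB.
apply: (le_trans H).
(* The factor $2^n$ is the ratio of the volumes of the balls of radius [s] and [s / 2]. *)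
have H2 : (\sum_(0 <= j <oo) nu (Bs s j) <=
    \sum_(0 <= j <oo) ((C * 2 ^+ n)%:E * leb (Bs (s / 2)%R j)))%E.
  apply: lee_nneseries => // j _; rewrite /Bs.
  case: pickle_inv => [p|]; last by rewrite !measure0 mule0.
  case: ifPn => _; last by rewrite !measure0 mule0.
  apply: (le_trans (nu_ball _ s0)).
  rewrite (lebesgue_rV_ball _ s20) -EFinM lee_fin -mulrA -exprMn.
  rewrite (_ : 2 * (s / 2 *+ 2) = s *+ 2)//.
  by rewrite -[s / 2 *+ 2]mulr_natr divfK// mulr_natl.
apply: (le_trans H2).
rewrite nneseriesZl// lee_wpmul2l//.
  by rewrite lee_fin mulr_ge0// exprn_ge0.
rewrite -[leLHS](_ : leb (\bigcup_j Bs (s / 2) j) = _).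
  by apply: le_measure; rewrite ?inE//; exact: bigcupT_measurable.
by rewrite measure_bigcup//; apply: eq_eseriesl => j; rewrite in_setT.
Qed.

(** [U] is the increasing union of its erosions, and around each of them there is room inside [U]
    for a fine enough grid. *)
Lemma open_le (U : set 'rV[R]_n) : open U -> (nu U <= (C * 2 ^+ n)%:E * leb U)%E.
Proof.
move=> oU.
have mE k : measurable (erosion U k) by apply: measurable_closed_rV; exact: closed_erosion.
have : nu \o erosion U @ \oo --> nu (\bigcup_k erosion U k).
  apply: nondecreasing_cvg_mu => //; first exact: bigcupT_measurable.
  exact: erosion_nd.
rewrite (erosion_bigcup oU) => cv.
rewrite -(cvg_lim _ cv)//; apply: lime_le; first by apply/cvg_ex; exists (nu U).
apply: nearW => k /=.
have k0 : 0 < k.+1%:R^-1 :> R by rewrite invr_gt0 ltr0n.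
have k2 : 0 < k.+1%:R^-1 / 2 :> R by rewrite divr_gt0.
apply: (grid_le k2 (mE k) oU).
by move=> x /erosion_sub; rewrite -splitr.
Qed.

(** Outer regularity is applied to Lebesgue measure restricted to a ball, which is finite; [nu]
    enters only through its bound on open sets. Unbounded sets are exhausted by bounded ones. *)
Lemma measure_le_lebesgue (A : set 'rV[R]_n) : measurable A ->
  (nu A <= (C * 2 ^+ n)%:E * leb A)%E.
Proof.
suff bdd (A' : set 'rV[R]_n) (N : nat) : measurable A' -> A' `<=` ball 0 N.+1%:R ->
    (nu A' <= (C * 2 ^+ n)%:E * leb A')%E.
  move=> mA; pose B k := A `&` ball 0 k.+1%:R.
  have mB k : measurable (B k).
    by apply: measurableI => //; apply: measurable_open_rV; exact: ball_open.
  have BA : \bigcup_k B k = A.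
    apply/seteqP; split=> [x [k _ []]//|x Ax]; exists (Num.truncn `|x|) => //; split=> //.
    by rewrite -ball_normE/= sub0r normrN truncnS_gt.
  have : nu \o B @ \oo --> nu (\bigcup_k B k).
    apply: nondecreasing_cvg_mu => //; first exact: bigcupT_measurable.
    move=> k l kl; apply/subsetPset => x [Ax xk]; split=> //.
    by apply: le_ball xk; rewrite ler_nat.
  rewrite BA => cv; rewrite -(cvg_lim _ cv)//; apply: lime_le.
    by apply/cvg_ex; exists (nu A).
  apply: nearW => k /=; apply: (le_trans (bdd (B k) k (mB k) _)).
    by move=> x [].
  rewrite lee_wpmul2l//; first by rewrite lee_fin mulr_ge0// exprn_ge0.
  by apply: le_measure; rewrite ?inE//; move=> x [].
move=> mA AN.
have mb : measurable (ball (0 : 'rV[R]_n) N.+1%:R).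
  by apply: measurable_open_rV; exact: ball_open.
pose mu : {measure set 'rV[R]_n -> \bar R} := mrestr leb mb.
have mu_fin : (mu setT < +oo)%E.
  by rewrite /mu/= /mrestr setTI lebesgue_rV_ball ?ltry// ltr0n.
have K0 : 0 <= C * 2 ^+ n by rewrite mulr_ge0// exprn_ge0.
have lebA : (leb A' < +oo)%E.
  apply: (@le_lt_trans _ _ (leb (ball 0 N.+1%:R))).
    by apply: le_measure; rewrite ?inE.
  by rewrite lebesgue_rV_ball ?ltry// ltr0n.
have fA : leb A' \is a fin_num by rewrite ge0_fin_numE.
apply/lee_addgt0Pr => e e0.
have d0 : 0 < e / (C * 2 ^+ n + 1) by rewrite divr_gt0// ltr_wpDl.
have [D [U [cD oU DA AU Ud]]] := outer_regular mu_fin mA d0.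
have mU := measurable_open_rV oU.
have mD := measurable_closed_rV cD.
pose V := U `&` ball 0 N.+1%:R.
have oV : open V by apply: openI => //; exact: ball_open.
apply: (@le_trans _ _ (nu V)).
  apply: le_measure; rewrite ?inE//; first exact: measurable_open_rV.
  by move=> x Ax; split; [exact: AU|exact: AN].
apply: (le_trans (open_le oV)).
have lV : (leb V <= leb A' + (e / (C * 2 ^+ n + 1))%:E)%E.
  apply: (@le_trans _ _ (leb (A' `|` ((U `\` D) `&` ball 0 N.+1%:R)))).
    apply: le_measure; rewrite ?inE//; first exact: measurable_open_rV.
      by apply: measurableU => //; apply: measurableI => //; exact: measurableD.
    move=> x [Ux xN]; have [Ax|nAx] := pselect (A' x); first by left.
    by right; split=> //; split=> // /DA.
  apply: (le_trans (measureU2 _ _ _)) => //.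
    by apply: measurableI => //; exact: measurableD.
  by rewrite leeD2l// ltW.
apply: (@le_trans _ _ ((C * 2 ^+ n)%:E * (leb A' + (e / (C * 2 ^+ n + 1))%:E))%E).
  by rewrite lee_wpmul2l// lee_fin.
rewrite ge0_muleDr//; last by rewrite lee_fin ltW.
apply: leeD2l; rewrite -EFinM lee_fin mulrCA ler_piMr ?(ltW e0)//.
by rewrite ler_pdivrMr ?ltr_wpDl// mul1r lerDl.
Qed.

End comparison.

Section lipschitz_measure.
Variables (R : realType) (n : nat).
Local Notation leb := (lebesgue_rV R n).

(* [H] is the inverse of a Lipschitz map; this form avoids the measurability
   of direct images. *)
Lemma lipschitz_le (Q : set 'rV[R]_n) (H : 'rV[R]_n -> 'rV[R]_n) (L : R) :
  0 < L -> measurable Q -> measurable_fun Q H ->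
  (forall x y, Q x -> Q y -> `|x - y| <= L * `|H x - H y|) ->
  forall A, measurable A ->
    (leb (Q `&` H @^-1` A) <= ((L *+ 2) ^+ n * 2 ^+ n)%:E * leb A)%E.
Proof.
move=> L0 mQ mH HL A mA.
(* The extension by 0 is measurable on the whole space, so that Lebesgue measure on [Q] can be
   pushed forward along it. *)
pose G := patch (fun=> 0) Q H.
have GQ B : G @^-1` B `&` Q = Q `&` H @^-1` B.
  apply/seteqP; split=> x.
    by rewrite /G /preimage /patch /= => -[+ Qx]; rewrite mem_set.
  by rewrite /G /preimage /patch /= => -[Qx Bx]; rewrite mem_set.
have mG : measurable_fun setT G.
  move=> _ B mB; rewrite setTI.
  have -> : G @^-1` B = (G @^-1` B `&` Q) `|` (G @^-1` B `\` Q).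
    by rewrite -setIUr setUCr setIT.
  apply: measurableU; first by rewrite GQ; exact: mH.
  have [B0|B0] := pselect (B 0).
    rewrite (_ : _ `\` _ = ~` Q); first exact: measurableC.
    apply/seteqP; split=> [x []//|x nQx]; split=> //.
    by rewrite /G /preimage /patch /= memNset.
  rewrite (_ : _ `\` _ = set0)//; apply/seteqP; split=> // x [+ nQx].
  by rewrite /G /preimage /patch /= memNset.
pose nu0 : {measure set 'rV[R]_n -> \bar R} := pushforward (mrestr leb mQ) G.
pose nu := nu0 mG.
have nuE B : nu B = leb (Q `&` H @^-1` B) by rewrite /nu/= /pushforward /mrestr GQ.
rewrite -nuE; apply: measure_le_lebesgue => //.
  by rewrite exprn_ge0// mulrn_wge0// ltW.
move=> x r r0; rewrite nuE.
have [->|/set0P[z [Qz Hz]]] := eqVneq (Q `&` H @^-1` ball x r) set0.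
  by rewrite measure0 lee_fin mulr_ge0 ?exprn_ge0 ?mulrn_wge0// ltW.
have Lr0 : 0 < L * (r *+ 2) by rewrite mulr_gt0// mulrn_wgt0.
(* Points of the preimage have images less than [2 * r] apart, so they all lie within [2 * L * r] of
   any one of them. *)
apply: (@le_trans _ _ (leb (ball z (L * (r *+ 2))))).
  apply: le_measure; rewrite ?inE.
  - by apply: mH => //; apply: measurable_open_rV; exact: ball_open.
  - by apply: measurable_open_rV; exact: ball_open.
  move=> y [Qy Hy]; rewrite -ball_normE/=; apply: (le_lt_trans (HL _ _ Qz Qy)).
  rewrite ltr_pM2l// mulr2n.
  have : ball (H z) (r + r) (H y) by apply: ball_triangle (ball_sym Hz) Hy.
  by rewrite -ball_normE.
by rewrite lebesgue_rV_ball// lee_fin -exprMn -mulrnAl mulrnAr mulrnAl.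
Qed.

End lipschitz_measure.

(** * Invariance under translations *)

Section measure_preserving.
Context d (T : measurableType d) (R : realType) (mu : {measure set T -> \bar R}).
Variable phi : T -> T.
Hypothesis mphi : measurable_fun setT phi.
Hypothesis phiP : forall A, measurable A -> mu (phi @^-1` A) = mu A.

Lemma ge0_integral_preserving (f : T -> \bar R) : measurable_fun setT f ->
  (forall x, 0 <= f x)%E -> (\int[mu]_x f (phi x) = \int[mu]_x f x)%E.
Proof.
move=> mf f0; rewrite -[LHS](ge0_integral_pushforward mphi mu (D := setT))//.
by apply: eq_measure_integral => //= A mA _; rewrite /pushforward phiP.
Qed.

Lemma integral_preserving (f : T -> \bar R) : measurable_fun setT f ->
  (\int[mu]_x f (phi x) = \int[mu]_x f x)%E.
Proof.
move=> mf; rewrite integralE [RHS]integralE; congr (_ - _)%E.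
  rewrite -[RHS]ge0_integral_preserving//; last exact: measurable_funepos.
  by apply: eq_integral => x _; rewrite !funeposE.
rewrite -[RHS]ge0_integral_preserving//; last exact: measurable_funeneg.
by apply: eq_integral => x _; rewrite !funenegE.
Qed.

Lemma integrable_preserving (f : T -> \bar R) :
  mu.-integrable setT f -> mu.-integrable setT (f \o phi).
Proof.
move=> /integrableP[mf fi]; apply/integrableP; split; first exact: measurableT_comp.
rewrite (ge0_integral_preserving (f := fun x => `|f x|%E))//.
exact: measurableT_comp.
Qed.

End measure_preserving.

Section translation.
Variable R : realType.

Lemma lebesgue_measure_shift (c : R) (A : set R) : measurable A ->
  lebesgue_measure ((fun x => x + c) @^-1` A) = lebesgue_measure A :> \bar R.
Proof.
move=> mA.
have mf : measurable_fun setT (fun x : measurableTypeR R => x + c : measurableTypeR R).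
  exact: measurable_funD.
pose nu0 : {measure set (measurableTypeR R) -> \bar R} := pushforward lebesgue_measure
  (fun x : measurableTypeR R => x + c : measurableTypeR R).
pose nu := nu0 mf.
apply/esym; apply: (@lebesgue_measure_unique R nu) => //= _ [[a b]] _ <-.
rewrite /nu/= /pushforward /=.
have -> : (fun x : R => x + c) @^-1` `]a, b] = `](a - c), (b - c)]%classic.
  by apply/seteqP; split=> x /=; rewrite !in_itv/= ltrBlDr lerBrDr.
rewrite !lebesgue_measure_itv/= !lte_fin ltrD2r; case: ifPn => // _.
by rewrite -!EFinB; congr EFin; ring.
Qed.

Lemma measurable_shift_rV n (c : 'rV[R]_n) :
  measurable_fun setT (fun x : 'rV[R]_n => x + c).
Proof.
apply: measurable_rV => // i; under eq_fun do rewrite mxE.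
by apply: measurable_funD => //; exact: measurable_coord.
Qed.

(** Induction along the iterated integral: the sections are translated in dimension [n], the outer
    variable on the line. *)
Lemma lebesgue_rV_shift n (c : 'rV[R]_n) (A : set 'rV[R]_n) : measurable A ->
  lebesgue_rV R n ((fun x => x + c) @^-1` A) = lebesgue_rV R n A.
Proof.
elim: n c A => [|n IH] c A mA.
  rewrite (_ : _ @^-1` A = A)//; apply/seteqP; split=> x /=.
    by rewrite (_ : x + c = x)//; apply/rowP => -[].
  by rewrite (_ : x + c = x)//; apply/rowP => -[].
rewrite /=.
pose A' := (fun p : R * 'rV[R]_n => row_mx p.1%:M p.2 : 'rV[R]_(1 + n)) @^-1` A.
have mA' : measurable A'.
  by rewrite -[A']setTI; exact: measurable_row_mx.
have AE x : [set y | A (row_mx x%:M y : 'rV[R]_(1 + n))] = xsection A' x.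
  by apply/seteqP; split=> y; rewrite /xsection/= inE.
have cE : c = row_mx (c 0 0)%:M (rsubmx (c : 'rV[R]_(1 + n))) :> 'rV[R]_(1 + n).
  transitivity (row_mx (lsubmx (c : 'rV[R]_(1 + n))) (rsubmx (c : 'rV[R]_(1 + n)))).
    by rewrite hsubmxK.
  congr row_mx.
  apply/rowP => i; rewrite (ord1 i) !mxE eqxx mulr1n; congr (c _ _).
  exact: val_inj.
transitivity (\int[@lebesgue_measure R]_x lebesgue_rV R n (xsection A' ((x : R) + c 0 0)%R))%E.
  apply: eq_integral => x _; rewrite -AE.
  rewrite -[RHS](IH (rsubmx (c : 'rV[R]_(1 + n)))); last first.
    by rewrite AE; exact: measurable_xsection.
  have E y : (row_mx (x : R)%:M y : 'rV[R]_(1 + n)) + c =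
      row_mx ((x : R) + c 0 0)%:M (y + rsubmx (c : 'rV[R]_(1 + n))).
    by rewrite {1}cE add_row_mx -raddfD.
  by congr (lebesgue_rV R n _); apply/seteqP; split=> y /=; rewrite -E.
transitivity (\int[@lebesgue_measure R]_x lebesgue_rV R n (xsection A' x))%E; last first.
  by apply: eq_integral => x _; rewrite AE.
have mphi : measurable_fun setT (fun x : measurableTypeR R => x + c 0 0 : measurableTypeR R).
  exact: measurable_funD.
apply: (ge0_integral_preserving mphi) => [B mB| |x].
- exact: lebesgue_measure_shift.
- exact: measurable_fun_xsection.
- exact: measure_ge0.
Qed.

End translation.

Section locally_null.
Variables (R : realType) (n : nat) (mu : {measure set 'rV[R]_n -> \bar R}).

(** Lindelöf's argument: countably many rational balls, each meeting [A] in a null set, cover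
    [A]. *)
Lemma locally_null (A : set 'rV[R]_n) : measurable A ->
  (forall x, A x -> exists U, [/\ open U, U x & mu (A `&` U) = 0%E]) -> mu A = 0%E.
Proof.
move=> mA lA.
pose b (p : 'rV[rat]_n * rat) : set 'rV[R]_n := ball (map_mx ratr p.1 : 'rV[R]_n) (ratr p.2).
have mb p : measurable (b p) by apply: measurable_open_rV; exact: ball_open.
pose B (j : nat) : set 'rV[R]_n := if unpickle j is Some p then
  (if `[< mu (A `&` b p) = 0%E >] then A `&` b p else set0) else set0.
have mB j : measurable (B j).
  rewrite /B; case: unpickle => [p|] //; case: asboolP => // _.
  exact: measurableI.
have B0 j : mu (B j) = 0%E.
  by rewrite /B; case: unpickle => [p|]; [case: asboolP => // _|]; rewrite measure0.
have AB : A `<=` \bigcup_j B j.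
  move=> x Ax; have [U [oU Ux AU0]] := lA x Ax.
  have [P UE] := open_bigcup_rat_ball oU.
  have [p Pp px] : (\bigcup_(p in P) b p) x by rewrite /b -UE.
  exists (pickle p) => //; rewrite /B pickleK.
  case: asboolP => [_|]; first by split.
  move=> H; exfalso; apply: H; apply/eqP; rewrite eq_le measure_ge0 andbT -AU0.
  apply: le_measure; rewrite ?inE.
  - exact: measurableI.
  - by apply: measurableI => //; exact: measurable_open_rV.
  - by move=> y [Ay py]; split=> //; rewrite UE; exists p.
apply/eqP; rewrite eq_le measure_ge0 andbT.
have H := @measure_sigma_subadditive _ _ _ mu _ _ mB mA AB.
by apply: (le_trans H); rewrite eseries0.
Qed.

End locally_null.

Section flow_measurable.
Variables (R : realType) (d : nat) (F : 'rV[R]_d).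

Lemma measurable_flow : measurable_fun [set: 'rV[R]_d * R] (flow F).
Proof.
apply: measurable_rV => // i; rewrite /flow; under eq_fun do rewrite !mxE.
apply: measurable_funD; first exact: (measurableT_comp (measurable_coord i) measurable_fst).
exact: measurable_funM.
Qed.

(** Tonelli for the indicator function of [E], whose product measure vanishes. *)
Lemma ae_section_null (E : set ('rV[R]_d * R)) : measurable E ->
  (forall s, lebesgue_rV R d [set x | E (x, s)] = 0%E) ->
  {ae lebesgue_rV R d, forall x, {ae lebesgue_measure, forall s : R, ~ E (x, s)}}.
Proof.
move=> mE E0.
pose f (p : 'rV[R]_d * R) : \bar R := (\1_E p)%:E.
have mf : measurable_fun setT f.
  by apply/measurable_EFinP; exact: measurable_indic.
have f0 p : (0 <= f p)%E by rewrite lee_fin.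
have I0 : (\int[lebesgue_rV R d]_x \int[lebesgue_measure]_s f (x, s) = 0)%E.
  rewrite fubini_tonelli//; apply: integral0_eq => s _.
  have mEs : measurable [set x | E (x, s)].
    by rewrite -[X in measurable X]setTI; exact: (pair2_measurable s).
  transitivity (\int[lebesgue_rV R d]_x (\1_[set x | E (x, s)] x)%:E)%E; last first.
    by rewrite integral_indic// setIT; exact: E0.
  apply: eq_integral => x _; rewrite /f !indicE.
  by have [Ex|nEx] := pselect (E (x, s)); [rewrite !mem_set|rewrite !memNset].
have mF : measurable_fun setT (fun x => \int[lebesgue_measure]_s f (x, s))%E.
  exact: (measurable_fun_fubini_tonelli_F (m2 := lebesgue_measure)).
have := (ae_eq_integral_abs (lebesgue_rV R d) measurableT mF).1.
have -> : (\int[lebesgue_rV R d]_x `|\int[lebesgue_measure]_s f (x, s)| = 0)%E.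
  rewrite -[RHS]I0; apply: eq_integral => x _; rewrite gee0_abs//.
  exact: integral_ge0.
move=> /(_ erefl); apply: filterS => x /(_ I) fx0.
have mfx : measurable_fun setT (fun s => f (x, s)).
  by apply: (measurableT_comp mf); exact: pair1_measurable.
have := (ae_eq_integral_abs lebesgue_measure measurableT mfx).1.
have -> : (\int[lebesgue_measure]_s `|f (x, s)| = 0)%E.
  by rewrite -[RHS]fx0; apply: eq_integral => s _; rewrite gee0_abs.
move=> /(_ erefl); apply: filterS => s /(_ I) + Ns.
by rewrite /f indicE mem_set// => -[] /eqP; rewrite oner_eq0.
Qed.

Lemma null_flow (N : set 'rV[R]_d) : measurable N -> lebesgue_rV R d N = 0%E ->
  {ae lebesgue_rV R d, forall x,
    {ae lebesgue_measure, forall s : R, ~ N (x + s *: F)}}.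
Proof.
move=> mN N0; apply: (@ae_section_null (flow F @^-1` N)) => [|s].
  by rewrite -[X in measurable X]setTI; exact: measurable_flow.
by rewrite -N0 -[RHS](lebesgue_rV_shift (s *: F) mN).
Qed.

End flow_measurable.

(** * Local integrability and the fundamental lemma of the calculus of variations *)

Section local_integrability.
Variables (R : realType) (n : nat).
Local Notation leb := (lebesgue_rV R n).
Implicit Types (f g : 'rV[R]_n -> R) (K : set 'rV[R]_n).

Lemma compact_measurable_rV K : compact K -> measurable K.
Proof.
move=> cK; apply: measurable_closed_rV; apply: compact_closed => //.
Qed.

Lemma compact_sub_ball K : compact K -> exists2 M : R, 0 < M & K `<=` ball 0 M.
Proof.
move=> /compact_bounded[M [Mreal MK]].
exists (`|M| + 2); first by rewrite ltr_wpDl.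
move=> x Kx; rewrite -ball_normE/= sub0r normrN.
have := MK (`|M| + 1) _ x Kx; rewrite ltr_pwDr ?ler_norm// => /(_ isT).
by move/le_lt_trans; apply; rewrite ltrD2l ltr1n.
Qed.

Lemma compact_closed_ball (x : 'rV[R]_n) (r : R) : compact (closed_ball x r).
Proof.
apply: bounded_closed_compact; last exact: closed_ball_closed.
have [r0|r0] := ltP 0 r; last first.
  rewrite closed_ball0//; exists 0; split; first exact: num_real.
  by move=> M _ y [].

exists (`|x| + r); split; first exact: num_real.
move=> M xM y; rewrite closed_ballE// /closed_ball_/= => xy.
rewrite ltW//; apply: le_lt_trans xM.
have -> : y = x - (x - y) by rewrite subKr.
by apply: (le_trans (ler_normB _ _)); rewrite lerD2l.
Qed.

Lemma compact_measure_fin K : compact K -> (leb K < +oo)%E.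
Proof.
move=> cK; have [M M0 KM] := compact_sub_ball cK.
apply: (@le_lt_trans _ _ (leb (ball 0 M))).
  apply: le_measure; rewrite ?inE//; first exact: compact_measurable_rV.
  by apply: measurable_open_rV; exact: ball_open.
by rewrite lebesgue_rV_ball// ltry.
Qed.

Definition loc_int f := measurable_fun setT f /\
  forall K, compact K -> leb.-integrable K (EFin \o f).

(** [|f| <= 1 + f ^ 2], and compact sets have finite measure. *)
Lemma sq_loc_int f : measurable_fun setT f ->
  (forall K, compact K -> (\int[leb]_(x in K) (f x ^+ 2)%:E < +oo)%E) -> loc_int f.
Proof.
move=> mf fK; split=> // K cK; have mK := compact_measurable_rV cK.
have mfK : measurable_fun K f by exact: measurable_funTS.
have mEK : measurable_fun K (EFin \o f) by exact/measurable_EFinP.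
apply/integrableP; split => //.
apply: (@le_lt_trans _ _ (\int[leb]_(x in K) (1 + (f x ^+ 2)%:E))%E).
  apply: ge0_le_integral => //=.
  - by apply/measurable_EFinP; exact: measurableT_comp.
  - apply: emeasurable_funD => //; apply/measurable_EFinP; exact: measurable_funX.
  - move=> x _; rewrite -EFinD lee_fin.
    have := sqr_ge0 (`|f x| - 1); rewrite -(real_normK (num_real (f x))).
    by have := normr_ge0 (f x); nra.
rewrite ge0_integralD//; last 2 first.
- by move=> x _; rewrite lee_fin sqr_ge0.
- by apply/measurable_EFinP; exact: measurable_funX.
by rewrite integral_cst// mul1e lte_add_pinfty// ?fK// compact_measure_fin.
Qed.

Lemma dot_coord (x : 'rV[R]_n) i : x 0 i ^+ 2 <= dot x x.
Proof.
rewrite /dot (bigD1 i)//= expr2 lerDl; apply: sumr_ge0 => j _.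
by rewrite -expr2 sqr_ge0.
Qed.

Lemma measurable_dot d (T : measurableType d) (D : set T) (f : T -> 'rV[R]_n) :
  measurable D -> measurable_fun D f -> measurable_fun D (fun x => dot (f x) (f x)).
Proof.
move=> mD mf; rewrite /dot; apply: measurable_sum => i.
have mi : measurable_fun D (fun x => f x 0 i).
  exact: (measurableT_comp (measurable_coord i) mf).
exact: measurable_funM.
Qed.

Lemma L2loc_loc_int (v : 'rV[R]_n -> 'rV[R]_n) i : L2loc v ->
  loc_int (fun x => v x 0 i).
Proof.
move=> [mv vK].
have mi : measurable_fun setT (fun x => v x 0 i).
  exact: (measurableT_comp (measurable_coord i) mv).
apply: sq_loc_int => // K cK; apply: le_lt_trans (vK K cK).
have mK := compact_measurable_rV cK.
apply: ge0_le_integral => //=.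
- by move=> x _; rewrite lee_fin sqr_ge0.
- by apply/measurable_EFinP/measurable_funX/measurable_funTS.
- by apply/measurable_EFinP/measurable_dot => //; exact: measurable_funTS.
- by move=> x _; rewrite lee_fin dot_coord.
Qed.

Lemma supported_bounded g K : continuous g -> compact K ->
  (forall x, ~ K x -> g x = 0) -> exists2 C, 0 < C & forall x, `|g x| <= C.
Proof.
move=> cg cK g0.
have /compact_bounded[M [Mreal MK]] : compact (g @` K).
  by apply: continuous_compact => //; exact: continuous_subspaceT.
exists (`|M| + 1); first by rewrite ltr_wpDl.
move=> x; have [Kx|/g0->] := pselect (K x); last by rewrite normr0 addr_ge0.
by apply: MK; [rewrite ltr_pwDr// ler_norm|exists x].
Qed.

Lemma loc_int_mul f g K : loc_int f -> continuous g -> compact K ->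
  (forall x, ~ K x -> g x = 0) -> leb.-integrable setT (EFin \o (fun x => f x * g x)).
Proof.
move=> [mf fK] cg cK g0.
have mK := compact_measurable_rV cK.
have mg : measurable_fun setT g by exact: continuous_rV_measurable.
have [C C0 gC] := supported_bounded cg cK g0.
have -> : EFin \o (fun x => f x * g x) = (EFin \o (fun x => f x * g x)) \_ K.
  apply/funext => x; rewrite /patch; case: ifPn => //; rewrite notin_setE => /g0 /= ->.
  by rewrite mulr0.
apply/(integrable_mkcond _ mK).
have H := integrableZl mK C (fK K cK).
apply: le_integrable H => //.
  by apply/measurable_EFinP; apply: measurable_funTS; exact: measurable_funM.
move=> x _ /=; rewrite lee_fin normrM [leRHS]normrM (gtr0_norm C0) mulrC.
by rewrite ler_wpM2r.
Qed.

(** Bounded open sets are limits of test functions, so dominated convergence makes the integral of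
    [f] vanish on them. Dynkin's theorem extends this to bounded Borel sets, which forces [f] to
    vanish almost everywhere. *)
Lemma loc_int_eq0 f : loc_int f ->
  (forall w, test_function w -> \int[leb]_x (f x * w x) = 0) ->
  {ae leb, forall x, f x = 0}.
Proof.
move=> fl fw; have [mf fK] := fl.
pose b (k : nat) : set 'rV[R]_n := ball 0 k.+1%:R.
have ob k : open (b k) by exact: ball_open.
have mb k : measurable (b k) by exact: measurable_open_rV.
have fb k : leb.-integrable (b k) (EFin \o f).
  apply: (integrableS _ _ _ (fK _ (@compact_closed_ball 0 k.+1%:R))) => //.
  - by apply: measurable_closed_rV; exact: closed_ball_closed.
  - exact: subset_closed_ball.
have int_open O k : open O -> (\int[leb]_(x in O `&` b k) (f x)%:E = 0)%E.
  move=> oO; have oOb : open (O `&` b k) by exact: openI.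
  have mOb := measurable_open_rV oOb.
  have [W [sW W01 W0 W1]] := open_bump oOb.
  have int0 j : (\int[leb]_(x in O `&` b k) (f x * W j x)%:E = 0)%E.
    have tW : test_function (W j).
      split; first by apply/ksmoothP => i; exact: sW.
      exists (closed_ball 0 k.+1%:R); first exact: compact_closed_ball.
      move=> x nx; apply: W0 => -[_ bx]; apply: nx; exact: subset_closed_ball.
    have E : (\int[leb]_x (f x * W j x)%:E = 0)%E.
      have := fw _ tW; rewrite /Rintegral => H.
      have cW : continuous (W j) by exact: ksmooth_continuous (sW j 0%N).
      have [_ [K cK WK]] := tW.
      have I1 := loc_int_mul fl cW cK WK.
      by rewrite -[LHS]fineK ?H//; exact: (integrable_fin_num _ I1).
    rewrite -[RHS]E integral_mkcond; apply: eq_integral => x _.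
    rewrite /patch; case: ifPn => //; rewrite notin_setE => /W0 /= ->.
    by rewrite mulr0.
  have fOb : leb.-integrable (O `&` b k) (EFin \o f).
    by apply: (integrableS _ _ _ (fb k)) => //; exact: subIsetr.
  have mW j : measurable_fun setT (W j).
    by apply: continuous_rV_measurable; exact: ksmooth_continuous (sW j 0%N).
  have [] := @dominated_convergence _ _ _ leb _ mOb (fun j x => (f x * W j x)%:E)
    (EFin \o f) (abse \o (EFin \o f)).
  - move=> j; apply/measurable_EFinP; apply: measurable_funTS; exact: measurable_funM.
  - by apply/measurable_EFinP; exact: measurable_funTS.
  - apply: aeW => x Ox /=; apply: cvg_EFin; first exact: nearW.
    rewrite -[X in _ --> X]mulr1; apply: cvgM; first exact: cvg_cst.
    exact: W1.
  - exact: integrable_abse.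
  - apply: aeW => x j Ox /=; rewrite lee_fin normrM ler_piMr//.
    by have /andP[? ?] := W01 j x; rewrite ger0_norm.
  move=> _ _; rewrite (_ : (fun n0 => _) = cst 0%E); last by apply/funext => j; exact: int0.
  by move/cvg_lim => <-//; rewrite lim_cst.
have all0 A k : measurable A -> (\int[leb]_(x in A `&` b k) (f x)%:E = 0)%E.
  move=> mA; apply: (@dynkin_induction _ 'rV[R]_n (@open 'rV[R]_n)
    (fun A => (\int[leb]_(x in A `&` b k) (f x)%:E = 0)%E)) => //.
  - by move=> U V; exact: openI.
  - exact: (int_open _ _ openT).
  - by move=> U; exact: int_open.
  - move=> A' mA' A0; have H := int_open setT k openT.
    have bE : b k = (A' `&` b k) `|` (~` A' `&` b k) by rewrite -setIUl setUv setTI.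
    move: H; rewrite setTI {1}bE integral_setU; first by rewrite A0 add0e.
    + exact: measurableI.
    + by apply: measurableI => //; exact: measurableC.
    + by apply/measurable_EFinP; exact: measurable_funTS.
    + by apply/disj_setPS => x [[Ax _] [nAx _]].
  - move=> G mG tG G0; rewrite setI_bigcupl integral_bigcup.
    + by apply: eseries0 => j _ _; exact: G0.
    + exact: trivIset_setIr.
    + by move=> j; exact: measurableI.
    + apply: (integrableS (mb k)) => //; last by move=> x [j _ []].
      by apply: bigcupT_measurable => j; exact: measurableI.
have ae0 k : ae_eq leb (b k) (EFin \o f) (cst 0%E).
  apply: integral_ae_eq => // E Eb mE.
  by rewrite integral_cst// mul0e -(all0 E k mE) setIidl.
have : {ae leb, forall x, forall k, b k x -> (f x)%:E = 0%E}.
  by apply/ae_foralln => k; exact: ae0.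
apply: filterS => x H; have := H (Num.truncn `|x|).
rewrite /b -ball_normE/= sub0r normrN truncnS_gt => /(_ isT).
by case.
Qed.

End local_integrability.

Lemma ksmooth_component (R : realType) (V : normedModType R) n k (U : set V)
    (f : V -> 'rV[R]_n) i : open U ->
  ksmooth k U f -> ksmooth k U (fun x => f x 0 i).
Proof.
move=> oU; elim: k f => [|k IH] f sf;
  have df x : U x -> differentiable (fun x => f x 0 i) x by
    move=> Ux; apply: (differentiable_comp (f := f) (g := fun y : 'rV[R]_n => y 0 i));
      [exact: ksmooth_diff sf Ux|exact: differentiable_coord].
  by [].
apply: ksmoothS => // v; exists (fun x => 'D_v f x 0 i).
  by apply: IH; exact: ksmoothD.
move=> x /set_mem Ux.
have dfx : differentiable f x by exact: ksmooth_diff sf Ux.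
have clin : linear (fun x : 'rV[R]_n => x 0 i) by move=> a u w; rewrite !mxE.
pose Ll := GRing.isLinear.Build _ _ _ _ (fun x : 'rV[R]_n => x 0 i) clin.
pose LL : {linear 'rV[R]_n -> R} := HB.pack (fun x : 'rV[R]_n => x 0 i) Ll.
have cL : continuous LL by exact: coord_continuous.
rewrite (deriveE _ (df x Ux)) (deriveE _ dfx).
rewrite -[X in 'd X x]/(LL \o f) diff_comp//; last exact: linear_differentiable.
by rewrite diff_lin.
Qed.

Lemma rV_linear_continuous (R : realType) n (V : normedModType R)
    (f : {linear 'rV[R]_n -> V}) : continuous f.
Proof.
have -> : (f : 'rV[R]_n -> V) = fun w => \sum_i w 0 i *: f (delta_mx 0 i).
  apply/funext => w; rewrite {1}(row_sum_delta w) linear_sum.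
  by apply: eq_bigr => i _; rewrite linearZ.
move=> w; apply: (@cvg_sumr _ _ _ (nbhs w) _) => i.
apply: (@cvgZr_tmp _ _ _ (nbhs w) _ (fun v : 'rV[R]_n => v 0 i)); exact: coord_continuous.
Qed.

(** * Charts adapted to the flow *)

Section chart.
Variables (R : realType) (m : nat).
Local Notation d := m.+1.
Variables (F : 'rV[R]_d) (S : set 'rV[R]_d).
Variable n : 'rV[R]_d -> 'rV[R]_d.
Hypothesis hn : unit_normal S n.
Hypothesis hFn : forall x, S x -> dot F (n x) != 0.
Hypothesis hPhi : flow_C1_diffeo S F.
Variables (pi : 'rV[R]_d -> 'rV[R]_d) (tau : 'rV[R]_d -> R).
Hypothesis hpi : forall x, S (pi x) /\ x = pi x + tau x *: F.

Lemma pi_tau_flow y s : S y -> pi (y + s *: F) = y /\ tau (y + s *: F) = s.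
Proof.
move=> Sy; have [[_ inj _] _ _] := hPhi.
have [Sp xE] := hpi (y + s *: F).
have : (pi (y + s *: F), tau (y + s *: F)) = (y, s).
  by apply: inj; rewrite ?inE//=.
by case.
Qed.

Lemma pi_shift x s : pi (x + s *: F) = pi x.
Proof.
have [Sp {1}->] := hpi x; rewrite -addrA -scalerDl.
by have [] := pi_tau_flow (tau x + s) Sp.
Qed.

Lemma tau_shift x s : tau (x + s *: F) = tau x + s.
Proof.
have [Sp {1}->] := hpi x; rewrite -addrA -scalerDl.
by have [] := pi_tau_flow (tau x + s) Sp.
Qed.

Lemma pi_id y : S y -> pi y = y.
Proof. by move=> Sy; have [] := pi_tau_flow 0 Sy; rewrite scale0r addr0. Qed.

Lemma tau_id y : S y -> tau y = 0.
Proof. by move=> Sy; have [] := pi_tau_flow 0 Sy; rewrite scale0r addr0. Qed.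

Lemma tau_eq0 x : tau x = 0 -> S x.
Proof. by have [Sp {2}->] := hpi x => ->; rewrite scale0r addr0. Qed.

(** Regularity is granted to the inverse map [g] in [flow_C1_diffeo]; injectivity of the flow
    identifies it with the pair of [pi] and [tau]. *)
Lemma pi_tau_continuous : continuous pi /\ continuous tau.
Proof.
have [[_ inj _] _ [g gC1 gP]] := hPhi.
have gE x : g x = (pi x, tau x).
  have [Sg gx] := gP x; have [Sp xE] := hpi x.
  by apply: inj; rewrite ?inE//= gx.
have cg : continuous g.
  by move=> x; apply: differentiable_continuous; have [] := gC1 x I.
split.
  have -> : pi = fst \o g by apply/funext => x; rewrite /= gE.
  by move=> x; apply: (cvg_comp g fst (cg x)); exact: cvg_fst.
have -> : tau = snd \o g by apply/funext => x; rewrite /= gE.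
by move=> x; apply: (cvg_comp g snd (cg x)); exact: cvg_snd.
Qed.

Lemma closed_S : closed S.
Proof.
have -> : S = tau @^-1` [set 0].
  by apply/seteqP; split=> [x /tau_id//|x /tau_eq0].
by apply: closed_comp => [x _|]; [case: pi_tau_continuous|exact: closed_eq].
Qed.

Section at_chart.
Variables (V : set 'rV[R]_m) (gamma : 'rV[R]_m -> 'rV[R]_d).
Hypothesis gammaP : local_param S V gamma.

Let oV : open V. Proof. by case: gammaP. Qed.

Lemma param_component k i : ksmooth k V (fun u => gamma u 0 i).
Proof.
by apply: ksmooth_component => //; case: gammaP => _ /ksmoothP.
Qed.

Lemma param_diff u : V u -> differentiable gamma u.
Proof. by case: gammaP => _ sg _ _ _ Vu; exact: (sg [::] u Vu). Qed.

Lemma param_S u : V u -> S (gamma u).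
Proof.
move=> Vu; have [_ _ _ _ H] := gammaP.
have [U oU E] := H V oV (@subset_refl _ V).
have : (gamma @` V) (gamma u) by exists u.
by rewrite E => -[].
Qed.

(** The Jacobian matrix, time first, of the chart $(s, u) \mapsto \gamma(u) + s F$ of the whole
    space. *)
Definition frame u : 'M[R]_(1 + m) := col_mx F ('J gamma u).

Lemma ksmooth_frame k i j : ksmooth k V (fun u => frame u i j).
Proof.
have [i'|i'] := split_ordP i.
  move=> ->; apply: eq_ksmooth (ksmooth_cst k (F 0 j) oV) => // u _.
  by rewrite /frame col_mxEu (ord1 i').
move=> ->; apply: eq_ksmooth (ksmoothD (delta_mx 0 i') (param_component k.+1 j)) => // u /set_mem Vu.
rewrite /frame col_mxEd.
have dg := param_diff Vu.
have : 'D_(delta_mx 0 i') gamma u = row i' ('J gamma u).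
  by rewrite deriveEjacobian// rowE.
move/(congr1 (fun w : 'rV[R]_d => w 0 j)); rewrite [RHS]mxE => <-.
have dc : differentiable (fun u => gamma u 0 j) u.
  exact: ksmooth_diff (param_component 0 j) Vu.
rewrite (deriveE _ dc) (deriveE _ dg).
have clin : linear (fun x : 'rV[R]_d => x 0 j) by move=> a w w'; rewrite !mxE.
pose Ll := GRing.isLinear.Build _ _ _ _ (fun x : 'rV[R]_d => x 0 j) clin.
pose LL : {linear 'rV[R]_d -> R} := HB.pack (fun x : 'rV[R]_d => x 0 j) Ll.
have cL : continuous LL by exact: coord_continuous.
rewrite -[X in 'd X u]/(LL \o gamma) diff_comp//; last exact: linear_differentiable.
by rewrite diff_lin.
Qed.

(** The tangent rows are orthogonal to the normal, so that only the row [F] survives the pairing. *)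
Lemma frame_normal u : V u ->
  frame u *m (n (gamma u))^T = dot F (n (gamma u)) *: (delta_mx 0 0 : 'cV[R]_(1 + m)).
Proof.
move=> Vu; have [_ hnD] := hn.
have dotE (x y : 'rV[R]_d) : x *m y^T = (dot x y)%:M.
  apply/matrixP => i j; rewrite (ord1 i) (ord1 j) !mxE eqxx mulr1n /dot.
  by apply: eq_bigr => k _; rewrite mxE.
apply/matrixP => i j; rewrite (ord1 j) /frame mul_col_mx.
have [i'|i'] := split_ordP i.
  move=> ->; rewrite col_mxEu dotE !mxE (ord1 i') eqxx mulr1n.
  have -> : lshift m (0 : 'I_1) = 0 :> 'I_(1 + m) by exact: val_inj.
  by rewrite eqxx mulr1.
move=> ->; rewrite col_mxEd [RHS]mxE [X in _ * X]mxE.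
have -> : (rshift 1 i' == 0 :> 'I_(1 + m)) = false by [].
rewrite /= mulr0.
have := hnD V gamma gammaP u (delta_mx 0 i') Vu.
rewrite deriveEjacobian; last exact: param_diff.
rewrite -rowE => H.
have : row i' ('J gamma u) *m (n (gamma u))^T = 0.
  rewrite dotE -[RHS](_ : (0 : R)%:M = 0); last by rewrite raddf0.
  congr _%:M; rewrite -[RHS]H /dot; apply: eq_bigr => k _; exact: mulrC.
rewrite -row_mul => /(congr1 (fun A : 'M[R]_1 => A 0 0)).
by rewrite !mxE.
Qed.

(** In a linear relation between the rows, pairing with the normal kills the coefficient of [F] by
    transversality; the immersion condition kills the others. *)
Lemma frame_unit u : V u -> frame u \in unitmx.
Proof.
move=> Vu; rewrite -row_free_unit -kermx_eq0; apply/eqP/row_matrixP => i.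
rewrite row0; set w := row i _.
have wM : w *m frame u = 0 by rewrite -row_mul mulmx_ker row0.
have [_ _ _ Jfree _] := gammaP.
have w0 : lsubmx w = 0.
  have : w *m frame u *m (n (gamma u))^T = 0 by rewrite wM mul0mx.
  rewrite -mulmxA frame_normal// -scalemxAr => /(congr1 (fun A : 'M[R]_1 => A 0 0)).
  rewrite mxE -colE [X in _ * X]mxE [RHS]mxE.
  move/eqP; rewrite mulf_eq0 (negPf (hFn (param_S Vu)))/= => /eqP w00.
  apply/rowP => j; rewrite (ord1 j) [LHS]mxE [RHS]mxE -[RHS]w00; congr (w _ _).
  exact: val_inj.
have := wM; rewrite -{1}(hsubmxK w) w0 /frame mul_row_col mul0mx add0r => wJ.
have wr : rsubmx w = 0.
  by apply: (row_free_inj (Jfree u Vu)); rewrite wJ mul0mx.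
by rewrite -(hsubmxK w) w0 wr row_mx0.
Qed.

(** By [tau_diff] below, the first column of the inverse frame is the gradient of [tau]; this is its
    expression through the normal. *)
Lemma frame_invn u : V u -> forall l,
  invmx (frame u) l 0 = n (gamma u) 0 l / dot F (n (gamma u)).
Proof.
move=> Vu l; have Fn := hFn (param_S Vu).
have := frame_normal Vu => /(congr1 (mulmx (invmx (frame u)))).
rewrite mulKmx ?frame_unit// -scalemxAr => /(congr1 (fun A : 'cV[R]_d => A l 0)).
rewrite -colE !mxE => ->.
by rewrite mulrC mulKf.
Qed.

Lemma ksmooth_frameV k i j : ksmooth k V (fun u => invmx (frame u) i j).
Proof.
apply: ksmooth_invmx => //; first by move=> u; exact: frame_unit.
by move=> *; exact: ksmooth_frame.
Qed.

Definition chart_dom : set 'rV[R]_d := pi @^-1` (gamma @` V).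

(** The chart coordinate of [pi x], meaningful on [chart_dom] and constant along the lines. *)
Definition theta (x : 'rV[R]_d) : 'rV[R]_m :=
  xget 0 [set u | V u /\ gamma u = pi x].

Lemma thetaP x : chart_dom x -> V (theta x) /\ gamma (theta x) = pi x.
Proof.
by move=> [u Vu ux]; apply: (@xgetPex _ _ [set u | V u /\ gamma u = pi x]); exists u.
Qed.

Lemma chart_dom_flow u s : V u -> chart_dom (gamma u + s *: F).
Proof.
move=> Vu; rewrite /chart_dom/= pi_shift pi_id; last exact: param_S.
by exists u.
Qed.

Lemma theta_flow u s : V u -> theta (gamma u + s *: F) = u.
Proof.
move=> Vu; have [Vt] := thetaP (chart_dom_flow s Vu).
rewrite pi_shift pi_id; last exact: param_S.
by case: gammaP => _ _ inj _ _; apply: inj; rewrite inE.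
Qed.

Lemma open_pi_image V' : open V' -> V' `<=` V -> open (pi @^-1` (gamma @` V')).
Proof.
move=> oV' V'V; have [_ _ _ _ H] := gammaP.
have [U oU ->] := H V' oV' V'V.
have -> : pi @^-1` (S `&` U) = pi @^-1` U.
  by apply/seteqP; split=> [x []//|x Ux]; split=> //; case: (hpi x).
by apply: open_comp => // x _; case: pi_tau_continuous.
Qed.

Lemma open_chart_dom : open chart_dom.
Proof. exact: open_pi_image. Qed.

(** The parametrization maps open sets to relatively open sets; their preimages under the continuous
    [pi] are open. *)
Lemma theta_continuous x : chart_dom x -> {for x, continuous theta}.
Proof.
move=> Wx N; have [Vt gt] := thetaP Wx.
rewrite nbhsE/= => -[Y [oY Yt] YN].
have oVY : open (V `&` Y) by exact: openI.
have VYV : V `&` Y `<=` V by exact: subIsetl.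
have := open_pi_image oVY VYV.
rewrite openE => /(_ x) H; have : (pi @^-1` (gamma @` (V `&` Y))) x by exists (theta x).
move=> /H; apply: filterS => y [u [Vu Yu] uy] /=; apply: YN.
suff -> : theta y = u by [].
have [Vty gty] := thetaP (ex_intro2 _ _ u Vu uy : chart_dom y).
by case: gammaP => _ _ inj _ _; apply: inj; rewrite ?inE// gty.
Qed.

Definition Theta x : 'rV[R]_m * R := (theta x, tau x).

Definition dTheta (u : 'rV[R]_m) (w : 'rV[R]_d) : 'rV[R]_m * R :=
  let z : 'rV[R]_(1 + m) := w *m invmx (frame u) in (rsubmx z, z 0 0).

(** [Theta] is a continuous right inverse of [P], whose differential is multiplication by the
    invertible frame, so [diff_inverse] applies. *)
Lemma Theta_diff x : chart_dom x -> differentiable Theta x /\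
  forall v, 'D_v Theta x = dTheta (theta x) v.
Proof.
move=> Wx; have [Vt gt] := thetaP Wx; set u := theta x in Vt gt *.
have dlin : linear (dTheta u).
  move=> a v w; rewrite /dTheta mulmxDl -scalemxAl; congr pair; last by rewrite !mxE.
  by rewrite linearP.
pose Ll := GRing.isLinear.Build _ _ _ _ (dTheta u) dlin.
pose LL : {linear 'rV[R]_d -> ('rV[R]_m * R)%type} := HB.pack (dTheta u) Ll.
have cL : continuous LL by exact: rV_linear_continuous.
pose P (p : 'rV[R]_m * R) := gamma p.1 + p.2 *: F.
have dg := param_diff Vt.
have d1 : is_diff (Theta x) (gamma \o fst) ('d gamma u \o fst).
  have dfst : is_diff (Theta x) (fst : 'rV[R]_m * R -> 'rV[R]_m) fst.
    apply: DiffDef; first exact: (@linear_differentiable _ _ _ fst _ (fun p => cvg_fst)).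
    exact: (@diff_lin _ _ _ fst _ (fun p => cvg_fst)).
  apply: is_diff_comp; exact: differentiableP.
have d2 : is_diff (Theta x) (fun p : 'rV[R]_m * R => p.2 *: F) (fun p => p.2 *: F).
  have dsnd : differentiable (snd : 'rV[R]_m * R -> R) (Theta x).
    exact: (@linear_differentiable _ _ _ snd _ (fun p => cvg_snd)).
  apply: DiffDef; first exact: differentiableZl.
  by rewrite diffZl// (@diff_lin _ _ _ snd _ (fun p => cvg_snd)).
have dP : is_diff (Theta x) P ('d gamma u \o fst + (fun p => p.2 *: F)) by exact: is_diffD.
apply: (@diff_inverse R 'rV[R]_d ('rV[R]_m * R)%type P Theta x LL) => //.
- have ct : theta y @[y --> x] --> theta x by exact: theta_continuous.
  have ctau : tau y @[y --> x] --> tau x by case: pi_tau_continuous => _; exact.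
  exact: (cvg_pair ct ctau).
- move=> [k r]; rewrite /LL/= diff_val /dTheta/= !fctE/=.
  have -> : 'd gamma u k + r *: F = row_mx r%:M k *m frame u :> 'rV[R]_d.
    rewrite /frame mul_row_col mul_scalar_mx addrC; congr (_ + _).
    by rewrite -deriveEjacobian// deriveE.
  rewrite mulmxK ?frame_unit//; congr pair; first by rewrite row_mxKr.
  have -> : 0 = lshift m (0 : 'I_1) :> 'I_(1 + m) by exact: val_inj.
  by rewrite row_mxEl mxE eqxx mulr1n.
- have := open_nbhs_nbhs (conj open_chart_dom Wx); apply: filterS => y Wy.
  have [_ gy] := thetaP Wy; rewrite /P/= gy.
  by have [_ <-] := hpi y.
Qed.

Lemma derive_comp_theta (a : 'rV[R]_m -> R) x :
  chart_dom x -> differentiable a (theta x) ->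
  differentiable (a \o theta) x /\ forall v, 'D_v (a \o theta) x =
    \sum_j (dTheta (theta x) v).1 0 j * 'D_(delta_mx 0 j) a (theta x).
Proof.
move=> Wx dax; have [dT DT] := Theta_diff Wx.
have dfst : differentiable (fst : 'rV[R]_m * R -> 'rV[R]_m) (Theta x).
  exact: (@linear_differentiable _ _ _ fst _ (fun p => cvg_fst)).
have dt : differentiable (fst \o Theta) x by exact: differentiable_comp.
have dc : differentiable (a \o (fst \o Theta)) x by exact: differentiable_comp.
split=> // v; rewrite -[X in 'D_v X x]/(a \o (fst \o Theta)) deriveE//.
rewrite (diff_comp dt dax)/= (diff_comp dT dfst)/=.
rewrite (@diff_lin _ _ _ fst _ (fun p => cvg_fst)) -(deriveE _ dT) DT.
by rewrite -(deriveE _ dax) derive_coord.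
Qed.

(** Bootstrap: the derivative of [a \o theta] has again the form [b \o theta], where [b] combines
    the derivatives of [a] with entries of the inverse frame, which are smooth on [V]. *)
Lemma ksmooth_comp_theta k (a : 'rV[R]_m -> R) :
  ksmooth k V a -> ksmooth k chart_dom (a \o theta).
Proof.
have oW := open_chart_dom.
have da k' a' x : ksmooth k' V a' -> chart_dom x -> differentiable (a' \o theta) x /\
    forall v, 'D_v (a' \o theta) x =
    \sum_j (dTheta (theta x) v).1 0 j * 'D_(delta_mx 0 j) a' (theta x).
  move=> sa Wx; have [Vt _] := thetaP Wx.
  by apply: derive_comp_theta => //; exact: ksmooth_diff sa Vt.
elim: k a => [|k IH] a sa; first by split=> // x Wx; case: (da _ _ x sa Wx).
apply: ksmoothS => // [x Wx|v]; first by case: (da _ _ x sa Wx).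
pose b u := \sum_j (\sum_l v 0 l * invmx (frame u) l (rshift 1 j)) * 'D_(delta_mx 0 j) a u.
exists (b \o theta).
  apply: IH; apply: ksmooth_sum => // j _; apply: ksmooth_mul => //; last exact: ksmoothD.
  apply: ksmooth_sum => // l _; apply: ksmooth_scale => //; exact: ksmooth_frameV.
move=> x /set_mem Wx; have [_ ->] := da _ _ x sa Wx; apply: eq_bigr => j _.
by congr (_ * _); rewrite /dTheta/= !mxE.
Qed.

Lemma ksmooth_theta_coord k j : ksmooth k chart_dom (fun x => theta x 0 j).
Proof.
have := @ksmooth_comp_theta k (fun u => u 0 j); apply.
exact: ksmooth_coord.
Qed.

Lemma tau_diff x : chart_dom x -> differentiable tau x /\
  forall v, 'D_v tau x = \sum_l v 0 l * invmx (frame (theta x)) l 0.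
Proof.
move=> Wx; have [dT DT] := Theta_diff Wx.
have dsnd : differentiable (snd : 'rV[R]_m * R -> R) (Theta x).
  exact: (@linear_differentiable _ _ _ snd _ (fun p => cvg_snd)).
have dc : differentiable (snd \o Theta) x by exact: differentiable_comp.
split=> // v; rewrite -[X in 'D_v X x]/(snd \o Theta) deriveE//.
rewrite (diff_comp dT dsnd)/= (@diff_lin _ _ _ snd _ (fun p => cvg_snd)).
by rewrite -(deriveE _ dT) DT /dTheta/= !mxE.
Qed.

Lemma ksmooth_tau_chart k : ksmooth k chart_dom tau.
Proof.
have oW := open_chart_dom.
case: k => [|k]; first by split=> // x Wx; case: (tau_diff Wx).
apply: ksmoothS => // [x Wx|v]; first by case: (tau_diff Wx).
exists ((fun u => \sum_l v 0 l * invmx (frame u) l 0) \o theta).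
  apply: ksmooth_comp_theta; apply: ksmooth_sum => // l _.
  by apply: ksmooth_scale => //; exact: ksmooth_frameV.
by move=> x /set_mem Wx; case: (tau_diff Wx).
Qed.

Lemma ksmooth_comp_Theta k (q : 'rV[R]_m * R -> R) :
  ksmooth k (V `*` setT) q -> ksmooth k chart_dom (q \o Theta).
Proof.
move=> sq; have oW := open_chart_dom.
(* The basis of the product space is indexed by ['I_m + unit], the [unit] summand standing for the
   time coordinate. *)
apply: (@ksmooth_comp R 'rV[R]_d ('rV[R]_m * R)%type k ('I_m + unit)%type
  (fun o => if o is inl j then (delta_mx 0 j, 0) else (0, 1))
  (fun o x => if o is inl j then theta x 0 j else tau x) Theta chart_dom (V `*` setT)) => //.
- move=> x _; rewrite /Theta big_sumType/=.
  rewrite [X in _ + X](_ : _ = (0, tau x)); last first.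
    rewrite big_const card_unit/= addr0; congr pair; first exact: scaler0.
    exact: mulr1.
  have -> : \sum_j theta x 0 j *: (delta_mx 0 j : 'rV[R]_m, 0 : R) = (theta x, 0).
    rewrite [in RHS](row_sum_delta (theta x)).
    rewrite (big_morph (fun y : 'rV[R]_m => (y, 0 : R)) (id1 := 0) (op1 := +%R)) //.
      by apply: eq_bigr => j _; congr pair; exact: mulr0.
    by move=> y z; congr pair; rewrite addr0.
  by congr pair; rewrite /= ?addr0 ?add0r.
- by move=> x Wx; split=> //=; case: (thetaP Wx).
- by case=> [j|]; [exact: ksmooth_theta_coord|move=> _; exact: ksmooth_tau_chart].
Qed.

End at_chart.

Hypothesis hS : smooth_hypersurface S.

Lemma chart_cover x : exists V gamma, local_param S V gamma /\ chart_dom V gamma x.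
Proof.
have [Sp _] := hpi x; have [V [gamma [gP gx]]] := hS Sp.
by exists V, gamma.
Qed.

Lemma ksmooth_tau k : ksmooth k setT tau.
Proof.
apply: ksmooth_local => x _; have [V [gamma [gP Wx]]] := chart_cover x.
by exists (chart_dom V gamma) => //; exact: ksmooth_tau_chart.
Qed.

Lemma ksmooth_comp_pi k (f : 'rV[R]_d -> R) :
  (forall V gamma, local_param S V gamma -> ksmooth k V (f \o gamma)) ->
  ksmooth k setT (f \o pi).
Proof.
move=> sf; apply: ksmooth_local => x _; have [V [gamma [gP Wx]]] := chart_cover x.
exists (chart_dom V gamma) => //.
apply: eq_ksmooth (ksmooth_comp_theta gP (sf _ _ gP)); first exact: open_chart_dom.
by move=> y /set_mem Wy; rewrite /=; case: (thetaP Wy) => _ ->.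
Qed.

Lemma ksmooth_comp_pi_tau k (psi : 'rV[R]_d * R -> R) :
  (forall V gamma, local_param S V gamma ->
   ksmooth k (V `*` setT) (fun p : 'rV[R]_m * R => psi (gamma p.1, p.2))) ->
  ksmooth k setT (fun x => psi (pi x, tau x)).
Proof.
move=> sf; apply: ksmooth_local => x _; have [V [gamma [gP Wx]]] := chart_cover x.
exists (chart_dom V gamma) => //.
apply: eq_ksmooth (ksmooth_comp_Theta gP (sf _ _ gP)); first exact: open_chart_dom.
by move=> y /set_mem Wy; rewrite /=; case: (thetaP Wy) => _ ->.
Qed.

(* The Jacobian factor of the flow, as [F . n = 1 / |grad tau|]. *)
Definition grad_norm x := Num.sqrt (\sum_l ('D_(delta_mx 0 l) tau x) ^+ 2).

(** The gradient of [tau] is the unit normal divided by F . n. This trades the normal, known only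
    pointwise, for derivatives of a smooth function. *)
Lemma dot_normal x : `|dot F (n (pi x))|^-1 = grad_norm x.
Proof.
have [V [gamma [gP Wx]]] := chart_cover x.
have [Vt gt] := thetaP Wx.
have [_ Dt] := tau_diff gP Wx.
rewrite -[LHS]gtr0_norm ?invr_gt0 ?normr_gt0 ?hFn//; last by case: (hpi x).
rewrite -sqrtr_sqr; congr (Num.sqrt _).
have nn : dot (n (pi x)) (n (pi x)) = 1.
  by case: hn => + _; apply; case: (hpi x).
rewrite exprVn real_normK ?num_real//; set D := dot F _.
have DtE l : 'D_(delta_mx 0 l) tau x = n (pi x) 0 l / D.
  rewrite Dt (bigD1 l)//= (frame_invn gP Vt) gt mxE !eqxx mul1r big1 ?addr0//.
  by move=> j /negPf jl; rewrite mxE eqxx/= jl mul0r.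
rewrite -[LHS]mul1r -nn {1}/dot mulr_suml; apply: eq_bigr => l _.
by rewrite DtE expr_div_n expr2.
Qed.

Lemma grad_norm_gt0 x : 0 < grad_norm x.
Proof.
rewrite -dot_normal invr_gt0 normr_gt0; apply: hFn; by case: (hpi x).
Qed.

Lemma grad_norm_shift x s : grad_norm (x + s *: F) = grad_norm x.
Proof. by rewrite -!dot_normal pi_shift. Qed.

Lemma ksmooth_grad_norm k : ksmooth k setT grad_norm.
Proof.
have oT : open [set: 'rV[R]_d] by exact: openT.
apply: ksmooth_sqrt => //.
  by move=> x _; rewrite -sqrtr_gt0; exact: grad_norm_gt0.
apply: ksmooth_sum => // l _.
have := ksmooth_mul oT (ksmoothD (delta_mx 0 l) (ksmooth_tau k.+1)) (ksmoothD (delta_mx 0 l) (ksmooth_tau k.+1)).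
by apply: eq_ksmooth => // x _; rewrite expr2.
Qed.

End chart.

Arguments lebesgue_rV : simpl never.

Lemma open_continuous_measurable (R : realType) n (V : set 'rV[R]_n) (f : 'rV[R]_n -> R) :
  open V -> (forall x, V x -> {for x, continuous f}) -> measurable_fun V f.
Proof.
move=> oV cf; apply: (measurability _ (RGenOInfty.measurableE R)) => _ [_ [x ->] <-].
apply: measurable_open_rV; rewrite openE => y [Vy fy]; apply: filterI.
  exact: open_nbhs_nbhs.
by apply: (cf y Vy); apply: open_nbhs_nbhs; split => //; exact: rray_open.
Qed.

Lemma vector_lipschitz (R : realType) n p (G : 'rV[R]_n -> 'rV[R]_p) U x :
  open U -> U x -> (forall i, ksmooth 1 U (fun y => G y 0 i)) ->
  exists L r, [/\ 0 < L, 0 < r, ball x r `<=` U &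
    forall y z, ball x r y -> ball x r z -> `|G y - G z| <= L * `|y - z| ].
Proof.
move=> oU Ux sG.
have [L [r [L0 r0 rU GL]]] := ksmooth_lipschitz (f := fun i y => G y 0 i) oU Ux sG.
exists L, r; split=> // y z xy xz; apply: norm_coord_le.
  by rewrite mulr_ge0// ltW.
by move=> i; rewrite !mxE; exact: GL.
Qed.

(** * Surface measure and null sets *)

Section gram.
Variables (R : realType) (m : nat).

(** Bordering [J] by the unit normal gives a square invertible matrix. Its own Gram matrix is block
    diagonal with blocks 1 and $J J^T$, so $\det (J J^T)$ is the square of its determinant. *)
Lemma gram_det_gt0 (J : 'M[R]_(m, m.+1)) (nu : 'rV[R]_m.+1) :
  row_free J -> nu *m nu^T = 1 -> J *m nu^T = 0 -> 0 < \det (J *m J^T).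
Proof.
move=> Jf nn Jn.
have nJ : nu *m J^T = 0.
  by apply: (can_inj (@trmxK _ _ _)); rewrite trmx_mul trmxK Jn trmx0.
pose M : 'M[R]_(1 + m) := col_mx nu J.
have -> : \det (J *m J^T) = \det M ^+ 2.
  rewrite expr2 -[X in _ = _ * X]det_tr -det_mulmx /M tr_col_mx mul_col_row nJ Jn nn.
  by rewrite det_ublock det1 mul1r.
have Mu : M \in unitmx.
  rewrite -row_free_unit -kermx_eq0; apply/eqP/row_matrixP => i.
  rewrite row0; set w := row i _.
  have wM : w *m M = 0 by rewrite -row_mul mulmx_ker row0.
  have := wM; rewrite -{1}(hsubmxK w) /M mul_row_col => wJ.
  have w0 : lsubmx w = 0.
    have := congr1 (mulmx^~ nu^T) wJ.
    by rewrite mulmxDl -!mulmxA nn Jn mulmx0 addr0 mulmx1 mul0mx.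
  move: wJ; rewrite w0 mul0mx add0r => wJ.
  have wr : rsubmx w = 0 by apply: (row_free_inj Jf); rewrite wJ mul0mx.
  by rewrite -(hsubmxK w) w0 wr row_mx0.
by rewrite exprn_even_gt0//= -unitfE -unitmxE.
Qed.

End gram.

Section row_mx_product.
Variables (R : realType) (m : nat).
Local Notation leb := (lebesgue_rV R).

Lemma lebesgue_rV_prod (I : set R) (B : set 'rV[R]_m) : measurable I -> measurable B ->
  leb m.+1 [set z | I ((z : 'rV[R]_(1 + m)) 0 0) /\ B (rsubmx (z : 'rV[R]_(1 + m)))] =
  (lebesgue_measure I * leb m B)%E.
Proof.
move=> mI mB; rewrite /=.
transitivity (\int[@lebesgue_measure R]_(x in I) leb m B)%E.
  rewrite [RHS]integral_mkcond; apply: eq_integral => x _; rewrite /patch.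
  have x0 (y : 'rV[R]_m) : (row_mx x%:M y : 'rV[R]_(1 + m)) 0 0 = x.
    have -> : 0 = lshift m (0 : 'I_1) :> 'I_(1 + m) by exact: val_inj.
    by rewrite row_mxEl mxE eqxx mulr1n.
  case: ifPn => [/set_mem Ix|]; last first.
    rewrite notin_setE => nIx; transitivity (leb m set0); last exact: measure0.
    congr (leb m _).
    by apply/seteqP; split=> // y /=; rewrite x0 => -[].
  congr (leb m _); apply/seteqP; split=> y /=; rewrite x0 row_mxKr; last by [].
  by case.
by rewrite integral_cst// muleC.
Qed.

Lemma ball_row_mx (c z : 'rV[R]_(1 + m)) r : 0 < r ->
  ball c r z <-> ball (c 0 0) r (z 0 0) /\ ball (rsubmx c) r (rsubmx z).
Proof.
move=> r0; have := @preimage_row_mx_ball R m c r r0.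
move=> /(congr1 (fun A => A (z 0 0, rsubmx z))) /=.
have -> : row_mx (z 0 0)%:M (rsubmx z) = z.
  rewrite -[RHS]hsubmxK; congr row_mx; apply/rowP => i.
  rewrite (ord1 i) !mxE eqxx mulr1n; congr (z _ _); exact: val_inj.
by move=> ->.
Qed.

End row_mx_product.

Section surface.
Variables (R : realType) (m : nat).
Local Notation d := m.+1.
Local Notation leb := (lebesgue_rV R).
Variables (F : 'rV[R]_d) (S : set 'rV[R]_d).
Hypothesis hS : smooth_hypersurface S.
Variable n : 'rV[R]_d -> 'rV[R]_d.
Hypothesis hn : unit_normal S n.
Hypothesis hFn : forall x, S x -> dot F (n x) != 0.
Hypothesis hPhi : flow_C1_diffeo S F.
Variables (pi : 'rV[R]_d -> 'rV[R]_d) (tau : 'rV[R]_d -> R).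
Hypothesis hpi : forall x, S (pi x) /\ x = pi x + tau x *: F.
Variable sigma : {measure set 'rV[R]_d -> \bar R}.
Hypothesis hsigma : surface_measure S sigma.

Lemma measurable_S : measurable S.
Proof. by apply: measurable_closed_rV; exact: (@closed_S _ _ _ _ hPhi _ _ hpi). Qed.

Lemma measurable_pi : measurable_fun setT pi.
Proof.
have [cpi _] := pi_tau_continuous hPhi hpi.
apply: measurable_rV => // i; apply: continuous_rV_measurable => x.
exact: (cvg_comp pi (fun y : 'rV[R]_d => y 0 i) (cpi x) (@coord_continuous _ _ _ _ _ _)).
Qed.

Lemma measurable_tau : measurable_fun setT tau.
Proof.
by have [_ ctau] := pi_tau_continuous hPhi hpi; exact: continuous_rV_measurable.
Qed.

Section at_chart.
Variables (V : set 'rV[R]_m) (gamma : 'rV[R]_m -> 'rV[R]_d).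
Hypothesis gammaP : local_param S V gamma.
Local Notation W := (chart_dom pi V gamma).
Local Notation th := (theta pi V gamma).

Let oV : open V. Proof. by case: gammaP. Qed.
Let oW : open W. Proof. exact: (@open_chart_dom _ _ _ _ hPhi _ _ hpi _ _ gammaP). Qed.

Definition density u := \det ('J gamma u *m ('J gamma u)^T).

Lemma ksmooth_density k : ksmooth k V density.
Proof.
apply: ksmooth_det => // i j.
have : ksmooth k V (fun u => \sum_l frame F gamma u (rshift 1 i) l * frame F gamma u (rshift 1 j) l).
  by apply: ksmooth_sum => // l _; apply: ksmooth_mul => //; exact: ksmooth_frame gammaP _ _ _.
apply: eq_ksmooth => // u _; rewrite mxE; apply: eq_bigr => l _.
by rewrite /frame !col_mxEd; congr (_ * _); rewrite [RHS]mxE.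
Qed.

Lemma density_gt0 u : V u -> 0 < density u.
Proof.
move=> Vu; have Su := param_S gammaP Vu.
have dotE (x y : 'rV[R]_d) : x *m y^T = (dot x y)%:M.
  apply/matrixP => i j; rewrite (ord1 i) (ord1 j) !mxE eqxx mulr1n /dot.
  by apply: eq_bigr => k _; rewrite mxE.
have [hn1 hnD] := hn.
apply: (@gram_det_gt0 _ _ _ (n (gamma u))); first by case: gammaP => _ _ _ + _; apply.
  by rewrite dotE hn1.
apply/row_matrixP => i; rewrite row0 row_mul rowE.
rewrite -(deriveEjacobian _ (param_diff gammaP Vu)).
rewrite dotE (_ : dot _ _ = dot (n (gamma u)) ('D_(delta_mx 0 i) gamma u)); last first.
  by apply: eq_bigr => k _; exact: mulrC.
by rewrite (hnD V gamma gammaP)// raddf0.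
Qed.

Lemma measurable_sqrt_density : measurable_fun V (fun u => (Num.sqrt (density u))%:E).
Proof.
apply/measurable_EFinP; apply: open_continuous_measurable => // u Vu.
apply: differentiable_continuous.
have sd := ksmooth_sqrt oV (fun u => @density_gt0 u) (ksmooth_density 0).
exact: ksmooth_diff sd Vu.
Qed.

Lemma measurable_gamma : measurable_fun V gamma.
Proof.
have mV := measurable_open_rV oV.
apply: measurable_rV => // i; apply: open_continuous_measurable => // u Vu.
apply: differentiable_continuous.
exact: ksmooth_diff (param_component gammaP 0 i) Vu.
Qed.

(** Time is the first coordinate, the outermost one in [lebesgue_rV], so that [lebesgue_rV_prod]
    computes the measure of a time interval times a set of parameters. *)
Definition Psi (z : 'rV[R]_(1 + m)) : 'rV[R]_d := gamma (rsubmx z) + z 0 0 *: F.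
Definition PsiV (x : 'rV[R]_d) : 'rV[R]_(1 + m) := row_mx (tau x)%:M (th x).
Definition Psi_dom := [set z : 'rV[R]_(1 + m) | V (rsubmx z)].

Lemma open_Psi_dom : open Psi_dom.
Proof. by apply: open_comp => // z _; exact: continuous_rsubmx. Qed.

Lemma PsiV0 x : PsiV x 0 0 = tau x.
Proof.
rewrite /PsiV; have -> : 0 = lshift m (0 : 'I_1) :> 'I_(1 + m) by exact: val_inj.
by rewrite row_mxEl mxE eqxx mulr1n.
Qed.

Lemma PsiK x : W x -> Psi (PsiV x) = x.
Proof.
move=> Wx; rewrite /Psi PsiV0 /PsiV row_mxKr.
by have [_ ->] := thetaP Wx; have [_ <-] := hpi x.
Qed.

Lemma PsiVK z : Psi_dom z -> PsiV (Psi z) = z.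
Proof.
move=> Vz; rewrite /PsiV /Psi (theta_flow hPhi hpi gammaP _ Vz).
have [_ ->] := pi_tau_flow hPhi hpi (z 0 0) (param_S gammaP Vz).
rewrite -[RHS]hsubmxK; congr row_mx; apply/rowP => i.
by rewrite (ord1 i) !mxE eqxx mulr1n; congr (z _ _); exact: val_inj.
Qed.

Lemma ksmooth_Psi k i : ksmooth k Psi_dom (fun z => Psi z 0 i).
Proof.
have oP := open_Psi_dom.
have sr : ksmooth k Psi_dom ((fun u => gamma u 0 i) \o rsubmx).
  apply: (@ksmooth_comp R 'rV[R]_(1 + m) 'rV[R]_m k 'I_m (fun j => delta_mx 0 j)
    (fun j z => z 0 (rshift 1 j)) rsubmx Psi_dom V) => //.
  - by move=> z _; rewrite [LHS]row_sum_delta; apply: eq_bigr => j _; rewrite mxE.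
  - by move=> j; exact: ksmooth_coord.
  - exact: (param_component gammaP k i).
have s0 : ksmooth k Psi_dom (fun z : 'rV[R]_(1 + m) => F 0 i * z 0 0).
  by apply: ksmooth_scale => //; exact: ksmooth_coord.
apply: eq_ksmooth (ksmooth_add oP sr s0) => // z _.
by rewrite /Psi !mxE mulrC.
Qed.

Lemma ksmooth_PsiV k i : ksmooth k W (fun x => PsiV x 0 i).
Proof.
have [j|j] := split_ordP i.
  move=> ->; apply: eq_ksmooth (ksmooth_tau_chart hn hFn hPhi hpi gammaP k) => // x _.
  by rewrite /PsiV row_mxEl (ord1 j) mxE eqxx mulr1n.
move=> ->; apply: eq_ksmooth (ksmooth_theta_coord hn hFn hPhi hpi gammaP k j) => // x _.
by rewrite /PsiV row_mxEr.
Qed.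

Lemma measurable_on (n1 n2 : nat) (U : set 'rV[R]_n1) (G : 'rV[R]_n1 -> 'rV[R]_n2) :
  open U -> (forall i, ksmooth 0 U (fun x => G x 0 i)) -> measurable_fun U G.
Proof.
move=> oU sG; have mU := measurable_open_rV oU.
apply: measurable_rV => // i; apply: open_continuous_measurable => // u Uu.
by apply: differentiable_continuous; exact: ksmooth_diff (sG i) Uu.
Qed.

Lemma open_preimage_on (n1 n2 : nat) (U : set 'rV[R]_n1) (G : 'rV[R]_n1 -> 'rV[R]_n2) B :
  open U -> (forall i, ksmooth 0 U (fun x => G x 0 i)) -> open B -> open (U `&` G @^-1` B).
Proof.
move=> oU sG oB; rewrite openE => x [Ux Bx]; apply: filterI; first exact: open_nbhs_nbhs.
suff cG : G y @[y --> x] --> G x.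
  by apply: (cG B); exact: open_nbhs_nbhs.
have H : (\sum_i G y 0 i *: (delta_mx 0 i : 'rV[R]_n2)) @[y --> x] -->
    \sum_i G x 0 i *: (delta_mx 0 i : 'rV[R]_n2).
  apply: (@cvg_sumr _ _ _ (nbhs x) _) => i.
  apply: (@cvgZr_tmp _ _ _ (nbhs x) _ (fun y => G y 0 i)).
  exact: (differentiable_continuous (ksmooth_diff (sG i) Ux)).
move: H; rewrite -row_sum_delta.
have -> // : (fun y => \sum_i G y 0 i *: (delta_mx 0 i : 'rV[R]_n2)) = G.
by apply/funext => y; rewrite -row_sum_delta.
Qed.

(** In the chart, the preimage under [pi] is an interval of times multiplied by a set of parameters.
    The Lipschitz bound for [Psi] compares volumes; the surface density, at least [Num.sqrt c] near
    the centre, then compares the parameters with [sigma]. *)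
Lemma surface_le_chart x : W x -> exists Q (C : R),
  [/\ open Q, Q x, 0 <= C & forall A, measurable A ->
    (leb d (Q `&` pi @^-1` A) <= C%:E * sigma A)%E].
Proof.
move=> Wx; have [Vt _] := thetaP Wx.
have Pz : Psi_dom (PsiV x) by rewrite /Psi_dom/= /PsiV row_mxKr.
have [L [r1 [L0 r10 r1P PL]]] := vector_lipschitz open_Psi_dom Pz (fun i => ksmooth_Psi 1 i).
have d0 := density_gt0 Vt.
have cd : {for th x, continuous density}.
  by apply: differentiable_continuous; exact: ksmooth_diff (ksmooth_density 0) Vt.
pose c := density (th x) / 2.
have c0 : 0 < c by rewrite divr_gt0.
have : nbhs (th x) (V `&` [set u | c < density u]).
  apply: filterI; first exact: open_nbhs_nbhs.
  by apply: (cvgr_gt _ cd); rewrite ltr_pdivrMr// ltr_pMr// ltr1n.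
move=> /nbhs_ballP[r2 /= r20 r2P].
pose r := Num.min r1 r2.
have r0 : 0 < r by rewrite lt_min r10.
pose b := ball (PsiV x) r.
have bP z : b z -> Psi_dom z by move=> /(@le_ball _ _ _ _ _ _)/r1P; apply; rewrite ge_min lexx.
pose Q := W `&` PsiV @^-1` b.
have oQ : open Q.
  by apply: open_preimage_on => //; [exact: ksmooth_PsiV|exact: ball_open].
have mQ := measurable_open_rV oQ.
have mPsiV : measurable_fun Q PsiV.
  apply: (measurable_funS (measurable_open_rV oW)); first exact: subIsetl.
  by apply: measurable_on => // i; exact: ksmooth_PsiV.
have HL y z : Q y -> Q z -> `|y - z| <= L * `|PsiV y - PsiV z|.
  move=> [Wy yb] [Wz zb]; rewrite -{1}(PsiK Wy) -{1}(PsiK Wz).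
  by apply: PL; [apply: le_ball yb|apply: le_ball zb]; rewrite ge_min lexx.
pose K := (L *+ 2) ^+ d * 2 ^+ d.
have K0 : 0 <= K by rewrite mulr_ge0 ?exprn_ge0// mulrn_wge0// ltW.
pose bu := ball (th x) r.
have obu : open bu by exact: ball_open.
have buV : bu `<=` V `&` [set u | c < density u].
  by move=> u /(@le_ball _ _ _ _ _ _)/r2P; apply; rewrite ge_min lexx orbT.
exists Q, (K * ((r *+ 2) * (Num.sqrt c)^-1)); split=> //.
- by split=> //; exact: ballxx.
- by rewrite mulr_ge0// mulr_ge0 ?invr_ge0 ?sqrtr_ge0// mulrn_wge0// ltW.
move=> A mA.
pose Bu := bu `&` gamma @^-1` A.
have mBu : measurable Bu.
  have mbu := measurable_open_rV obu.
  have := measurable_funS (measurable_open_rV oV) _ measurable_gamma.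
  by move=> /(_ bu); apply => // u /buV[].
pose B := [set z | (ball (tau x) r : set R) ((z : 'rV[R]_(1 + m)) 0 0) /\
   Bu (rsubmx (z : 'rV[R]_(1 + m)))].
have mb1 : measurable (ball (tau x) r : set R) by exact: measurable_ball.
have mB : measurable B.
  apply: measurableI.
    rewrite -[X in measurable X]setTI; apply: (measurable_coord _) => //.
  rewrite -[X in measurable X]setTI; apply: measurable_on => //; first exact: openT.
  move=> i; apply: (eq_ksmooth _ _ (ksmooth_coord 0 (rshift 1 i) (@openT 'rV[R]_(1 + m)))) => //.
    exact: openT.
  by move=> z _; rewrite mxE.
have QE : Q `&` pi @^-1` A = Q `&` PsiV @^-1` B.
  apply/seteqP; split=> y [[Wy yb] Ay]; split=> //; have [_ gy] := thetaP Wy.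
    have [yb1 yb2] := (ball_row_mx _ _ r0).1 yb.
    rewrite !PsiV0 in yb1; rewrite /PsiV !row_mxKr in yb2.
    by rewrite /B /= PsiV0 /PsiV row_mxKr; split=> //; split=> //=; rewrite gy.
  by move: Ay; rewrite /B /= /PsiV row_mxKr => -[_ [_ /=]]; rewrite gy.
rewrite QE.
apply: (le_trans (lipschitz_le L0 mQ mPsiV HL mB)).
rewrite [X in (_ <= X * _)%E]EFinM -[X in (_ <= X)%E]muleA lee_wpmul2l// lebesgue_rV_prod//.
rewrite lebesgue_measure_ball ?(ltW r0)// [X in (_ <= X * _)%E]EFinM -[X in (_ <= X)%E]muleA lee_wpmul2l ?lee_fin ?mulrn_wge0 ?(ltW r0)//.
have [U oU gU] : exists2 U, open U & gamma @` bu = S `&` U.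
  by case: gammaP => _ _ _ _; apply => // u /buV[].
have mAU : measurable (A `&` (S `&` U)).
  apply: measurableI => //; apply: measurableI; first exact: measurable_S.
  exact: measurable_open_rV.
have AUV : A `&` (S `&` U) `<=` gamma @` V.
  by rewrite -gU => y [_ [u /buV[Vu _] <-]]; exists u.
have [_ sgE] := hsigma.
have sA : (sigma (A `&` (S `&` U)) <= sigma A)%E by apply: le_measure; rewrite ?inE.
apply: (@le_trans _ _ ((Num.sqrt c)^-1%:E * sigma (A `&` (S `&` U)))%E); last first.
  by rewrite lee_wpmul2l// lee_fin invr_ge0 sqrtr_ge0.
rewrite (sgE V gamma gammaP _ mAU AUV).
have -> : V `&` gamma @^-1` (A `&` (S `&` U)) = Bu.
  rewrite -gU; apply/seteqP; split=> u.
    move=> [Vu [Au [u' bu' uu']]]; have [Vu' _] := buV _ bu'.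
    have <- : u' = u by case: gammaP => _ _ inj _ _; apply: inj; rewrite ?inE.
    by split=> //=; rewrite /preimage/= uu'.
  by move=> [bu' Au]; have [Vu _] := buV _ bu'; split=> //; split=> //; exists u.
have sc0 : 0 < Num.sqrt c by rewrite sqrtr_gt0.
apply: (@le_trans _ _ ((Num.sqrt c)^-1%:E * \int[leb m]_(u in Bu) (Num.sqrt c)%:E)%E).
  by rewrite integral_cst// muleA -EFinM mulVf ?mul1e// gt_eqF.
rewrite lee_wpmul2l ?lee_fin ?invr_ge0 ?sqrtr_ge0//.
apply: ge0_le_integral => //=.
- apply: (measurable_funS (measurable_open_rV oV)); last exact: measurable_sqrt_density.
  by move=> u [/buV[]].
- by move=> u [/buV[_ /ltW cu] _]; rewrite lee_fin ler_wsqrtr.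
Qed.

(** By invariance, [A] read in the chart contains a time interval of positive length multiplied by
    the parameters of its points on the surface. This product is null because [PsiV] is Lipschitz,
    hence so is the set of parameters. *)
Lemma surface_null_chart (A : set 'rV[R]_d) (y : 'rV[R]_d) : measurable A -> (forall x s, A x -> A (x + s *: F)) ->
  leb d A = 0%E -> W y -> S y ->
  exists U, [/\ open U, U y & sigma (A `&` S `&` U) = 0%E].
Proof.
move=> mA Ainv A0 Wy Sy; have [Vt gt] := thetaP Wy.
have [L [r1 [L0 r10 r1W PL]]] := vector_lipschitz oW Wy (fun i => ksmooth_PsiV 1 i).
pose Q := Psi_dom `&` Psi @^-1` ball y r1.
have oQ : open Q.
  by apply: open_preimage_on; [exact: open_Psi_dom|exact: ksmooth_Psi|exact: ball_open].
have mQ := measurable_open_rV oQ.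
have mPsi : measurable_fun Q Psi.
  apply: (measurable_funS (measurable_open_rV open_Psi_dom)); first exact: subIsetl.
  by apply: measurable_on => [|i]; [exact: open_Psi_dom|exact: ksmooth_Psi].
have HL p q : Q p -> Q q -> `|p - q| <= L * `|Psi p - Psi q|.
  move=> [Vp pb] [Vq qb]; rewrite -{1}(PsiVK Vp) -{1}(PsiVK Vq).
  exact: PL.
have Q0 : leb d (Q `&` Psi @^-1` A) = 0%E.
  apply/eqP; rewrite eq_le measure_ge0 andbT.
  by apply: (le_trans (lipschitz_le L0 mQ mPsi HL mA)); rewrite A0 mule0.
have Qy : Q (PsiV y).
  split; first by rewrite /Psi_dom/= /PsiV row_mxKr.
  by rewrite /preimage/= PsiK//; exact: ballxx.
have /nbhs_ballP[r /= r0 rQ] : nbhs (PsiV y) Q by exact: open_nbhs_nbhs.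
pose bu := ball (th y) r.
have obu : open bu by exact: ball_open.
have buV : bu `<=` V.
  move=> u ru; have : ball (PsiV y) r (row_mx (tau y)%:M u : 'rV[R]_(1 + m)).
    apply/(ball_row_mx _ _ r0); rewrite PsiV0 /PsiV !row_mxKr; split=> //.
    have -> : 0 = lshift m (0 : 'I_1) :> 'I_(1 + m) by exact: val_inj.
    by rewrite row_mxEl mxE eqxx mulr1n; exact: ballxx.
  by move=> /rQ[]; rewrite /Psi_dom/= row_mxKr.
pose Bu := bu `&` gamma @^-1` A.
have mBu : measurable Bu.
  have mbu := measurable_open_rV obu.
  have := measurable_funS (measurable_open_rV oV) _ measurable_gamma.
  by move=> /(_ bu); apply.
pose B := [set z | (ball (tau y) r : set R) ((z : 'rV[R]_(1 + m)) 0 0) /\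
   Bu (rsubmx (z : 'rV[R]_(1 + m)))].
have mb1 : measurable (ball (tau y) r : set R) by exact: measurable_ball.
have mB : measurable B.
  apply: measurableI.
    rewrite -[X in measurable X]setTI; apply: (measurable_coord _) => //.
  rewrite -[X in measurable X]setTI; apply: measurable_on => //; first exact: openT.
  move=> i; apply: (eq_ksmooth _ _ (ksmooth_coord 0 (rshift 1 i) (@openT 'rV[R]_(1 + m)))) => //.
    exact: openT.
  by move=> z _; rewrite mxE.
have Bu0 : leb m Bu = 0%E.
  have : leb d B = 0%E.
    apply/eqP; rewrite eq_le measure_ge0 andbT -Q0; apply: le_measure; rewrite ?inE//.
      exact: mPsi.
    move=> z [zb [ub Az]]; have Qz : Q z.
      apply: rQ; apply/(ball_row_mx _ _ r0); rewrite PsiV0 /PsiV row_mxKr; split => //.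
    by split=> //; rewrite /preimage/= /Psi; exact: Ainv.
  rewrite lebesgue_rV_prod// lebesgue_measure_ball ?ltW// => /eqP.
  rewrite mule_eq0 eqe mulrn_eq0/= (gt_eqF r0)/= => /eqP.
  exact.
have [U oU gU] : exists2 U, open U & gamma @` bu = S `&` U.
  by case: gammaP => _ _ _ _; apply.
exists U; split=> //.
  have : (gamma @` bu) y by exists (th y); [exact: ballxx|rewrite gt (pi_id hPhi hpi Sy)].
  by rewrite gU => -[].
have [_ sgE] := hsigma.
have mAU : measurable (A `&` S `&` U).
  apply: measurableI; last exact: measurable_open_rV.
  by apply: measurableI => //; exact: measurable_S.
rewrite (sgE V gamma gammaP _ mAU); last first.
  by rewrite -setIA -gU => z [_ [u /buV Vu <-]]; exists u.
have -> : V `&` gamma @^-1` (A `&` S `&` U) = Bu.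
  rewrite -setIA -gU; apply/seteqP; split=> u.
    move=> [Vu [Au [u' bu' uu']]]; have Vu' := buV _ bu'.
    have <- : u' = u by case: gammaP => _ _ inj _ _; apply: inj; rewrite ?inE.
    by split=> //=; rewrite /preimage/= uu'.
  by move=> [bu' Au]; have Vu := buV _ bu'; split=> //; split=> //; exists u.
apply: null_set_integral => //.
apply: (measurable_funS (measurable_open_rV oV)); last exact: measurable_sqrt_density.
by move=> u [/buV].
Qed.

End at_chart.

Lemma surface_le x : exists Q (C : R),
  [/\ open Q, Q x, 0 <= C & forall A, measurable A ->
    (leb d (Q `&` pi @^-1` A) <= C%:E * sigma A)%E].
Proof.
have [V [gamma [gP Wx]]] := chart_cover hpi hS x.
exact: surface_le_chart gP _ Wx.
Qed.

Lemma surface_null (A : set 'rV[R]_d) : measurable A -> (forall x s, A x -> A (x + s *: F)) ->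
  leb d A = 0%E -> sigma (A `&` S) = 0%E.
Proof.
move=> mA Ainv A0; apply: locally_null.
  by apply: measurableI => //; exact: measurable_S.
move=> y [_ Sy]; have [V [gamma [gP Wy]]] := chart_cover hpi hS y.
exact: surface_null_chart gP _ _ _ _ _ Wy Sy.
Qed.

Lemma null_pi A : measurable A -> sigma A = 0%E -> leb d (pi @^-1` A) = 0%E.
Proof.
move=> mA A0; apply: locally_null.
  by rewrite -[X in measurable X]setTI; exact: measurable_pi.
move=> x _; have [Q [C [oQ Qx C0 QC]]] := surface_le x.
exists Q; split=> //; apply/eqP; rewrite eq_le measure_ge0 andbT setIC.
by apply: (le_trans (QC _ mA)); rewrite A0 mule0.
Qed.

End surface.

(** * Distributional derivatives along lines *)

Section test_functions.
Variables (R : realType) (n : nat).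
Local Notation leb := (lebesgue_rV R n).
Implicit Types (u f w phi : 'rV[R]_n -> R) (e F : 'rV[R]_n) (K : set 'rV[R]_n).

Lemma test_ksmooth phi k : test_function phi -> ksmooth k setT phi.
Proof. by move=> [/ksmoothP s _]; exact: s. Qed.

Lemma test_continuous phi : test_function phi -> continuous phi.
Proof. by move=> /(@test_ksmooth _ 0); exact: ksmooth_continuous. Qed.

Lemma test_derive phi e : test_function phi -> test_function ('D_e phi).
Proof.
move=> tphi; split; first by apply/ksmoothP => k; exact: ksmoothD (test_ksmooth k.+1 tphi).
have [_ [K cK K0]] := tphi; exists K => // x nKx.
have -> : 'D_e phi x = 'D_e (cst 0 : 'rV[R]_n -> R) x.
  apply: near_eq_derive_val.
  have oK : open (~` K) by apply: closed_openC; exact: compact_closed.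
  have := open_nbhs_nbhs (conj oK nKx); apply: filterS => y; exact: K0.
by rewrite derive_cst.
Qed.

Definition sweep e (B : R) K : set 'rV[R]_n := (fun p => p.1 - p.2 *: e) @` (K `*` `[- B, B]).

Lemma compact_sweep e B K : compact K -> compact (sweep e B K).
Proof.
move=> cK; apply: continuous_compact; last first.
  by apply: compact_setX => //; exact: segment_compact.
apply: continuous_subspaceT => p; apply: cvgB; first exact: cvg_fst.
by apply: cvgZr_tmp; exact: cvg_snd.
Qed.

Lemma sweepP e B K x r : `|r| <= B -> K (x + r *: e) -> sweep e B K x.
Proof.
move=> rB Kx; exists (x + r *: e, r) => /=; last by rewrite addrK.
by split => //=; rewrite in_itv/= -ler_norml.
Qed.

Lemma line_int_out e B w K x : (forall x, ~ K x -> w x = 0) ->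
  ~ sweep e B K x -> line_int e B w x = 0.
Proof.
move=> w0 nx; transitivity (\int[lebesgue_measure]_(r in `[0, B]) (cst 0 r : R)).
  apply: eq_Rintegral => r; rewrite inE/= in_itv/= => /andP[r0 rB].
  by apply: w0 => Kx; apply: nx; apply: sweepP Kx; rewrite ger0_norm.
by rewrite Rintegral_cst// mul0r.
Qed.

Lemma test_line_int e B w : 0 <= B -> test_function w -> test_function (line_int e B w).
Proof.
move=> B0 tw; split.
  by apply/ksmoothP => k; apply: ksmooth_line_int => //; exact: test_ksmooth tw.
have [_ [K cK K0]] := tw; exists (sweep e B K); first exact: compact_sweep.
by move=> x; exact: line_int_out.
Qed.

Lemma test_opp w : test_function w -> test_function (fun x => - w x).
Proof.
move=> tw; split.
  by apply/ksmoothP => k; apply: ksmooth_opp; [exact: openT|exact: test_ksmooth tw].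
by have [_ [K cK K0]] := tw; exists K => // x /K0 ->; rewrite oppr0.
Qed.

Lemma distr_directional u phi F : loc_int u -> test_function phi ->
  \sum_(j < n) F 0 j * distr_partial j (distr_of u) phi =
  - \int[leb]_x (u x * 'D_F phi x).
Proof.
move=> lu tphi.
have [|_ E] := @Rintegral_sum _ _ R leb setT _ (index_enum 'I_n)
  (fun j x => F 0 j * (u x * partial j phi x)) measurableT.
  move=> j; have tj := test_derive (delta_mx 0 j) tphi.
  have [_ [K cK K0]] := tj.
  exact: (integrableZl measurableT (F 0 j) (loc_int_mul lu (test_continuous tj) cK K0)).
transitivity (- \int[leb]_x \sum_(j <- index_enum 'I_n) F 0 j * (u x * partial j phi x)).
  rewrite E -sumrN; apply: eq_bigr => j _; rewrite /distr_partial /distr_of RintegralZl//.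
    by rewrite mulrN.
  have tj := test_derive (delta_mx 0 j) tphi.
  have [_ [K cK K0]] := tj.
  exact: (loc_int_mul lu (test_continuous tj) cK K0).
congr (- _); apply: eq_Rintegral => x _; rewrite derive_coord; last first.
  exact: ksmooth_diff (test_ksmooth 0 tphi) _.
by rewrite mulr_sumr; apply: eq_bigr => j _; rewrite mulrCA.
Qed.

Lemma test_integrable u phi : loc_int u -> test_function phi ->
  leb.-integrable setT (EFin \o (fun x => u x * phi x)).
Proof.
move=> lu tphi; have [_ [K cK K0]] := tphi.
exact: (loc_int_mul lu (test_continuous tphi) cK K0).
Qed.

Lemma Rintegral_segment_cst (c B : R) : 0 <= B ->
  \int[lebesgue_measure]_(r in `[0, B]) c = c * B.
Proof.
move=> B0; rewrite Rintegral_cst//= lebesgue_measure_itv/= lte_fin.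
case: ifPn => [Bp|]; first by rewrite -EFinD/= subr0.
by rewrite -leNgt => B0'; rewrite (@le_anti _ _ B 0) ?B0 ?B0'.
Qed.

Lemma segment_cst_integrable (c B : R) :
  lebesgue_measure.-integrable `[0, B] (EFin \o (fun=> c)).
Proof.
apply: continuous_compact_integrable; first exact: segment_compact.
by apply: continuous_subspaceT => ?; exact: cvg_cst.
Qed.

Lemma line_int_le e w B C x : 0 <= B -> continuous w -> (forall y, `|w y| <= C) ->
  `|line_int e B w x| <= B * C.
Proof.
move=> B0 cw wC; apply: (le_trans (le_normr_Rintegral _ (line_integrable e x B cw))) => //.
apply: (@le_trans _ _ (\int[lebesgue_measure]_(r in `[0, B]) (cst C r))).
  apply: le_Rintegral => //.
  - exact: (integrable_norm (line_integrable e x B cw)).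
  - exact: segment_cst_integrable.
by rewrite Rintegral_segment_cst// mulrC.
Qed.

(** Means over segments of parameter length [1 / (k + 1)] play the part of mollifiers: they converge
    pointwise to [w], keep its bound, and vanish off one compact set, so that a multiple of [|u|]
    dominates. *)
Lemma line_mean_cvg u w e : loc_int u -> test_function w ->
  (\int[leb]_x (u x * (k.+1%:R * line_int e k.+1%:R^-1 w x)))
    @[k --> \oo] --> \int[leb]_x (u x * w x).
Proof.
move=> lu tw; have cw := test_continuous tw.
have [mu uK] := lu.
have [_ [K cK K0]] := tw.
have [C C0 wC] := supported_bounded cw cK K0.
pose K' := sweep e 1 K.
have cK' : compact (K' : set 'rV[R]_n) by exact: compact_sweep.
have mK' := compact_measurable_rV cK'.
have r1 k : 0 <= k.+1%:R^-1 :> R by rewrite invr_ge0.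
have tk k := @test_line_int e k.+1%:R^-1 w (r1 k) tw.
have mk k : measurable_fun setT (line_int e k.+1%:R^-1 w).
  by apply: continuous_rV_measurable; exact: test_continuous.
have Kk k x : ~ K' x -> line_int e k.+1%:R^-1 w x = 0.
  move=> nx; apply: (line_int_out K0) => -[[y r] [/= Ky]].
  rewrite in_itv/= => /andP[r0 rB] E; apply: nx; exists (y, r) => //; split=> //=.
  have k1 : k.+1%:R^-1 <= 1 :> R by rewrite invf_le1// ler1n.
  by rewrite in_itv/= (le_trans _ r0) ?lerN2// (le_trans rB).
have [] := @dominated_convergence _ _ _ leb setT measurableT
  (fun k x => (u x * (k.+1%:R * line_int e k.+1%:R^-1 w x))%:E)
  (EFin \o (fun x => u x * w x))
  ((EFin \o (fun x => C * `|u x|)) \_ K').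
- move=> k; apply/measurable_EFinP; apply: measurable_funM => //.
  by apply: measurable_funM => //; exact: measurable_cst.
- apply/measurable_EFinP; apply: measurable_funM => //.
  exact: continuous_rV_measurable.
- apply: aeW => x _ /=; apply: cvg_EFin; first exact: nearW.
  apply: cvgM; first exact: cvg_cst.
  apply/cvgrPdist_le => eps eps0.
  have /cvgrPdist_le/(_ eps eps0)/nbhs_ballP[d /= d0 dP] := @line_continuous R n w e x cw 0.
  near=> k.
  have kd : k.+1%:R^-1 < d by near: k; exact: near_infty_natSinv_lt (PosNum d0).
  have E : w x = k.+1%:R * \int[lebesgue_measure]_(r in `[0, k.+1%:R^-1]) w x.
    by rewrite Rintegral_segment_cst// mulrCA mulfV ?mulr1// pnatr_eq0.
  have ic : lebesgue_measure.-integrable `[0, k.+1%:R^-1] (EFin \o (fun r : R => w x)).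
    exact: segment_cst_integrable.
  have il := line_integrable e x k.+1%:R^-1 cw.
  rewrite {1}E -mulrBr -RintegralB// normrM gtr0_norm//.
  have i2 : lebesgue_measure.-integrable `[0, k.+1%:R^-1]
      (EFin \o (fun r : R => w x - w (x + r *: e))) by exact: (integrableB _ ic il).
  apply: (@le_trans _ _ (k.+1%:R * \int[lebesgue_measure]_(r in `[0, k.+1%:R^-1]) (cst eps r))).
    rewrite ler_wpM2l//.
    apply: (le_trans (le_normr_Rintegral _ i2)) => //.
    apply: le_Rintegral => //.
    + exact: (integrable_norm i2).
    + exact: segment_cst_integrable.
    + move=> r; rewrite /= in_itv/= => /andP[r0 rk].
      have /= := dP r; rewrite scale0r addr0; apply.
      rewrite /ball/= sub0r normrN ger0_norm//.
      exact: le_lt_trans kd.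
  by rewrite Rintegral_segment_cst// mulrCA mulfV ?mulr1// pnatr_eq0.
- apply/(integrable_mkcond _ mK').
  exact: (integrableZl mK' C (integrable_norm (uK _ cK'))).
- apply: aeW => x k _ /=; rewrite /patch; case: ifPn => [_|]; last first.
    by rewrite notin_setE => /(Kk k) ->; rewrite !mulr0 normr0.
  rewrite /= lee_fin normrM mulrC ler_wpM2r// normrM ger0_norm//.
  rewrite -ler_pdivlMl//; exact: line_int_le.
move=> _ _ H; have := @fine_cvg _ _ \oo _ _ (\int[leb]_x (u x * w x)).
apply; rewrite [X in _ --> X]fineK; first exact: H.
exact: (integrable_fin_num _ (test_integrable lu tw)).
Unshelve. all: by end_near. Qed.

End test_functions.

Section lines.
Variables (R : realType) (n : nat).
Local Notation leb := (lebesgue_rV R n).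
Implicit Types (u f w phi : 'rV[R]_n -> R) (e F : 'rV[R]_n) (K : set 'rV[R]_n).

(** Fubini and translation invariance. The inner integral stays an extended real, as [f] need not be
    integrable on each individual segment. *)
Lemma line_int_adjoint f phi F B : 0 <= B -> loc_int f -> test_function phi ->
  measurable_fun setT (fun x =>
    (\int[lebesgue_measure]_(r in `[0%R, B]) (phi x * f (x + r *: F))%:E)%E) /\
  (\int[leb]_x \int[lebesgue_measure]_(r in `[0%R, B]) (phi x * f (x + r *: F))%:E =
   \int[leb]_x (f x * line_int (- F) B phi x)%:E)%E.
Proof.
move=> B0 lf tphi; have cphi := test_continuous tphi.
have [mf fK] := lf.
have [_ [K cK K0]] := tphi.
have [C C0 phiC] := supported_bounded cphi cK K0.
have mphi : measurable_fun setT phi by exact: continuous_rV_measurable.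
pose I := (`[0, B]%classic : set R).
have mI : measurable I by exact: measurable_itv.
have lebI : lebesgue_measure I = B%:E.
  rewrite /I lebesgue_measure_itv/= lte_fin.
  case: ifPn => [Bp|]; first by rewrite -EFinD subr0.
  by rewrite -leNgt => B0'; rewrite (@le_anti _ _ B 0) ?B0 ?B0'.
pose K' : set 'rV[R]_n := sweep (- F) B K.
have cK' : compact K' by exact: compact_sweep.
have mK' := compact_measurable_rV cK'.
(* [k2] is the integrand of the claim and [k] its translate at each fixed time. Integrability is
   checked on [k], where [f] is not moved and a fixed compact set suffices. *)
pose k (p : 'rV[R]_n * R) := f p.1 * phi (flow (- F) p) * \1_I p.2.
pose k2 (p : 'rV[R]_n * R) := phi p.1 * f (flow F p) * \1_I p.2.
have m1 : measurable_fun setT (fun p : 'rV[R]_n * R => \1_I p.2 : R).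
  by apply: measurableT_comp => //; exact: measurable_indic.
have mk : measurable_fun setT k.
  apply: measurable_funM => //; apply: measurable_funM.
    by apply: measurableT_comp.
  by apply: measurableT_comp => //; exact: measurable_flow.
have mk2 : measurable_fun setT k2.
  apply: measurable_funM => //; apply: measurable_funM.
    by apply: measurableT_comp.
  by apply: measurableT_comp => //; exact: measurable_flow.
have mEk : measurable_fun setT (EFin \o k) by exact/measurable_EFinP.
have mEk2 : measurable_fun setT (EFin \o k2) by exact/measurable_EFinP.
have kI : (leb \x lebesgue_measure)%E.-integrable setT (EFin \o k).
  apply/(integrable12ltyP leb (@lebesgue_measure R) mEk).
  have IK : leb.-integrable setT ((EFin \o f) \_ K').
    by apply/(integrable_mkcond _ mK'); exact: fK.
  have /integrableP[mIK IKoo] := IK.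
  apply: (@le_lt_trans _ _ (\int[leb]_x ((C * B)%:E * `|((EFin \o f) \_ K') x|))%E); last first.
    rewrite ge0_integralZl//; last 2 first.
    - exact: measurableT_comp.
    - by rewrite lee_fin mulr_ge0// ltW.
    apply: lte_mul_pinfty => //.
    by rewrite lee_fin mulr_ge0// ltW.
  apply: ge0_le_integral => //.
  - by move=> x _; apply: integral_ge0 => y _; rewrite abse_ge0.
  - by apply: (@measurable_fun_fubini_tonelli_F _ _ _ _ _ (@lebesgue_measure R)
      (fun p => `|(EFin \o k) p|)%E) => //; exact: measurableT_comp.
  - by apply: measurable_funeM; exact: measurableT_comp.
  move=> x _; apply: (@le_trans _ _
    (\int[lebesgue_measure]_y (((C%:E * `|((EFin \o f) \_ K') x|)) * (\1_I y)%:E))%E).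
    apply: ge0_le_integral => //.
    - apply: measurableT_comp => //.
      exact: (measurableT_comp mEk (pair1_measurable x)).
    - by apply: measurable_funeM; apply/measurable_EFinP; exact: measurable_indic.
    move=> y _; rewrite /k/= /flow/= indicE.
    have [yI|nyI] := boolP (y \in I); last by rewrite mulr0 normr0 mule0.
    rewrite mulr1 mule1 /patch; case: ifPn => [_|]; last first.
      rewrite notin_setE => nx.
      rewrite (K0 (x + y *: - F)) ?mulr0 ?normr0 ?abse0 ?mule0// => Kx.
      apply: nx; apply: sweepP Kx.
      by move: yI; rewrite inE /I/= in_itv/= => /andP[y0 yB]; rewrite ger0_norm.
    by rewrite /= -EFinM lee_fin normrM mulrC ler_wpM2r.
  rewrite ge0_integralZl//; last 2 first.
  - by apply/measurable_EFinP; exact: measurable_indic.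
  - by rewrite mule_ge0// lee_fin ltW.
  by rewrite integral_indic// setIT [X in (_ * X <= _)%E]lebI EFinM muleAC.
have shift y : (\int[leb]_x (k2 (x, y))%:E = \int[leb]_x (k (x, y))%:E)%E.
  have mk2y : measurable_fun setT (fun x => (k2 (x, y))%:E).
    exact: (measurableT_comp mEk2 (pair2_measurable y)).
  rewrite -(integral_preserving (measurable_shift_rV (y *: - F))
    (lebesgue_rV_shift (y *: - F)) mk2y).
  apply: eq_integral => x _; rewrite /k2 /k/= /flow/=.
  by rewrite scalerN subrK [phi _ * _]mulrC.
have k2I : (leb \x lebesgue_measure)%E.-integrable setT (EFin \o k2).
  apply/(integrable12ltyP leb (@lebesgue_measure R) mEk2).
  have /(integrable12ltyP leb (@lebesgue_measure R) mEk) := kI.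
  have mA := @measurableT_comp _ _ _ _ _ _ _ _ _ (@abse_measurable R setT) mEk.
  have mA2 := @measurableT_comp _ _ _ _ _ _ _ _ _ (@abse_measurable R setT) mEk2.
  have A0 (g : 'rV[R]_n * R -> \bar R) p : (0 <= `|g p|)%E by exact: abse_ge0.
  apply: le_lt_trans; rewrite le_eqVlt; apply/orP; left; apply/eqP.
  transitivity (\int[lebesgue_measure]_y \int[leb]_x `|(EFin \o k2) (x, y)|)%E.
    exact: (@fubini_tonelli _ _ _ _ _ leb (@lebesgue_measure R) _ mA2 (A0 (EFin \o k2))).
  transitivity (\int[lebesgue_measure]_y \int[leb]_x `|(EFin \o k) (x, y)|)%E; last first.
    by symmetry; exact: (@fubini_tonelli _ _ _ _ _ leb (@lebesgue_measure R) _ mA (A0 (EFin \o k))).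
  apply: eq_integral => y _.
  have mk2y : measurable_fun setT (fun x => `|(EFin \o k2) (x, y)|%E).
    exact: (measurableT_comp mA2 (pair2_measurable y)).
  rewrite -(integral_preserving (measurable_shift_rV (y *: - F))
    (lebesgue_rV_shift (y *: - F)) mk2y).
  apply: eq_integral => x _; rewrite /k2 /k/= /flow/=.
  by rewrite scalerN subrK [phi _ * _]mulrC.
have E2 x : fubini_F (@lebesgue_measure R) (EFin \o k2) x =
    (\int[lebesgue_measure]_(r in `[0%R, B]) (phi x * f (x + r *: F))%:E)%E.
  rewrite [RHS]integral_mkcond /fubini_F; apply: eq_integral => r _.
  rewrite /k2 /= /flow/= patchE indicE.
  by case: ifPn => _; rewrite ?mulr1 ?mulr0.
have E1 x : fubini_F (@lebesgue_measure R) (EFin \o k) x =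
    (f x * line_int (- F) B phi x)%:E.
  transitivity (\int[lebesgue_measure]_(r in `[0%R, B]) ((f x)%:E * (phi (x + r *: - F))%:E))%E.
    rewrite [RHS]integral_mkcond /fubini_F; apply: eq_integral => r _.
    rewrite /k /= /flow/= patchE indicE.
    by case: ifPn => _; rewrite ?mulr1 ?mulr0.
  have il := line_integrable (- F) x B cphi.
  rewrite integralZl// EFinM; congr (_ * _)%E.
  by rewrite /line_int /Rintegral fineK//; exact: (integrable_fin_num _ il).
split.
  have := measurable_fubini_F k2I; congr (measurable_fun _ _).
  by apply/funext => x; rewrite E2.
transitivity (\int[leb]_x fubini_F (@lebesgue_measure R) (EFin \o k2) x)%E.
  by apply: eq_integral => x _; rewrite E2.
rewrite [LHS](Fubini k2I).
transitivity (\int[lebesgue_measure]_y \int[leb]_x (EFin \o k) (x, y))%E.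
  by apply: eq_integral => y _; exact: shift.
by rewrite -(Fubini kI); apply: eq_integral => x _; exact: E1.
Qed.

Lemma distr_shift u phi c : loc_int u -> test_function phi ->
  \int[leb]_x (u (x + c) * phi x) = \int[leb]_x (u x * phi (x - c)).
Proof.
move=> [mu _] tphi; rewrite /Rintegral; congr fine.
have mg : measurable_fun setT (fun x => (u x * phi (x - c))%:E).
  apply/measurable_EFinP; apply: measurable_funM => //.
  apply: measurableT_comp; last exact: (measurable_shift_rV (- c)).
  exact: continuous_rV_measurable (test_continuous tphi).
transitivity (\int[leb]_x (u (x + c) * phi (x + c - c))%:E)%E.
  by apply: eq_integral => x _; rewrite addrK.
exact: (integral_preserving (measurable_shift_rV c) (lebesgue_rV_shift c) mg).
Qed.

(** The translate is [phi] plus the line integral of its derivative, whose smoothness is already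
    known. *)
Lemma test_shift phi F r : 0 <= r -> test_function phi ->
  test_function (fun x => phi (x + r *: F)).
Proof.
move=> r0 tphi.
have E : (fun x => phi (x + r *: F)) = (fun x => line_int F r ('D_F phi) x + phi x).
  apply/funext => x; rewrite line_int_derive ?subrK//; exact: test_ksmooth.
have tl : test_function (line_int F r ('D_F phi)).
  by apply: test_line_int => //; exact: test_derive.
split.
  rewrite E; apply/ksmoothP => k; apply: ksmooth_add; first exact: openT.
    exact: test_ksmooth.
  exact: test_ksmooth.
have [_ [K cK K0]] := tphi.
exists (sweep F r K); first exact: compact_sweep.
move=> x nx; apply: K0 => Kx; apply: nx; apply: sweepP Kx.
by rewrite ger0_norm.
Qed.

(** Pairing the increment of [u] over a segment with [phi] gives the identity [key]; its division by
    the length, with the length tending to 0, yields the equation. *)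
Lemma line_solution u f phi F : loc_int u -> loc_int f -> test_function phi ->
  (forall r, 0 <= r -> {ae leb, forall x,
     lebesgue_measure.-integrable `[0, r] (EFin \o (fun s : R => f (x + s *: F))) /\
     u (x + r *: F) - u x = \int[lebesgue_measure]_(s in `[0, r]) f (x + s *: F)}) ->
  - (\int[leb]_x (u x * 'D_F phi x)) = \int[leb]_x (f x * phi x).
Proof.
move=> lu lf tphi H.
have tD : test_function (fun x => - 'D_F phi x) by exact/test_opp/test_derive.
have key r : 0 <= r -> \int[leb]_x (u x * line_int (- F) r (fun x => - 'D_F phi x) x) =
    \int[leb]_x (f x * line_int (- F) r phi x).
  move=> r0; have [mG] := line_int_adjoint F r0 lf tphi.
  move=> /(congr1 fine) E; rewrite [RHS]/Rintegral -E.
  have DE : (fun x => - 'D_F phi x) = 'D_(- F) phi.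
    apply/funext => x.
    have dphi : differentiable phi x by exact: ksmooth_diff (test_ksmooth 0 tphi) _.
    by rewrite !deriveE// linearN.
  have E1 x : line_int (- F) r (fun x => - 'D_F phi x) x = phi (x - r *: F) - phi x.
    by rewrite DE line_int_derive// ?scalerN//; exact: test_ksmooth.
  have ts : test_function (fun x => phi (x - r *: F)).
    have := @test_shift phi (- F) r r0 tphi; congr test_function.
    by apply/funext => x; rewrite scalerN.
  have lus : leb.-integrable setT (EFin \o (fun x => u (x + r *: F) * phi x)).
    have := integrable_preserving (measurable_shift_rV (r *: F))
      (lebesgue_rV_shift (r *: F)) (test_integrable lu ts).
    by congr (integrable _ _ _); apply/funext => x /=; rewrite addrK.
  transitivity (\int[leb]_x (u (x + r *: F) * phi x - u x * phi x)).
    rewrite (RintegralB measurableT lus (test_integrable lu tphi)).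
    rewrite distr_shift// -(RintegralB measurableT (test_integrable lu ts) (test_integrable lu tphi)).
    by apply: eq_Rintegral => x _; rewrite E1 mulrBr.
  rewrite /Rintegral; congr fine; apply: ae_eq_integral => //.
    apply/measurable_EFinP; apply: measurable_funB; apply: measurable_funM => //.
    - by have [mu _] := lu; apply: measurableT_comp => //; exact: measurable_shift_rV.
    - exact: continuous_rV_measurable (test_continuous tphi).
    - by have [] := lu.
    - exact: continuous_rV_measurable (test_continuous tphi).
  apply: filterS (H r r0) => x [ix Ex] _ /=.
  transitivity ((phi x)%:E * \int[lebesgue_measure]_(s in `[0%R, r]) (f (x + s *: F))%:E)%E; last first.
    by rewrite -integralZl.
  rewrite -mulrBl Ex EFinM muleC; congr (_ * _)%E.
  by rewrite /Rintegral fineK//; exact: (integrable_fin_num _ ix).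
have c1 := @line_mean_cvg R n u _ (- F) lu tD.
have c2 := @line_mean_cvg R n f _ (- F) lf tphi.
have -> : - (\int[leb]_x (u x * 'D_F phi x)) = \int[leb]_x (u x * - 'D_F phi x).
  rewrite -[RHS]opprK; congr (- _); rewrite -mulN1r -RintegralZl//.
    by apply: eq_Rintegral => x _; rewrite mulN1r mulrN opprK.
  exact: test_integrable.
have : (fun k => \int[leb]_x (u x * (k.+1%:R * line_int (- F) k.+1%:R^-1 (fun x => - 'D_F phi x) x))) =
   (fun k => \int[leb]_x (f x * (k.+1%:R * line_int (- F) k.+1%:R^-1 phi x))).
  apply/funext => k.
  have k0 : 0 <= k.+1%:R^-1 :> R by rewrite invr_ge0.
  have t1 := test_line_int (- F) k0 tD.
  have t2 := test_line_int (- F) k0 tphi.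
  transitivity (k.+1%:R * \int[leb]_x (u x * line_int (- F) k.+1%:R^-1 (fun x => - 'D_F phi x) x)).
    rewrite -RintegralZl//; last exact: test_integrable.
    by apply: eq_Rintegral => x _; rewrite mulrCA.
  rewrite key// -RintegralZl//; last exact: test_integrable.
  by apply: eq_Rintegral => x _; rewrite mulrCA.
move=> E; rewrite E in c1.
exact: cvg_unique c1 c2.
Qed.

(** The difference between a test function and its translate is an [F]-derivative of a line
    integral, so [u] does not see it; [loc_int_eq0] concludes. *)
Lemma shift_invariant u F s : loc_int u ->
  (forall phi, test_function phi -> \int[leb]_x (u x * 'D_F phi x) = 0) ->
  {ae leb, forall x, u (x + s *: F) = u x}.
Proof.
move=> lu uF.
(* Negative times are handled by reversing [F], as line integrals are taken over positive
   parameters. *)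
wlog s0 : F uF s / 0 <= s.
  move=> W; have [s0|s0] := leP 0 s; first exact: W.
  have -> : s *: F = (- s) *: (- F) by rewrite scalerN scaleNr opprK.
  apply: W; last by rewrite oppr_ge0 ltW.
  move=> phi tphi; transitivity (- \int[leb]_x (u x * 'D_F phi x)); last by rewrite uF// oppr0.
  rewrite -mulN1r -RintegralZl//; last exact: test_integrable (test_derive _ tphi).
  apply: eq_Rintegral => x _.
  have dphi : differentiable phi x by exact: ksmooth_diff (test_ksmooth 0 tphi) _.
  by rewrite !deriveE// linearN mulN1r mulrN.
have ls : loc_int (fun x => u (x + s *: F) - u x).
  have [mu uK] := lu; split.
    apply: measurable_funB => //; apply: measurableT_comp => //; exact: measurable_shift_rV.
  move=> K cK; have mK := compact_measurable_rV cK.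
  suff I1 : leb.-integrable K (EFin \o (fun x => u (x + s *: F))).
    exact: (integrableB mK I1 (uK K cK)).
  pose K' : set 'rV[R]_n := sweep (- F) s K.
  have cK' : compact K' by exact: compact_sweep.
  have /(integrable_mkcond _ (compact_measurable_rV cK')) := uK _ cK'.
  move=> /(integrable_preserving (measurable_shift_rV (s *: F)) (lebesgue_rV_shift (s *: F))).
  move=> I1; have := integrableS measurableT mK (@subsetT _ _) I1.
  apply: eq_integrable => // x; rewrite inE => Kx /=; rewrite patchE mem_set//.
  exists (x, s) => /=; last by rewrite scalerN opprK.
  by split=> //=; rewrite in_itv/= lexx (le_trans _ s0)// oppr_le0.
have := @loc_int_eq0 _ _ _ ls; move=> H.
have {}H : {ae leb, forall x, u (x + s *: F) - u x = 0}.
  apply: H => w tw.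
  have ts := @test_shift w (- F) s s0 tw.
  have ts' : test_function (fun x => w (x - s *: F)).
    by move: ts; congr test_function; apply/funext => x; rewrite scalerN.
  have lus : leb.-integrable setT (EFin \o (fun x => u (x + s *: F) * w x)).
    have := integrable_preserving (measurable_shift_rV (s *: F))
      (lebesgue_rV_shift (s *: F)) (test_integrable lu ts').
    by congr (integrable _ _ _); apply/funext => x /=; rewrite addrK.
  transitivity (\int[leb]_x (u (x + s *: F) * w x) - \int[leb]_x (u x * w x)).
    rewrite -(RintegralB measurableT lus (test_integrable lu tw)).
    by apply: eq_Rintegral => x _; rewrite mulrBl.
  rewrite distr_shift//.
  rewrite -(RintegralB measurableT (test_integrable lu ts') (test_integrable lu tw)).
  have tl := test_line_int (- F) s0 tw.
  transitivity (- \int[leb]_x (u x * 'D_F (line_int (- F) s w) x)); last by rewrite uF// oppr0.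
  rewrite -mulN1r -RintegralZl//; last exact: test_integrable (test_derive _ tl).
  apply: eq_Rintegral => x _; rewrite mulN1r -mulrBr -mulrN; congr (_ * _).
  have [dl _] := line_int_diff (- F) x s0 (test_ksmooth 1 tw).
  transitivity ('D_(- F) (line_int (- F) s w) x); last by rewrite !deriveE// linearN.
  have [_ ->] := line_int_diff (- F) x s0 (test_ksmooth 1 tw).
  by rewrite line_int_derive// ?scalerN//; exact: test_ksmooth.
by apply: filterS H => x /eqP; rewrite subr_eq0 => /eqP.
Qed.

End lines.

(** * Square integrable functions on the line and their primitives *)

Section line.
Variable R : realType.
Local Notation mu := (@lebesgue_measure R).
Implicit Types (f g : R -> R) (a b : R).

Lemma integral_shift (t : R) (g : R -> \bar R) : measurable_fun setT g ->
  (\int[mu]_s g (s + t)%R = \int[mu]_s g s)%E.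
Proof.
move=> mg; have mt : measurable_fun setT (fun s : measurableTypeR R => s + t : measurableTypeR R).
  exact: measurable_funD.
exact: (@integral_preserving _ _ _ mu _ mt (@lebesgue_measure_shift R t) _ mg).
Qed.

Definition loc_int1 f := forall k : nat, mu.-integrable `[- k%:R, k%:R] (EFin \o f).

Lemma segment_sub a b : exists k : nat, `[a, b] `<=` (`[- k%:R, k%:R] : set R).
Proof.
exists (Num.truncn (Num.max `|a| `|b|)).+1 => s; rewrite /= !in_itv/= => /andP[aS sb].
have H := @truncnS_gt R (Num.max `|a| `|b|).
have ha : `|a| <= Num.max `|a| `|b| by rewrite le_max lexx.
have hb : `|b| <= Num.max `|a| `|b| by rewrite le_max lexx orbT.
have := ler_norm b; have := ler_norm (- a); rewrite normrN => ? ?.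
by apply/andP; split; lra.
Qed.

Lemma loc_int1S f (I : interval R) a b : loc_int1 f -> [set` I] `<=` `[a, b] ->
  mu.-integrable [set` I] (EFin \o f).
Proof.
move=> lf Iab; have [k ak] := segment_sub a b.
apply: (integrableS _ _ _ (lf k)) => //.
exact: subset_trans ak.
Qed.

Lemma loc_int1_seg f a b : loc_int1 f -> mu.-integrable `[a, b] (EFin \o f).
Proof. by move=> lf; apply: (@loc_int1S _ _ a b). Qed.

Lemma integral_from0B f a b : loc_int1 f -> a <= b ->
  integral_from0 f b - integral_from0 f a = \int[mu]_(s in `[a, b]) f s.
Proof.
move=> lf ab; rewrite /integral_from0.
have int_oc x y : mu.-integrable `]x, y] (EFin \o f).
  by apply: (@loc_int1S _ _ x y) => // s /=; rewrite !in_itv/= => /andP[/ltW-> ->].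
have split3 x y z : x <= y -> y <= z ->
    \int[mu]_(s in `[x, z]) f s - \int[mu]_(s in `[x, y]) f s = \int[mu]_(s in `[y, z]) f s.
  move=> xy yz; rewrite Rintegral_itvB ?bnd_simp//; last exact: loc_int1_seg.
  by rewrite Rintegral_itv_obnd_cbnd.
have [a0|a0] := leP 0 a.
  by rewrite (le_trans a0 ab)/= (split3 0 a b a0 ab).
have [b0|b0] := leP 0 b.
  by rewrite opprK -(split3 a 0 b (ltW a0) b0) subrK.
by rewrite -(split3 a b 0 ab (ltW b0)) opprB opprK subrK.
Qed.

Lemma integral_from00 f : integral_from0 f 0 = 0.
Proof. by rewrite /integral_from0 lexx set_itv1 Rintegral_set1. Qed.

(** Young's inequality [|f| <= k / 2 + f ^ 2 / (2 * k)] with a free weight [k]; it serves below both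
    for a Cauchy-Schwarz bound and for absolute continuity. *)
Lemma Rintegral_sqr_le f q a b (k : R) : 0 < k -> a <= b ->
  measurable_fun setT f -> loc_int1 q -> (forall s, f s ^+ 2 <= q s) ->
  \int[mu]_(s in `[a, b]) `|f s| <=
  k / 2 * (b - a) + (2 * k)^-1 * \int[mu]_(s in `[a, b]) q s.
Proof.
move=> k0 ab mf lq fq.
have iq := loc_int1_seg a b lq.
have ic : mu.-integrable `[a, b] (EFin \o (fun _ : R => k / 2)).
  apply: continuous_compact_integrable; first exact: segment_compact.
  by apply: continuous_subspaceT => ?; exact: cvg_cst.
have iq2 : mu.-integrable `[a, b] (EFin \o (fun s => (2 * k)^-1 * q s)).
  exact: (integrableZl _ ((2 * k)^-1) iq).
have isum : mu.-integrable `[a, b] (EFin \o (fun s => k / 2 + (2 * k)^-1 * q s)).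
  exact: (integrableD _ ic iq2).
have le s : `|f s| <= k / 2 + (2 * k)^-1 * q s.
  have -> : (2 * k)^-1 = k^-1 / 2 by rewrite invfM mulrC.
  have k2 : 0 < k^-1 by rewrite invr_gt0.
  have : 0 <= k^-1 / 2 * (`|f s| - k) ^+ 2 by rewrite mulr_ge0// ?sqr_ge0// divr_ge0// ltW.
  have -> : k^-1 / 2 * (`|f s| - k) ^+ 2 = k^-1 / 2 * f s ^+ 2 + k / 2 - `|f s|.
    by rewrite -(real_normK (num_real (f s))); field; rewrite gt_eqF.
  have : k^-1 / 2 * f s ^+ 2 <= k^-1 / 2 * q s.
    by rewrite ler_wpM2l// divr_ge0// ltW.
  by move=> *; lra.
have iabs : mu.-integrable `[a, b] (EFin \o (fun s => `|f s|)).
  apply: (le_integrable _ _ _ isum) => //.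
    by apply/measurable_EFinP; apply: measurable_funTS; exact: measurableT_comp.
  by move=> s _ /=; rewrite lee_fin normr_id [leRHS]ger0_norm// (le_trans _ (le s)).
apply: (@le_trans _ _ (\int[mu]_(s in `[a, b]) (k / 2 + (2 * k)^-1 * q s))).
  by apply: le_Rintegral => // s _; exact: le.
rewrite (RintegralD _ ic iq2)// (RintegralZl _ _ iq)// lerD2r.
rewrite Rintegral_cst//= lebesgue_measure_itv/= lte_fin.
case: ifPn => [Bp|]; first by rewrite -EFinB/=.
by rewrite -leNgt => ba; rewrite (@le_anti _ _ a b) ?ab ?ba// subrr !mulr0.
Qed.

Lemma loc_int1_sqr f q : measurable_fun setT f -> loc_int1 q ->
  (forall s, f s ^+ 2 <= q s) -> loc_int1 f.
Proof.
move=> mf lq fq k.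
have ic : mu.-integrable `[- k%:R, k%:R] (EFin \o (fun _ : R => 1)).
  apply: continuous_compact_integrable; first exact: segment_compact.
  by apply: continuous_subspaceT => ?; exact: cvg_cst.
have isum : mu.-integrable `[- k%:R, k%:R] (EFin \o (fun s => 1 + q s)).
  exact: (integrableD _ ic (lq k)).
apply: (le_integrable _ _ _ isum) => //.
  by apply/measurable_EFinP; exact: measurable_funTS.
move=> s _ /=; rewrite lee_fin [leRHS]ger0_norm; last first.
  by rewrite addr_ge0// (le_trans (sqr_ge0 (f s))).
have := fq s; have := sqr_ge0 (`|f s| - 1); rewrite -(real_normK (num_real (f s))).
by have := normr_ge0 (f s); nra.
Qed.

Lemma integral_from0_sqr_le f q (k : nat) t : measurable_fun setT f -> loc_int1 q ->
  (forall s, f s ^+ 2 <= q s) -> `|t| <= k%:R ->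
  integral_from0 f t ^+ 2 <= 2 * k%:R * \int[mu]_(s in `[- k%:R, k%:R]) q s.
Proof.
move=> mf lq fq tk.
have lf := loc_int1_sqr mf lq fq.
have q0 s : 0 <= q s by rewrite (le_trans (sqr_ge0 (f s))).
have iabs : mu.-integrable `[- k%:R, k%:R] (EFin \o (fun s => `|f s|)).
  exact: integrable_norm (lf k).
set A := \int[mu]_(s in `[- k%:R, k%:R]) `|f s|.
have A0 : 0 <= A by apply: Rintegral_ge0.
have subA c e : `[c, e] `<=` (`[- k%:R, k%:R] : set R) ->
    \int[mu]_(s in `[c, e]) `|f s| <= A.
  move=> sub; rewrite /A /Rintegral; apply: fine_le.
  - have i2 : mu.-integrable `[c, e] (EFin \o (fun s => `|f s|)).
      exact: (integrable_norm (loc_int1_seg c e lf)).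
    exact: (integrable_fin_num _ i2).
  - exact: (integrable_fin_num _ iabs).
  apply: ge0_subset_integral => //.
  apply/measurable_EFinP; apply: measurable_funTS; exact: measurableT_comp.
have fA c e : `[c, e] `<=` (`[- k%:R, k%:R] : set R) ->
    `|\int[mu]_(s in `[c, e]) f s| <= A.
  move=> sub; apply: le_trans (subA c e sub).
  apply: le_normr_Rintegral => //; exact: loc_int1_seg.
have tA : `|integral_from0 f t| <= A.
  move: tk; rewrite ler_norml => /andP[kt tk].
  rewrite /integral_from0; case: ifPn => [t0|t0]; rewrite ?normrN; apply: fA => s /=.
    by rewrite !in_itv/= => /andP[? ?]; apply/andP; split; lra.
  by rewrite -ltNge in t0; rewrite !in_itv/= => /andP[? ?]; apply/andP; split; lra.
rewrite -(real_normK (num_real _)).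
apply: (@le_trans _ _ (A ^+ 2)); first by rewrite ler_pXn2r// nnegrE.
set Q := \int[mu]_(s in _) q s.
have Q0 : 0 <= Q by apply: Rintegral_ge0.
have [->|An0] := eqVneq A 0; first by rewrite expr0n/= !mulr_ge0.
have Ap : 0 < A by rewrite lt_neqAle eq_sym An0.
have [k0|k0] := eqVneq k 0%N.
  by move: Ap; rewrite /A k0 oppr0 set_itv1 Rintegral_set1 ltxx.
have kp : 0 < k%:R :> R by rewrite ltr0n lt0n.
(* With this weight the first term is [A / 2] and the inequality becomes [A ^ 2 <= 2 * k * Q], that
   is, Cauchy-Schwarz on an interval of length [2 * k]. *)
have := @Rintegral_sqr_le f q (- k%:R) k%:R (A / (2 * k%:R)) _ _ mf lq fq.
rewrite -/A -/Q divr_gt0// ?mulr_gt0// => /(_ isT).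
rewrite lerNl (le_trans _ (ltW kp)) ?oppr_le0// => /(_ isT) H.
have E : A / (2 * k%:R) / 2 * (k%:R - - k%:R) = A / 2 by field; rewrite gt_eqF.
rewrite E in H.
have E2 : (2 * (A / (2 * k%:R)))^-1 * Q = k%:R * Q / A by field; rewrite !gt_eqF.
rewrite E2 in H.
have {}H : A / 2 <= k%:R * Q / A by lra.
rewrite ler_pdivlMr// in H.
by rewrite expr2; lra.
Qed.

End line.

Section absolute_continuity.
Variables (R : realType) (n : nat).
Local Notation mu := (@lebesgue_measure R).

Lemma sum_Rintegral_disjoint (q : R -> R) (k N : nat) (l r : 'I_N -> R) :
  loc_int1 q -> (forall s, 0 <= q s) ->
  (forall i, - k%:R <= l i /\ l i <= r i /\ r i <= k%:R) ->
  (forall i j, i != j -> r i <= l j \/ r j <= l i) ->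
  \sum_(i < N) \int[mu]_(s in `[l i, r i]) q s <= \int[mu]_(s in `[- k%:R, k%:R]) q s.
Proof.
move=> lq q0 lr dis.
have int_oc x y : mu.-integrable `]x, y] (EFin \o q).
  by apply: (@loc_int1S _ _ _ x y) => // s /=; rewrite !in_itv/= => /andP[/ltW-> ->].
(* The closed segments may share endpoints; the half-open ones are disjoint and carry the same
   integrals. *)
pose I i := (`]l i, r i]%classic : set R).
have mI i : measurable (I i) by exact: measurable_itv.
have mU : measurable (\big[setU/set0]_(i <- index_enum 'I_N) I i).
  by apply: bigsetU_measurable.
have sub : \big[setU/set0]_(i <- index_enum 'I_N) I i `<=` (`[- k%:R, k%:R] : set R).
  apply: (big_ind (fun A : set R => A `<=` `[- k%:R, k%:R]%classic)) => //; first by move=> A B HA HB x [/HA|/HB].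
  move=> i _ s; rewrite /I/= !in_itv/= => /andP[? ?].
  by have [? [? ?]] := lr i; apply/andP; split; lra.
have E : (\sum_(i <- index_enum 'I_N) \int[mu]_(s in I i) (q s)%:E =
    \int[mu]_(s in \big[setU/set0]_(i <- index_enum 'I_N) I i) (q s)%:E)%E.
  rewrite ge0_integral_bigsetU//.
  - exact: index_enum_uniq.
  - apply/trivIsetP => i j _ _ /dis ij; apply/seteqP; split=> // s [] /=.
    rewrite /I/= !in_itv/= => /andP[? ?] /andP[? ?].
    by have [? [? ?]] := lr i; have [? [? ?]] := lr j; case: ij => ?; lra.
  - by have /integrableP[mqk _] := lq k; apply: (measurable_funS _ sub mqk).
  - by move=> s _; rewrite lee_fin.
rewrite -lee_fin /Rintegral fineK; last by apply: (integrable_fin_num _ (lq k)).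
rewrite -sumEFin.
rewrite (eq_bigr (fun i => \int[mu]_(s in I i) (q s)%:E)%E); last first.
  move=> i _.
  transitivity ((\int[mu]_(s in I i) q s)%:E).
    by congr EFin; rewrite /I Rintegral_itv_obnd_cbnd.
  by rewrite /Rintegral fineK//; exact: (integrable_fin_num _ (int_oc (l i) (r i))).
rewrite [leLHS]E; apply: ge0_subset_integral => //.
- by have /integrableP[] := lq k.
- by move=> s _; rewrite lee_fin.
Qed.

(** Young's inequality on each segment, summed: the weight multiplies the total length, its inverse
    multiplies the fixed energy [Q]. *)
Lemma abs_continuous_primitive (f : R -> 'rV[R]_n) (c : 'rV[R]_n) a b :
  measurable_fun setT f -> loc_int1 (fun s => dot (f s) (f s)) ->
  abs_continuous a b (fun t => c + \row_i integral_from0 (fun s => f s 0 i) t).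
Proof.
move=> mf lq e e0; set q := fun s => _ in lq.
have [k abk] := segment_sub a b.
have q0 s : 0 <= q s by apply: sumr_ge0 => i _; rewrite -expr2 sqr_ge0.
have mfi i : measurable_fun setT (fun s => f s 0 i).
  exact: (measurableT_comp (measurable_coord i) mf).
have fq i s : (f s 0 i) ^+ 2 <= q s by exact: dot_coord.
have lf i := loc_int1_sqr (mfi i) lq (fq i).
pose Q := \int[mu]_(s in `[- k%:R, k%:R]) q s.
have Q0 : 0 <= Q by apply: Rintegral_ge0.
(* This makes the energy term [Q / (2 * K)] at most [e / 2], and a total length below [e / K] keeps
   the other term below [e / 2]. *)
pose K := (Q + 1) / e.
have K0 : 0 < K by rewrite divr_gt0// ltr_wpDl.
exists (e / K) => [|N l r lr dis small]; first by rewrite divr_gt0.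
have lrk i : - k%:R <= l i /\ l i <= r i /\ r i <= k%:R.
  have [al [ll rb]] := lr i.
  have := abk (l i); have := abk (r i); rewrite /= !in_itv/=.
  rewrite al rb (le_trans ll rb) (le_trans al ll) => /(_ isT)/andP[_ ->].
  by move=> /(_ isT)/andP[-> _].
have bound i : `|c + \row_j integral_from0 (fun s => f s 0 j) (r i) -
    (c + \row_j integral_from0 (fun s => f s 0 j) (l i))| <=
    K / 2 * (r i - l i) + (2 * K)^-1 * \int[mu]_(s in `[l i, r i]) q s.
  have [? [ll ?]] := lrk i.
  have Q1 : 0 <= \int[mu]_(s in `[l i, r i]) q s by apply: Rintegral_ge0.
  rewrite opprD addrACA subrr add0r; apply: norm_coord_le => [|j].
    have K0' := ltW K0.
    apply: addr_ge0; apply: mulr_ge0 => //.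
    - exact: divr_ge0.
    - by rewrite subr_ge0.
    - by rewrite invr_ge0 mulr_ge0.
  rewrite !mxE integral_from0B//.
  apply: le_trans (Rintegral_sqr_le K0 ll (mfi j) lq (fq j)).
  by apply: le_normr_Rintegral => //; exact: loc_int1_seg.
apply: (@le_lt_trans _ _ (\sum_(i < N) (K / 2 * (r i - l i) +
    (2 * K)^-1 * \int[mu]_(s in `[l i, r i]) q s))).
  by apply: ler_sum => i _; exact: bound.
rewrite big_split/= -!mulr_sumr.
have H1 := sum_Rintegral_disjoint lq q0 lrk dis.
have H2 : K / 2 * \sum_(i < N) (r i - l i) < e / 2.
  by rewrite mulrAC ltr_pM2r// mulrC -ltr_pdivlMr.
have H3 : (2 * K)^-1 * \sum_(i < N) \int[mu]_(s in `[l i, r i]) q s <= e / 2.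
  apply: (@le_trans _ _ ((2 * K)^-1 * Q)).
    by rewrite ler_wpM2l// invr_ge0 mulr_ge0// ltW.
  have K2 : 0 < 2 * K by rewrite mulr_gt0.
  rewrite ler_pdivrMl// /K.
  have -> : 2 * ((Q + 1) / e) * (e / 2) = Q + 1 by field; rewrite gt_eqF.
  by rewrite lerDl.
by apply: (lt_le_trans (ltr_leD H2 H3)); rewrite -splitr.
Qed.

Lemma measurable_section_Rintegral dT (T : measurableType dT) (g : T * R -> R)
    (E : set (T * R)) : measurable E -> measurable_fun setT g ->
  measurable_fun setT (fun x => \int[mu]_(s in xsection E x) g (x, s)).
Proof.
move=> mE mg.
pose G : T * R -> \bar R := (EFin \o g) \_ E.
have mG : measurable_fun setT G.
  have mEg : measurable_fun setT (EFin \o g) by exact/measurable_EFinP.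
  by apply/(measurable_restrictT _ mE); exact: measurable_funTS.
have -> : (fun x => \int[mu]_(s in xsection E x) g (x, s)) =
    fine \o (fun x => fubini_F mu G^\+%E x - fubini_F mu G^\-%E x)%E.
  apply/funext => x /=; rewrite /Rintegral; congr fine.
  rewrite integral_mkcond integralE; congr (_ - _)%E; apply: eq_integral => s _.
    by rewrite /G !funeposE !patchE mem_xsection.
  by rewrite /G !funenegE !patchE mem_xsection.
apply: measurableT_comp => //; apply: emeasurable_funB.
- by apply: measurable_fun_fubini_tonelli_F => //; exact: measurable_funepos.
- by apply: measurable_fun_fubini_tonelli_F => //; exact: measurable_funeneg.
Qed.

End absolute_continuity.

(** * The transport formula *)

Section good_lines.
Variables (R : realType) (d : nat) (F : 'rV[R]_d).
Local Notation leb := (lebesgue_rV R).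
Local Notation mu := (@lebesgue_measure R).
Variable h : 'rV[R]_d -> 'rV[R]_d.
Hypothesis hh : L2 (leb d) setT h.
Local Notation q := (fun x => dot (h x) (h x)).

Lemma measurable_on_line n (f : 'rV[R]_d -> 'rV[R]_n) x : measurable_fun setT f ->
  measurable_fun setT (fun s : R => f (x + s *: F)).
Proof.
move=> mf; apply: measurableT_comp => //.
exact: (measurableT_comp (measurable_flow F) (pair1_measurable x)).
Qed.

Lemma dot_ge0 n (x : 'rV[R]_n) : 0 <= dot x x.
Proof. by apply: sumr_ge0 => i _; rewrite -expr2 sqr_ge0. Qed.

(** Extended-real valued, so that the exceptional lines are those where some energy is infinite.
    This set is measurable, null and invariant under the flow, hence passes to the hypersurface by
    [surface_null]. *)
Definition line_energy (k : nat) x : \bar R :=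
  (\int[mu]_(s in `[(- k%:R)%R, k%:R]) (q (x + s *: F)%R)%:E)%E.

Definition good_line x := forall k, (line_energy k x < +oo)%E.

Let mh : measurable_fun setT h. Proof. by have [] := hh. Qed.

Let mq : measurable_fun setT q. Proof. exact: measurable_dot. Qed.

Lemma good_lineP x : good_line x -> loc_int1 (fun s => q (x + s *: F)).
Proof.
move=> gx k; apply/integrableP; split.
  apply/measurable_EFinP; apply: measurable_funTS.
  by apply: measurable_dot => //; exact: measurable_on_line.
apply: le_lt_trans (gx k); rewrite le_eqVlt; apply/orP; left; apply/eqP.
by apply: eq_integral => s _ /=; rewrite ger0_norm// dot_ge0.
Qed.

Let G (k : nat) (p : 'rV[R]_d * R) : \bar R := (q (flow F p) * \1_`[- k%:R, k%:R]%classic p.2)%:E.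

Let mG k : measurable_fun setT (G k).
Proof.
apply/measurable_EFinP; apply: measurable_funM.
  by apply: (measurableT_comp mq); exact: measurable_flow.
by apply: measurableT_comp => //; exact: measurable_indic.
Qed.

Let G0 k p : (0 <= G k p)%E.
Proof. by rewrite lee_fin mulr_ge0// dot_ge0. Qed.

Let line_energyE k : line_energy k = fubini_F mu (G k).
Proof.
apply/funext => x; rewrite /line_energy integral_mkcond; apply: eq_integral => s _.
by rewrite /G patchE indicE /flow/=; case: ifPn => _; rewrite ?mulr1 ?mulr0.
Qed.

Lemma measurable_line_energy k : measurable_fun setT (line_energy k).
Proof.
by rewrite line_energyE; exact: (@measurable_fun_fubini_tonelli_F _ _ _ _ _ mu _ (mG k) (G0 k)).
Qed.

Lemma line_energy_ge0 k x : (0 <= line_energy k x)%E.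
Proof. by apply: integral_ge0 => s _; rewrite lee_fin dot_ge0. Qed.

(** By Tonelli and translation invariance, each time in the window contributes the squared norm of
    [h], for a total of [2 * k] times it. *)
Lemma integral_line_energy k : (\int[leb d]_x line_energy k x < +oo)%E.
Proof.
have [_ hoo] := hh.
rewrite line_energyE.
rewrite [X in (X < _)%E](_ : _ = \int[mu]_s \int[leb d]_x G k (x, s))%E; last first.
  exact: (@fubini_tonelli _ _ _ _ _ (leb d) mu _ (mG k) (G0 k)).
have E s : (\int[leb d]_x G k (x, s) =
    (\1_`[- k%:R, k%:R]%classic s)%:E * \int[leb d]_x (q x)%:E)%E.
  have mqE : measurable_fun setT (fun x => (q x)%:E) by exact/measurable_EFinP.
  rewrite -(integral_preserving (measurable_shift_rV (s *: F))
    (lebesgue_rV_shift (s *: F)) mqE) -ge0_integralZl//.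
  - by apply: eq_integral => x _; rewrite /G /flow/= muleC -EFinM.
  - exact: (measurableT_comp mqE (measurable_shift_rV (s *: F))).
  - by move=> x _; rewrite lee_fin dot_ge0.
under eq_integral do rewrite E.
have q0 : (0 <= \int[leb d]_x (q x)%:E)%E.
  by apply: integral_ge0 => s _; rewrite lee_fin dot_ge0.
rewrite ge0_integralZr//; last first.
  by apply/measurable_EFinP; exact: measurable_indic.
rewrite integral_indic// setIT lte_mul_pinfty//.
- by rewrite [X in X \is a _]lebesgue_measure_itv/= lte_fin; case: ifPn.
Qed.

Definition bad_lines : set 'rV[R]_d := \bigcup_k [set x | line_energy k x = +oo%E].

Lemma bad_linesP x : ~ bad_lines x <-> good_line x.
Proof.
split=> [nb k|gx [k _ /=]]; last by have := gx k; case: line_energy.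
rewrite ltey; apply/eqP => E; apply: nb; exists k => //.
Qed.

Let measurable_energy_oo k : measurable [set x | line_energy k x = +oo%E].
Proof.
by have := measurable_line_energy k measurableT (emeasurable_set1 +oo%E); rewrite setTI.
Qed.

Lemma measurable_bad_lines : measurable bad_lines.
Proof.
by apply: bigcupT_measurable => k.
Qed.

Lemma bad_lines_null : leb d bad_lines = 0%E.
Proof.
apply: measure_negligible; first exact: measurable_bad_lines.
apply: negligible_bigcup => k.
have ik : (leb d).-integrable setT (line_energy k).
  apply/integrableP; split; first exact: measurable_line_energy.
  under eq_integral do rewrite gee0_abs ?line_energy_ge0//.
  exact: integral_line_energy.
have [N [mN N0 NS]] := integrable_ae measurableT ik.
by exists N; split=> // x /= E; apply: NS => /= /(_ Logic.I); rewrite E.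
Qed.

(** Moving the base point by [t] moves the window of times by [t]. Being good is thus a property of
    the line and not of the point. *)
Lemma line_energy_flow (k j : nat) x t : `|t| <= j%:R ->
  (line_energy k (x + t *: F) <= line_energy (k + j) x)%E.
Proof.
move=> tj; rewrite /line_energy.
have kj : `[- k%:R + t, k%:R + t] `<=` (`[- (k + j)%:R, (k + j)%:R] : set R).
  move: tj; rewrite ler_norml => /andP[? ?] s.
  by rewrite /= !in_itv/= natrD => /andP[? ?]; apply/andP; split; lra.
have mg := measurable_on_line x mh.
have mqx : measurable_fun setT (fun s : R => q (x + s *: F)) by exact: measurable_dot.
have mEg : measurable_fun setT (fun s : R => (q (x + s *: F))%:E).
  exact/measurable_EFinP.
pose g (s : R) : \bar R := ((fun s : R => (q (x + s *: F))%:E) \_ `[- k%:R + t, k%:R + t]) s.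
have -> : (\int[mu]_(s in `[(- k%:R)%R, k%:R]) (q (x + t *: F + s *: F)%R)%:E =
    \int[mu]_s g (s + t)%R)%E.
  rewrite [LHS]integral_mkcond; apply: eq_integral => s _.
  rewrite /g !patchE !mem_setE !in_itv/= !lerD2r.
  by case: ifPn => // _; rewrite -addrA -scalerDl [t + s]addrC.
rewrite integral_shift; last first.
  by apply/(measurable_restrictT _ (measurable_itv _)); exact: measurable_funTS.
rewrite -integral_mkcond; apply: ge0_subset_integral => //.
- exact: measurable_funTS.
- by move=> s _; rewrite lee_fin dot_ge0.
Qed.

Lemma good_line_flow x t : good_line x -> good_line (x + t *: F).
Proof.
move=> gx k; have := @truncnS_gt R `|t| => /ltW /(line_energy_flow k x).
by move/le_lt_trans; apply; exact: gx.
Qed.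

End good_lines.

Lemma Rintegral_shift (R : realType) (f : R -> R) (a r : R) : measurable_fun setT f ->
  \int[lebesgue_measure]_(s in `[a, a + r]) f s =
  \int[lebesgue_measure]_(s in `[0, r]) f (a + s).
Proof.
move=> mf; rewrite /Rintegral; congr fine.
pose g (s : R) : \bar R := ((EFin \o f) \_ `[a, a + r]) s.
rewrite [LHS]integral_mkcond -[LHS]/(\int[lebesgue_measure]_s g s)%E.
rewrite -[LHS](integral_shift a); last first.
  apply/(measurable_restrictT _ (measurable_itv _)); apply: measurable_funTS.
  exact/measurable_EFinP.
rewrite [RHS]integral_mkcond; apply: eq_integral => s _.
by rewrite /g !patchE !mem_setE !in_itv/= lerDr [s + a]addrC lerD2l.
Qed.

Lemma dotD_le (R : realType) d (x y : 'rV[R]_d) :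
  dot (x + y) (x + y) <= 2 * dot x x + 2 * dot y y.
Proof.
rewrite /dot !mulr_sumr -big_split/=; apply: ler_sum => i _; rewrite !mxE.
by have := sqr_ge0 (x 0 i - y 0 i); rewrite expr2; nra.
Qed.

Section transport.
Variables (R : realType) (m : nat).
Local Notation d := m.+1.
Local Notation leb := (lebesgue_rV R).
Local Notation mu := (@lebesgue_measure R).
Variables (F : 'rV[R]_d) (S : set 'rV[R]_d).
Hypothesis hS : smooth_hypersurface S.
Variable n : 'rV[R]_d -> 'rV[R]_d.
Hypothesis hn : unit_normal S n.
Hypothesis hFn : forall x, S x -> dot F (n x) != 0.
Hypothesis hPhi : flow_C1_diffeo S F.
Variables (pi : 'rV[R]_d -> 'rV[R]_d) (tau : 'rV[R]_d -> R).
Hypothesis hpi : forall x, S (pi x) /\ x = pi x + tau x *: F.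
Variable sigma : {measure set 'rV[R]_d -> \bar R}.
Hypothesis hsigma : surface_measure S sigma.

Let mS : measurable S. Proof. exact: (measurable_S hPhi hpi). Qed.
Let mpi : measurable_fun setT pi. Proof. exact: (measurable_pi hPhi hpi). Qed.
Let mtau : measurable_fun setT tau. Proof. exact: (measurable_tau hPhi hpi). Qed.

(** The assumption on sets says that the image under [pi] of Lebesgue measure on [Q] is at most [C]
    times [sigma]; integrals of nonnegative functions follow. *)
Lemma integral_pi_local (Q : set 'rV[R]_d) (C : R) (G : 'rV[R]_d -> \bar R) :
  open Q -> 0 <= C ->
  (forall A, measurable A -> (leb d (Q `&` pi @^-1` A) <= C%:E * sigma A)%E) ->
  measurable_fun setT G -> (forall y, 0 <= G y)%E ->
  (\int[leb d]_(x in Q) G (pi x) <= C%:E * \int[sigma]_y G y)%E.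
Proof.
move=> oQ C0 QC mG G0.
have mQ : measurable Q by exact: measurable_open_rV.
pose nu := mrestr (leb d) mQ.
have -> : (\int[leb d]_(x in Q) G (pi x) = \int[nu]_(x in Q) G (pi x))%E.
  apply: eq_measure_integral => A mA AQ; rewrite /nu /mrestr.
  by congr (leb d _); apply/esym/setIidl.
apply: (@le_trans _ _ (\int[nu]_x G (pi x))%E).
  apply: ge0_subset_integral => //; exact: measurableT_comp.
pose rho0 : {measure set 'rV[R]_d -> \bar R} := pushforward nu pi.
pose rho := rho0 mpi.
rewrite -[X in (X <= _)%E](ge0_integral_pushforward mpi nu measurableT mG); last by move=> y _.
rewrite -(@ge0_integral_mscale _ _ _ sigma _ measurableT (NngNum C0))//.
apply: (@ge0_le_measure_integral _ _ _ rho) => // A mA.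
rewrite /rho/= /pushforward /nu/= /mrestr setIC.
exact: QC.
Qed.

Lemma integral_pi_compact (K : set 'rV[R]_d) (G : 'rV[R]_d -> \bar R) : compact K ->
  measurable_fun setT G -> (forall y, 0 <= G y)%E -> (\int[sigma]_y G y < +oo)%E ->
  (\int[leb d]_(x in K) G (pi x) < +oo)%E.
Proof.
move=> cK mG G0 Goo.
have mGpi : measurable_fun setT (G \o pi) by exact: measurableT_comp.
have /choice[Q QP] : forall x, exists Q, [/\ open Q, Q x &
    (\int[leb d]_(y in Q) G (pi y) < +oo)%E].
  move=> x; have [Q [C [oQ Qx C0 QC]]] := surface_le hS hn hFn hPhi hpi hsigma x.
  exists Q; split=> //; apply: (le_lt_trans (integral_pi_local oQ C0 QC mG G0)).
  exact: lte_mul_pinfty.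
have [D _ KD] : finite_subset_cover K Q K.
  have : cover_compact K by rewrite -compact_cover.
  apply; first by move=> x _; have [] := QP x.
  by move=> x Kx; exists x => //; have [] := QP x.
have mQ x : measurable (Q x) by have [oQ _ _] := QP x; exact: measurable_open_rV.
have H : forall s : seq 'rV[R]_d,
    (\int[leb d]_(y in \big[setU/set0]_(x <- s) Q x) G (pi y) < +oo)%E.
  elim=> [|x s IH]; first by rewrite big_nil integral_set0.
  rewrite big_cons; set U := \big[setU/set0]_(_ <- _) _.
  have mU : measurable U by apply: bigsetU_measurable.
  have -> : Q x `|` U = Q x `|` (U `\` Q x).
    apply/seteqP; split=> y [Qy|Uy]; [by left| |by left|by right; case: Uy].
    by have [Qy|nQy] := pselect (Q x y); [left|right].
  rewrite ge0_integral_setU//.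
  - apply: lte_add_pinfty; first by have [] := QP x.
    apply: le_lt_trans IH; apply: ge0_subset_integral => //.
    + exact: measurableD.
    + exact: measurable_funTS.
  - exact: measurableD.
  - exact: measurable_funTS.
  - by apply/disj_setPS => y [? []].
have := H (finmap.enum_fset D).
apply: le_lt_trans; apply: ge0_subset_integral => //.
- exact: compact_measurable_rV.
- by apply: bigsetU_measurable.
- exact: measurable_funTS.
move=> y /KD[x /= xD Qy]; rewrite -bigcup_seq; exists x => //.
Qed.

Variable h : 'rV[R]_d -> 'rV[R]_d.
Hypothesis hh : L2 (leb d) setT h.
Local Notation q := (fun x => dot (h x) (h x)).
Let mh : measurable_fun setT h. Proof. by have [] := hh. Qed.

Definition primitive i x := integral_from0 (fun s => h (pi x + s *: F) 0 i) (tau x).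

(** The domain of integration depends on [x]; it is the section at [x] of the measurable set [E1] or
    [E2], according to the sign of [tau]. *)
Lemma measurable_primitive i : measurable_fun setT (primitive i).
Proof.
pose g (p : 'rV[R]_d * R) := h (flow F (pi p.1, p.2)) 0 i.
have mg : measurable_fun setT g.
  apply: (measurableT_comp (measurable_coord i)).
  apply: (measurableT_comp mh); apply: (measurableT_comp (measurable_flow F)).
  apply: measurable_fun_pair; last exact: measurable_snd.
  exact: (measurableT_comp mpi measurable_fst).
have mt1 : measurable_fun setT (fun p : 'rV[R]_d * R => tau p.1).
  exact: (measurableT_comp mtau measurable_fst).
pose E1 := [set p : 'rV[R]_d * R | 0 <= p.2] `&` [set p | p.2 <= tau p.1].
pose E2 := [set p : 'rV[R]_d * R | p.2 <= 0] `&` [set p | tau p.1 <= p.2].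
have mle (f1 f2 : 'rV[R]_d * R -> R) : measurable_fun setT f1 -> measurable_fun setT f2 ->
    measurable [set p | f1 p <= f2 p].
  move=> m1 m2; have mt : measurable [set true] by [].
  by have := measurable_fun_ler m1 m2 measurableT mt; rewrite setTI.
have mE1 : measurable E1 by apply: measurableI; apply: mle => //.
have mE2 : measurable E2 by apply: measurableI; apply: mle => //.
have -> : primitive i = fun x => if 0 <= tau x then \int[mu]_(s in xsection E1 x) g (x, s)
   else - \int[mu]_(s in xsection E2 x) g (x, s).
  apply/funext => x; rewrite /primitive /integral_from0; case: ifPn => _.
    congr (Rintegral _ _ _); apply/seteqP; split => s; rewrite /xsection/= inE in_itv/=.
      by move=> /andP[].
    by move=> [-> ->].
  congr (- Rintegral _ _ _); apply/seteqP; split => s; rewrite /xsection/= inE in_itv/=.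
    by move=> /andP[].
  by move=> [-> ->].
apply: measurable_fun_ifT.
- exact: measurable_fun_ler.
- exact: measurable_section_Rintegral.
- by apply: measurable_funN; exact: measurable_section_Rintegral.
Qed.

Variable vS : 'rV[R]_d -> 'rV[R]_d.
Hypothesis hvS : L2 sigma S vS.
Local Notation v := (transport F pi tau h vS).

Lemma transportE i x : v x 0 i = vS (pi x) 0 i + primitive i x.
Proof. by rewrite /transport !mxE. Qed.

Lemma measurable_transport : measurable_fun setT v.
Proof.
apply: measurable_rV => // i.
have -> : (fun x => v x 0 i) = fun x => vS (pi x) 0 i + primitive i x.
  by apply/funext => x; rewrite transportE.
apply: measurable_funD; last exact: (measurable_primitive i).
apply: (measurableT_comp (measurable_coord i)).
have [mvS _] := hvS; have mvS' := (measurable_restrictT vS mS).1 mvS.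
have -> : (fun x => vS (pi x)) = (vS \_ S) \o pi.
  by apply/funext => x /=; rewrite patchE mem_set//; have [] := hpi x.
exact: measurableT_comp.
Qed.

(** Cauchy-Schwarz from the foot [pi x]. The times within [k] of the foot are within [k + k] of [x],
    so the bound can be integrated over [x] without mentioning [pi]. *)
Lemma primitive_sqr_le i x (k : nat) : good_line F h x -> `|tau x| <= k%:R ->
  ((primitive i x ^+ 2)%:E <= (2 * k%:R)%:E * line_energy F h (k + k) x)%E.
Proof.
move=> gx tk.
have piE : pi x = x + (- tau x) *: F by rewrite {2}(hpi x).2 -addrA -scalerDl subrr scale0r addr0.
have gp : good_line F h (pi x) by rewrite piE; exact: good_line_flow.
have lq := good_lineP hh gp.
have mf := measurable_on_line F (pi x) mh.
have mfi : measurable_fun setT (fun s : R => h (pi x + s *: F) 0 i).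
  exact: (measurableT_comp (measurable_coord i) mf).
have le1 : (line_energy F h k (pi x) <= line_energy F h (k + k) x)%E.
  by rewrite piE; apply: line_energy_flow => //; rewrite normrN.
apply: (@le_trans _ _ ((2 * k%:R)%:E * line_energy F h k (pi x))%E); last first.
  by rewrite lee_wpmul2l// lee_fin mulr_ge0.
have -> : line_energy F h k (pi x) =
    (\int[mu]_(s in `[- k%:R, k%:R]) q (pi x + s *: F))%:E.
  by rewrite /Rintegral fineK//; exact: (integrable_fin_num _ (lq k)).
rewrite -EFinM lee_fin.
by apply: integral_from0_sqr_le => // s; exact: dot_coord.
Qed.

Lemma L2loc_transport : L2loc v.
Proof.
split=> [|K cK]; first exact: measurable_transport.
have mK := compact_measurable_rV cK.
have [mvS vSoo] := hvS.
pose G : 'rV[R]_d -> \bar R := (fun y => (dot (vS y) (vS y))%:E) \_ S.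
have mG : measurable_fun setT G.
  apply/(measurable_restrictT _ mS); apply/measurable_EFinP; exact: measurable_dot.
have G0 y : (0 <= G y)%E.
  by rewrite /G patchE; case: ifPn => // _; rewrite lee_fin dot_ge0.
have Goo : (\int[sigma]_y G y < +oo)%E by rewrite -integral_mkcond.
have [k Kk] : exists k : nat, forall x, K x -> `|tau x| <= k%:R.
  have [_ ctau] := pi_tau_continuous hPhi hpi.
  have /compact_bounded[M [Mreal MK]] : compact (tau @` K).
    by apply: continuous_compact => //; exact: continuous_subspaceT.
  exists (Num.truncn (`|M| + 1)).+1 => x Kx.
  apply: (@le_trans _ _ (`|M| + 1)); last exact/ltW/truncnS_gt.
  by apply: MK; [rewrite ltr_pwDr// ler_norm|exists x].
have mGpi : measurable_fun setT (G \o pi) by exact: measurableT_comp.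
have mL := measurable_line_energy F hh (k + k).
have L0 := line_energy_ge0 F h (k + k).
(* The 2 comes from [dotD_le], [d] counts the coordinates, and [2 * k] is the constant of
   [primitive_sqr_le]. *)
pose c : R := 2 * (d%:R * (2 * k%:R)).
have c0 : 0 <= c by rewrite !mulr_ge0.
apply: (@le_lt_trans _ _ (\int[leb d]_(x in K)
    (2%:E * G (pi x) + c%:E * line_energy F h (k + k) x))%E).
  apply: ae_ge0_le_integral => //.
  - by move=> x _; rewrite lee_fin dot_ge0.
  - apply/measurable_EFinP; apply: measurable_dot => //.
    apply: measurable_funTS; exact: measurable_transport.
  - by move=> x _; rewrite adde_ge0// mule_ge0.
  - apply: measurable_funTS; apply: emeasurable_funD.
      by apply: measurable_funeM.
    by apply: measurable_funeM.
  have mb := measurable_bad_lines F hh; have b0 := bad_lines_null F hh.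
  exists (bad_lines F h); split=> // x /= nle.
  apply: contrapT => /bad_linesP gx; apply: nle => Kx.
  have Sp : S (pi x) by have [] := hpi x.
  have -> : G (pi x) = (dot (vS (pi x)) (vS (pi x)))%:E by rewrite /G patchE mem_set.
  apply: (@le_trans _ _ ((2 * dot (vS (pi x)) (vS (pi x)))%:E +
     2%:E * (\sum_(i < d) primitive i x ^+ 2)%:E)%E).
    rewrite -EFinM -EFinD lee_fin /transport.
    apply: (le_trans (dotD_le _ _)); rewrite lerD2l ler_pM2l//.
    by apply: ler_sum => i _; rewrite !mxE -expr2.
  rewrite EFinM leeD2l// /c EFinM -muleA lee_wpmul2l//.
  rewrite -sumEFin.
  apply: (@le_trans _ _ (\sum_(i < d) (2 * k%:R)%:E * line_energy F h (k + k) x)%E).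
    by apply: lee_sum => i _; apply: primitive_sqr_le => //; exact: Kk.
  rewrite (eq_bigr (fun=> 1%:E * ((2 * k%:R)%:E * line_energy F h (k + k) x))%E); last first.
    by move=> i _; rewrite mul1e.
  by rewrite -ge0_sume_distrl// sumEFin sumr_const card_ord EFinM muleA.
rewrite ge0_integralD//; last 4 first.
- by move=> x _; rewrite mule_ge0.
- by apply: measurable_funTS; apply: measurable_funeM.
- by move=> x _; rewrite mule_ge0.
- by apply: measurable_funTS; apply: measurable_funeM.
apply: lte_add_pinfty.
  rewrite ge0_integralZl//; last exact: measurable_funTS.
  by apply: lte_mul_pinfty => //; exact: integral_pi_compact.
rewrite ge0_integralZl//; last exact: measurable_funTS.
apply: lte_mul_pinfty => //.
apply: le_lt_trans (integral_line_energy F hh (k + k)).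
by apply: ge0_subset_integral.
Qed.

Lemma transport_flow i x r : good_line F h x -> 0 <= r ->
  mu.-integrable `[0, r] (EFin \o (fun s : R => h (x + s *: F) 0 i)) /\
  v (x + r *: F) 0 i - v x 0 i = \int[mu]_(s in `[0, r]) h (x + s *: F) 0 i.
Proof.
move=> gx r0.
have piE : pi x = x + (- tau x) *: F by rewrite {2}(hpi x).2 -addrA -scalerDl subrr scale0r addr0.
have gp : good_line F h (pi x) by rewrite piE; exact: good_line_flow.
have mfi y : measurable_fun setT (fun s : R => h (y + s *: F) 0 i).
  exact: (measurableT_comp (measurable_coord i) (measurable_on_line F y mh)).
have lf y : good_line F h y -> loc_int1 (fun s : R => h (y + s *: F) 0 i).
  by move=> gy; apply: loc_int1_sqr (good_lineP hh gy) _ => // s; exact: dot_coord.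
split; first by apply: loc_int1_seg; exact: lf.
rewrite !transportE /primitive (pi_shift hPhi hpi) (tau_shift hPhi hpi).
rewrite opprD addrACA subrr add0r integral_from0B ?lerDl//; last exact: lf.
rewrite Rintegral_shift//; apply: eq_Rintegral => s _.
by rewrite scalerDl addrA -(hpi x).2.
Qed.

Lemma solves_transport : solves F v h.
Proof.
move=> i phi tphi.
have lv := L2loc_loc_int i L2loc_transport.
have lh : loc_int (fun x => h x 0 i).
  have [_ hoo] := hh; apply: L2loc_loc_int; split=> // K cK.
  apply: le_lt_trans hoo; apply: ge0_subset_integral => //.
  - exact: compact_measurable_rV.
  - by apply/measurable_EFinP; exact: measurable_dot.
  - by move=> x _; rewrite lee_fin dot_ge0.
rewrite distr_directional//.
apply: line_solution => // r r0.
exists (bad_lines F h); split=> [||x /= nx].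
- exact: measurable_bad_lines.
- exact: bad_lines_null.
- by apply: contrapT => /bad_linesP gx; apply: nx; exact: transport_flow.
Qed.

(** The formula is its own absolutely continuous representative; it fails to be so at most on bad
    lines, which meet the hypersurface in a [sigma]-null set. *)
Lemma trace_transport : has_trace S sigma F v vS.
Proof.
exists v; first exact: aeW.
have mb := measurable_bad_lines F hh.
exists (bad_lines F h `&` S); split.
- exact: measurableI.
- apply: (surface_null hS hn hFn hPhi hpi hsigma) => //.
    move=> x s [k _ /= E]; apply: contrapT => /bad_linesP gx.
    have : good_line F h x.
      by rewrite -[x](addrK (s *: F)) -scaleNr; exact: good_line_flow.
    by move=> /bad_linesP; apply; exists k.
  exact: bad_lines_null.
move=> y /= nP; apply: contrapT => nb; apply: nP => Sy.
have gy : good_line F h y by apply/bad_linesP => b; apply: nb.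
have E s : v (y + s *: F) = vS y + \row_i integral_from0 (fun s => h (y + s *: F) 0 i) s.
  by have [p t] := pi_tau_flow hPhi hpi s Sy; rewrite /transport p t.
split=> [a b|].
  rewrite (_ : (fun s => _) = fun s : R => vS y + \row_i integral_from0 (fun s => h (y + s *: F) 0 i) s).
    apply: abs_continuous_primitive; last exact: good_lineP.
    exact: measurable_on_line.
  by apply/funext => s; exact: E.
have := E 0; rewrite scale0r addr0 => ->.
rewrite -[RHS]addr0; congr (_ + _); apply/rowP => i; rewrite !mxE.
exact: integral_from00.
Qed.

End transport.

(** * Uniqueness *)

Section uniqueness.
Variables (R : realType) (m : nat).
Local Notation d := m.+1.
Local Notation leb := (lebesgue_rV R).
Local Notation mu := (@lebesgue_measure R).
Variables (F : 'rV[R]_d).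

Local Instance ae_line_filter : Filter (almost_everywhere mu).
Proof. exact: ae_filter_ringOfSetsType. Qed.

(** The null set of the assumption depends on [s]; Tonelli exchanges the two quantifiers. *)
Lemma ae_line_const (u : 'rV[R]_d -> R) : measurable_fun setT u ->
  (forall s, {ae leb d, forall x, u (x + s *: F) = u x}) ->
  {ae leb d, forall x, {ae mu, forall s : R, u (x + s *: F) = u x}}.
Proof.
move=> mu_u us.
pose g (p : 'rV[R]_d * R) := u (flow F p) - u p.1.
have mg : measurable_fun setT g.
  apply: measurable_funB; first exact: (measurableT_comp mu_u (measurable_flow F)).
  exact: (measurableT_comp mu_u measurable_fst).
pose E := ~` (g @^-1` [set 0]).
have mE : measurable E.
  apply: measurableC; rewrite -[X in measurable X]setTI; exact: mg.
have {}mE0 := @ae_section_null R d E mE.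
apply: filterS (mE0 _) => [x H|s].
  by apply: (filterS _ H) => s /contrapT/= /eqP; rewrite subr_eq0 => /eqP.
apply: measure_negligible.
  by rewrite -[X in measurable X]setTI; exact: (pair2_measurable s).
have [N [mN N0 NS]] := us s; exists N; split=> // x nE; apply: NS => /= E0.
by apply: nE; rewrite /g/= /flow/= E0 subrr.
Qed.

Lemma abs_continuous_continuous (V : normedModType R) (f : R -> V) :
  (forall a b, abs_continuous a b f) -> continuous f.
Proof.
move=> ac s0; apply/cvgrPdist_lt => e e0.
have [delta d0 dP] := ac (s0 - 1) (s0 + 1) e e0.
have [r [r0 r1 rd]] : exists r, [/\ 0 < r, r <= 1 & r <= delta].
  exists (Num.min 1 delta); rewrite lt_min ltr01 d0; split => //.
  - by rewrite ge_min lexx.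
  - by rewrite ge_min lexx orbT.
near=> s; have sr : `|s0 - s| < r by near: s; exact: cvgr_dist_lt.
have H (l t : R) : s0 - 1 <= l -> l <= t -> t <= s0 + 1 -> t - l < delta -> `|f t - f l| < e.
  move=> l1 lt t1 td; have := dP 1%N (fun=> l) (fun=> t).
  rewrite !big_ord1; apply=> // i j; by rewrite !ord1 eqxx.
move: sr; rewrite ltr_norml => /andP[? ?].
have [ss|ss] := leP s s0; first by apply: H; lra.
by rewrite distrC; apply: H; lra.
Unshelve. all: by end_near. Qed.

(** A value other than [c] would persist on an interval, which has positive measure. *)
Lemma continuous_ae_cst (f : R -> R) (c s0 : R) : continuous f ->
  {ae mu, forall s, f s = c} -> f s0 = c.
Proof.
move=> cf [N [mN N0 NS]]; apply: contrapT => /eqP fc.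
have e0 : 0 < `|f s0 - c| by rewrite normr_gt0 subr_eq0.
have /cvgrPdist_lt/(_ _ e0)/nbhs_ballP[r /= r0 rP] := cf s0.
have : (mu (ball s0 r) <= mu N)%E.
  apply: le_measure; rewrite ?inE//; first exact: measurable_ball.
  move=> s /rP sr; apply: NS => /= E; move: sr; rewrite E /=.
  by rewrite ltxx.
have Er : mu (ball s0 r) = (r *+ 2)%:E by exact: (lebesgue_measure_ball s0 (ltW r0)).
by rewrite N0 [X in (X <= _)%E]Er lee_fin leNgt pmulrn_lgt0// r0.
Qed.

Variable S : set 'rV[R]_d.
Hypothesis hS : smooth_hypersurface S.
Variable n : 'rV[R]_d -> 'rV[R]_d.
Hypothesis hn : unit_normal S n.
Hypothesis hFn : forall x, S x -> dot F (n x) != 0.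
Hypothesis hPhi : flow_C1_diffeo S F.
Variables (pi : 'rV[R]_d -> 'rV[R]_d) (tau : 'rV[R]_d -> R).
Hypothesis hpi : forall x, S (pi x) /\ x = pi x + tau x *: F.
Variable sigma : {measure set 'rV[R]_d -> \bar R}.
Hypothesis hsigma : surface_measure S sigma.

Lemma null_pi_ae (P : 'rV[R]_d -> Prop) : {ae sigma, forall y, P y} ->
  {ae leb d, forall x, P (pi x)}.
Proof.
move=> [N [mN N0 NS]]; exists (pi @^-1` N); split => [||x /= Px].
- rewrite -[X in measurable X]setTI; exact: (measurable_pi hPhi hpi).
- exact: (null_pi hS hn hFn hPhi hpi hsigma mN N0).
- exact: NS.
Qed.

Lemma null_flow_ae (P : 'rV[R]_d -> Prop) : {ae leb d, forall y, P y} ->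
  {ae leb d, forall x, {ae mu, forall s : R, P (x + s *: F)}}.
Proof.
move=> [N [mN N0 NS]]; apply: filterS (null_flow F mN N0) => x.
by apply: filterS => s nN; apply: contrapT => nP; apply: nN; exact: NS.
Qed.

Lemma trace_unique (h vS v1 v2 : 'rV[R]_d -> 'rV[R]_d) :
  L2loc v1 -> solves F v1 h -> has_trace S sigma F v1 vS ->
  L2loc v2 -> solves F v2 h -> has_trace S sigma F v2 vS ->
  {ae leb d, forall x, v1 x = v2 x}.
Proof.
move=> l1 s1 [w1 wv1 wS1] l2 s2 [w2 wv2 wS2].
suff : {ae leb d, forall x, forall i, v1 x 0 i - v2 x 0 i = 0}.
  by apply: filterS => x E; apply/rowP => i; apply/eqP; rewrite -subr_eq0 E.
apply: filter_forall => i.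
pose u x := v1 x 0 i - v2 x 0 i.
have [m1 k1] := L2loc_loc_int i l1; have [m2 k2] := L2loc_loc_int i l2.
have lu : loc_int u.
  split; first exact: measurable_funB.
  move=> K cK; exact: (integrableB (compact_measurable_rV cK) (k1 K cK) (k2 K cK)).
have uF phi : test_function phi -> \int[leb d]_x (u x * 'D_F phi x) = 0.
  move=> tphi; have tD := test_derive F tphi.
  have i1 := test_integrable (L2loc_loc_int i l1) tD.
  have i2 := test_integrable (L2loc_loc_int i l2) tD.
  have e1 := s1 i phi tphi; rewrite (distr_directional F (L2loc_loc_int i l1) tphi) in e1.
  have e2 := s2 i phi tphi; rewrite (distr_directional F (L2loc_loc_int i l2) tphi) in e2.
  transitivity (\int[leb d]_x (v1 x 0 i * 'D_F phi x) - \int[leb d]_x (v2 x 0 i * 'D_F phi x)).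
    rewrite -(RintegralB measurableT i1 i2).
    by apply: eq_Rintegral => x _; rewrite mulrBl.
  by apply/eqP; rewrite subr_eq0 -eqr_opp e1 e2.
have c1 := ae_line_const lu.1 (fun s => @shift_invariant R d u F s lu uF).
have c2 := null_flow_ae wv1.
have c3 := null_flow_ae wv2.
have c4 := null_pi_ae wS1.
have c5 := null_pi_ae wS2.
apply: filterS3 c1 (filterI c2 c3) (filterI c4 c5) => x x1 [x2 x3] [x4 x5].
have Sp : S (pi x) by have [] := hpi x.
have [ac1 e1] := x4 Sp; have [ac2 e2] := x5 Sp.
have cw (w : 'rV[R]_d -> 'rV[R]_d) :
    (forall a b : R, abs_continuous a b (fun s : R => w (pi x + s *: F))) ->
    continuous (fun s : R => w (x + s *: F) 0 i).
  move=> ac s.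
  have -> : (fun s : R => w (x + s *: F) 0 i) =
      (fun v : 'rV[R]_d => v 0 i) \o (fun s : R => w (pi x + s *: F)) \o (fun s => tau x + s).
    by apply/funext => t /=; rewrite [in LHS](hpi x).2 -addrA -scalerDl.
  apply: continuous_comp; first by apply: cvgD; [exact: cvg_cst|exact: cvg_id].
  apply: continuous_comp; last exact: coord_continuous.
  exact: abs_continuous_continuous.
have cont : continuous (fun s : R => w1 (x + s *: F) 0 i - w2 (x + s *: F) 0 i).
  by move=> s; apply: cvgB; [exact: (cw _ ac1)|exact: (cw _ ac2)].
(* At time [- tau x] the line meets the hypersurface, where both representatives equal [vS]. Their
   difference is continuous and almost everywhere equal to [u x] on the line, so [u x] is 0. *)
have H := @continuous_ae_cst _ (u x) (- tau x) cont.
rewrite -/(u x) -H.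
  have -> : x + - tau x *: F = pi x.
    by rewrite {1}(hpi x).2 -addrA -scalerDl subrr scale0r addr0.
  by rewrite e1 e2 subrr.
apply: filterS3 x1 x2 x3 => s E1 E2 E3.
by rewrite E2 E3.
Qed.

End uniqueness.

Lemma segment_supported_integrable (R : realType) (f : R -> R) (a b : R) : continuous f ->
  (forall s, ~~ (a <= s <= b) -> f s = 0) ->
  lebesgue_measure.-integrable setT (EFin \o f).
Proof.
move=> cf f0; have mI : measurable (`[a, b]%classic : set (measurableTypeR R)).
  exact: measurable_itv.
have If : lebesgue_measure.-integrable `[a, b] (EFin \o f).
  apply: continuous_compact_integrable; first exact: segment_compact.
  exact: continuous_subspaceT.
have := (@integrable_mkcond _ (measurableTypeR R) R lebesgue_measure _ (EFin \o f) mI).1 If; congr (_.-integrable _ _).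
apply/funext => s; rewrite patchE; case: ifPn => //.
by rewrite mem_setE in_itv/= => /f0 /= ->.
Qed.

Lemma unit_bump (R : realType) : exists eta : R -> R,
  [/\ forall k, ksmooth k setT eta, forall t, 1 < `|t| -> eta t = 0 &
      \int[lebesgue_measure]_t eta t = 1].
Proof.
pose b (t : R) := flat 0 (t + 1) * flat 0 (1 - t).
have sb k : ksmooth k setT b.
  have oT := @openT R.
  have sid : ksmooth k setT (id : R -> R).
    exact: (@ksmooth_lin _ _ _ _ _ idfun oT (fun x => cvg_id)).
  have s1 (c : R) : ksmooth k setT (fun _ : R => c) by exact: ksmooth_cst.
  apply: ksmooth_mul => //.
    exact: (@ksmooth_comp1 R R k setT (fun t => t + 1) (flat 0) oT (ksmooth_add oT sid (s1 1)) (ksmooth_flat R k 0)).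
  exact: (@ksmooth_comp1 R R k setT (fun t => 1 - t) (flat 0) oT (ksmooth_sub oT (s1 1) sid) (ksmooth_flat R k 0)).
have b_out t : 1 < `|t| -> b t = 0.
  rewrite ltr_normr /b => /orP[t1|t1].
    by rewrite [flat 0 (1 - t)]flat_npos ?mulr0//; lra.
  by rewrite [flat 0 (t + 1)]flat_npos ?mul0r//; lra.
have b0 t : 0 <= b t by rewrite mulr_ge0// flat_ge0.
have cb : continuous b by move=> t; apply: differentiable_continuous; exact: ksmooth_diff (sb 0%N) _.
have mb : measurable_fun setT b by exact: continuous_measurable_fun.
have ib : lebesgue_measure.-integrable setT (EFin \o b).
  apply: (@segment_supported_integrable R b (-1) 1 cb) => t.
  by rewrite -ler_norml -ltNge => /b_out.
pose c := \int[lebesgue_measure]_t b t.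
have c0 : 0 < c.
  rewrite lt_neqAle eq_sym Rintegral_ge0// andbT; apply/eqP => c00.
  have E : (\int[lebesgue_measure]_t `|(b t)%:E| = 0)%E.
    transitivity (\int[lebesgue_measure]_t (b t)%:E)%E.
      by apply: eq_integral => t _; rewrite gee0_abs ?lee_fin.
    rewrite -[LHS]fineK; last exact: (integrable_fin_num _ ib).
    by congr EFin; exact: c00.
  have mEb : measurable_fun setT (EFin \o b) by exact/measurable_EFinP.
  have H := (ae_eq_integral_abs lebesgue_measure measurableT mEb).1 E.
  have := @continuous_ae_cst R b 0 0 cb; rewrite /b add0r subr0.
  have f1 := flat0_gt0 (@ltr01 R).
  have : 0 < flat 0 1 * flat 0 1 :> R by exact: mulr_gt0.
  move=> /[swap] ->; first by rewrite ltxx.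
  by apply: (filterS _ H) => t /(_ Logic.I) [].
exists (fun t => c^-1 * b t); split.
- by move=> k; apply: ksmooth_scale => //; exact: openT.
- by move=> t /b_out ->; rewrite mulr0.
- by rewrite RintegralZl// mulVf// gt_eqF.
Qed.

(** * Divergence *)

Section fibers.
Variables (R : realType) (m : nat).
Local Notation d := m.+1.
Local Notation mu := (@lebesgue_measure R).
Variables (F : 'rV[R]_d) (S : set 'rV[R]_d).
Hypothesis hS : smooth_hypersurface S.
Variable n : 'rV[R]_d -> 'rV[R]_d.
Hypothesis hn : unit_normal S n.
Hypothesis hFn : forall x, S x -> dot F (n x) != 0.
Hypothesis hPhi : flow_C1_diffeo S F.
Variables (pi : 'rV[R]_d -> 'rV[R]_d) (tau : 'rV[R]_d -> R).
Hypothesis hpi : forall x, S (pi x) /\ x = pi x + tau x *: F.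
Local Notation g := (grad_norm tau).
Implicit Types (f w phi : 'rV[R]_d -> R).

Lemma test_mul f k0 : test_function f -> (forall k, ksmooth k setT k0) ->
  test_function (fun x => f x * k0 x).
Proof.
move=> tf sk; split.
  by apply/ksmoothP => k; apply: ksmooth_mul; [exact: openT|exact: test_ksmooth|].
by have [_ [K cK K0]] := tf; exists K => // x /K0 ->; rewrite mul0r.
Qed.

Lemma test_tau_bound f : test_function f ->
  exists2 M, 0 <= M & forall x, M < `|tau x| -> f x = 0.
Proof.
move=> [_ [K cK K0]]; have [_ ctau] := pi_tau_continuous hPhi hpi.
have /compact_bounded[M [Mreal MK]] : compact (tau @` K).
  by apply: continuous_compact => //; exact: continuous_subspaceT.
exists (`|M| + 1) => [|x Mx]; first by rewrite addr_ge0.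
apply: K0 => Kx; move: Mx; rewrite ltNge => /negP; apply.
by apply: MK; [rewrite ltr_pwDr// ler_norm|exists x].
Qed.

Lemma measurable_line f x : continuous f -> measurable_fun setT (fun s : R => f (x + s *: F)).
Proof.
by move=> cf; apply: continuous_measurable_fun; exact: (@line_continuous R d f F x cf).
Qed.

Lemma line_total_shift f x t : continuous f ->
  \int[mu]_s f (x + t *: F + s *: F) = \int[mu]_s f (x + s *: F).
Proof.
move=> cf; rewrite /Rintegral; congr fine.
have mf : measurable_fun setT (fun s : R => (f (x + s *: F))%:E).
  by apply/measurable_EFinP; exact: measurable_line.
rewrite -[RHS](integral_shift t mf); apply: eq_integral => s _.
by rewrite -addrA -scalerDl [t + s]addrC.
Qed.

Lemma line_total f x A B : continuous f ->
  (forall s, ~~ (A <= s <= A + B) -> f (x + s *: F) = 0) ->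
  \int[mu]_s f (x + s *: F) = line_int F B f (x + A *: F).
Proof.
move=> cf f0; rewrite -(line_total_shift x A cf) /line_int.
rewrite [RHS]Rintegral_mkcond; apply: eq_Rintegral => s _.
rewrite patchE; case: ifPn => //; rewrite mem_setE in_itv/= => nB.
rewrite -addrA -scalerDl; apply: f0; apply: contra nB => /andP[? ?].
by apply/andP; split; lra.
Qed.

(** Integration along the lines, from test functions on the space to test functions on [S]; the
    latter are represented by their extension by 0. *)
Definition fiber f y := if `[< S y >] then \int[mu]_s f (y + s *: F) else 0.

Lemma fiber_pi f x : continuous f -> fiber f (pi x) = \int[mu]_s f (x + s *: F).
Proof.
move=> cf; have [Sp E] := hpi x; rewrite /fiber (asboolT Sp).
by rewrite {2}E line_total_shift.
Qed.

(** Since [tau] is bounded on the support, the integrals from all the points of [S] run over one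
    window of times, where smoothness of [line_int] applies. *)
Lemma test_fiber f : test_function f -> test_function_on S (fiber f).
Proof.
move=> tf; have cf := test_continuous tf.
have [_ [K cK K0]] := tf.
have [cpi _] := pi_tau_continuous hPhi hpi.
split.
  exists (pi @` K); split.
  - by apply: continuous_compact => //; exact: continuous_subspaceT.
  - by move=> _ [x _ <-]; have [] := hpi x.
  - move=> y nKy; rewrite /fiber; case: asboolP => // Sy.
    transitivity (\int[mu]_s (cst 0 s : R)); last by rewrite Rintegral_cst// mul0r.
    apply: eq_Rintegral => s _; apply: K0 => Ky; apply: nKy; exists (y + s *: F) => //.
    by have [] := pi_tau_flow hPhi hpi s Sy.
move=> V gamma gP; have [oV _ _ _ _] := gP; have [M M0 fM] := test_tau_bound tf.
apply/ksmoothP => k.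
have sl : ksmooth k setT (line_int F (M + M) f).
  by apply: ksmooth_line_int; [exact: addr_ge0|exact: test_ksmooth].
have sc : ksmooth k V (line_int F (M + M) f \o (fun u => gamma u + (- M) *: F)).
  apply: (@ksmooth_comp R 'rV[R]_m 'rV[R]_d k 'I_d (fun l => delta_mx 0 l)
    (fun l u => gamma u 0 l + (- M) * F 0 l) (fun u => gamma u + (- M) *: F) V setT) => //.
    by move=> u _; rewrite [LHS]row_sum_delta; apply: eq_bigr => l _; rewrite !mxE.
  move=> l; apply: ksmooth_add => //; first exact: (param_component gP).
  exact: ksmooth_cst.
apply: eq_ksmooth oV _ sc => u /set_mem Vu; have Sg := param_S gP Vu.
rewrite /= /fiber (asboolT Sg); apply/esym; apply: line_total => // s nB; apply: fM.
have [_ ->] := pi_tau_flow hPhi hpi s Sg.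
rewrite ltNge; apply: contra nB; rewrite ler_norml => /andP[? ?].
by apply/andP; split; lra.
Qed.

(* The primitive of [w] along the lines vanishes before and after the support of
   [w]; it is written there with two formulas that agree on an overlap, so that
   each of them is visibly smooth. *)
Lemma antiderivative w : test_function w ->
  (forall x, \int[mu]_s w (x + s *: F) = 0) ->
  exists2 X, test_function X & 'D_F X = w.
Proof.
move=> tw w0; have cw := test_continuous tw; have [M M0 wM] := test_tau_bound tw.
have [_ ctau] := pi_tau_continuous hPhi hpi.
have tauD := tau_shift hPhi hpi.
(* From a point of [U1], where [tau] exceeds [- M - 1], a segment of this parameter length ends
   beyond [tau = M], past the support of [w]. *)
pose B := M + M + 2.
have B0 : 0 <= B by rewrite !addr_ge0.
pose L := line_int F B w.
have tL : test_function L by exact: test_line_int.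
(* Minus the integral of [w] ahead of [x] equals the integral behind it, as the total vanishes;
   before the support this is 0. *)
pose X x := if tau x < - M then 0 else - L x.
pose U1 := [set x | - M - 1 < tau x].
pose U2 := [set x | tau x < - M].
have oU1 : open U1 by apply: (@open_comp _ _ tau [set t | - M - 1 < t]) => [x _|]; [exact: ctau|exact: open_gt].
have oU2 : open U2 by apply: (@open_comp _ _ tau [set t | t < - M]) => [x _|]; [exact: ctau|exact: open_lt].
have X1 x : U1 x -> X x = - L x.
  rewrite /U1/= /X => x1; case: ifPn => // x2.
  have -> : L x = line_int F B w (x + 0 *: F) by rewrite scale0r addr0.
  rewrite -line_total ?w0 ?oppr0// => s nB; apply: wM; rewrite tauD.
  rewrite ltNge; apply: contra nB; rewrite ler_norml => /andP[? ?].
  by rewrite /B; apply/andP; split; lra.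
have X2 x : U2 x -> X x = 0 by rewrite /U2/= /X => ->.
have U12 x : U1 x \/ U2 x.
  by rewrite /U1 /U2/=; have [?|?] := ltP (tau x) (- M); [right|left; lra].
exists X.
  split.
    apply/ksmoothP => k; apply: ksmooth_local => x _; have [Ux|Ux] := U12 x.
      exists U1 => //; apply: (@eq_ksmooth _ _ _ _ _ (fun x => - L x)) => //.
        by move=> y /set_mem /X1 ->.
      by apply: ksmooth_opp => //; apply: sub_ksmooth (test_ksmooth k tL).
    exists U2 => //; apply: (@eq_ksmooth _ _ _ _ _ (fun=> 0)) => //.
      by move=> y /set_mem /X2 ->.
    exact: ksmooth_cst.
  have [_ [K cK K0]] := tL; exists K => // x /K0 Lx.
  by rewrite /X Lx oppr0; case: ifPn.
apply/funext => x; have [Ux|Ux] := U12 x.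
  rewrite (@near_eq_derive_val _ _ _ X (fun x => - L x)); last first.
    by have := open_nbhs_nbhs (conj oU1 Ux); apply: filterS.
  have [dL DL] := line_int_diff F x B0 (test_ksmooth 1 tw).
  rewrite deriveN; last exact: diff_derivable.
  rewrite [X in - X](DL F) line_int_derive//; last exact: test_ksmooth.
  rewrite (wM (x + B *: F)) ?sub0r ?opprK// tauD.
  by move: Ux; rewrite /U1/= ltr_normr /B => ?; apply/orP; left; lra.
rewrite (@near_eq_derive_val _ _ _ X (fun=> 0)); last first.
  by have := open_nbhs_nbhs (conj oU2 Ux); apply: filterS.
rewrite derive_cst wM//.
by move: Ux; rewrite /U2/= ltr_normr => ?; apply/orP; right; lra.
Qed.

Variable eta : R -> R.
Hypothesis seta : forall k, ksmooth k setT eta.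
Hypothesis eta_out : forall t, 1 < `|t| -> eta t = 0.
Hypothesis eta1 : \int[mu]_t eta t = 1.

(* Testing a distribution on R^d against [flow_lift phi] yields its restriction
   to [S]: [eta] has integral 1 and [grad_norm] is the Jacobian factor of the
   pullback. *)
Definition flow_lift phi x := phi (pi x) * (eta (tau x) * g x).

Let sg k : ksmooth k setT g. Proof. exact: (ksmooth_grad_norm hn hFn hPhi hpi hS). Qed.

Lemma ksmooth_bump_weight k : ksmooth k setT (fun x => eta (tau x) * g x).
Proof.
apply: ksmooth_mul; [exact: openT| |exact: sg].
exact: (ksmooth_comp1 openT (ksmooth_tau hn hFn hPhi hpi hS k) (seta k)).
Qed.

Definition tube (K : set 'rV[R]_d) : set 'rV[R]_d := flow F @` (K `*` `[-1, 1]).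

Lemma compact_tube K : compact K -> compact (tube K).
Proof.
move=> cK; apply: continuous_compact; last first.
  by apply: compact_setX => //; exact: segment_compact.
apply: continuous_subspaceT => p; apply: cvgD; first exact: cvg_fst.
by apply: cvgZr_tmp; exact: cvg_snd.
Qed.

Lemma lift_out K phi x : (forall y, ~ K y -> phi y = 0) -> ~ tube K x -> flow_lift phi x = 0.
Proof.
move=> K0 nx; rewrite /flow_lift.
have [Kp|/K0->] := pselect (K (pi x)); last by rewrite mul0r.
have [t1|/eta_out->] := leP `|tau x| 1; last by rewrite mul0r mulr0.
exfalso; apply: nx; exists (pi x, tau x); last by rewrite /flow/= -(hpi x).2.
by split => //=; rewrite in_itv/= -ler_norml.
Qed.

Lemma test_lift phi : test_function_on S phi -> test_function (flow_lift phi).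
Proof.
move=> [[K [cK KS K0]] sphi]; split; last first.
  exists (tube K); first exact: compact_tube.
  by move=> x; exact: lift_out.
apply/ksmoothP => k; apply: ksmooth_mul; [exact: openT| |exact: ksmooth_bump_weight].
apply: (ksmooth_comp_pi hn hFn hPhi hpi hS) => V gamma gP.
by have /ksmoothP := sphi V gamma gP.
Qed.

(** Both arguments of [T] have the same integral along every line, as [grad_norm] is constant there
    and [eta] has integral 1. Their difference is therefore an [F]-derivative of a test function,
    which [T] kills. *)
Lemma fiber_lift (T : ('rV[R]_d -> R) -> R) f :
  (forall f1 f2, test_function f1 -> test_function f2 ->
     T (fun x => f1 x - f2 x) = T f1 - T f2) ->
  (forall X, test_function X -> T ('D_F X) = 0) ->
  test_function f -> T (fun x => f x * g x) = T (flow_lift (fiber f)).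
Proof.
move=> TB TD tf; have cf := test_continuous tf.
have t1 : test_function (fun x => f x * g x) by exact: test_mul.
have t2 := test_lift (test_fiber tf).
pose w x := f x * g x - flow_lift (fiber f) x.
have tw : test_function w.
  split; first by apply/ksmoothP => k; apply: ksmooth_sub; [exact: openT|exact: test_ksmooth|exact: test_ksmooth].
  have [_ [K1 cK1 K10]] := t1; have [_ [K2 cK2 K20]] := t2.
  exists (K1 `|` K2); first exact: compactU.
  by move=> x /not_orP[/K10 E1 /K20 E2]; rewrite /w E1 E2 subrr.
suff /(antiderivative tw)[X tX XE] : forall x, \int[mu]_s w (x + s *: F) = 0.
  have := TD X tX; rewrite XE TB// => /eqP; rewrite subr_eq0 => /eqP.
  exact.
move=> x.
have lineI k : test_function k -> mu.-integrable setT (EFin \o (fun s : R => k (x + s *: F))).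
  move=> tk; have ck := test_continuous tk; have [M M0 kM] := test_tau_bound tk.
  apply: (@segment_supported_integrable R _ (- M - tau x) (M - tau x)
    (@line_continuous R d k F x ck)) => s nB; apply: kM.
  rewrite (tau_shift hPhi hpi) ltNge.
  apply: contra nB; rewrite ler_norml => /andP[? ?].
  by apply/andP; split; lra.
have gs s : g (x + s *: F) = g x by exact: (grad_norm_shift hn hFn hPhi hpi hS).
rewrite (RintegralB measurableT (lineI _ t1) (lineI _ t2)).
apply/eqP; rewrite subr_eq0; apply/eqP.
transitivity (\int[mu]_s (g x * f (x + s *: F))).
  by apply: eq_Rintegral => s _; rewrite gs mulrC.
rewrite (RintegralZl _ measurableT (lineI _ tf)).
transitivity (\int[mu]_s (g x * fiber f (pi x) * eta (s + tau x))); last first.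
  apply: eq_Rintegral => s _.
  rewrite /flow_lift gs (pi_shift hPhi hpi) (tau_shift hPhi hpi) [tau x + s]addrC.
  by rewrite -mulrA mulrC -!mulrA; congr (_ * _); rewrite mulrC.
have ceta : continuous eta.
  by move=> t; apply: differentiable_continuous; exact: ksmooth_diff (seta 0%N) _.
have meta : measurable_fun setT eta by exact: continuous_measurable_fun.
have ieta : mu.-integrable setT (EFin \o (fun s => eta (s + tau x))).
  apply: (@segment_supported_integrable R _ (- 1 - tau x) (1 - tau x)) => [s|s nB].
    apply: (@continuous_comp _ _ _ (fun s => s + tau x) eta); last exact: ceta.
    by apply: cvgD; [exact: cvg_id|exact: cvg_cst].
  rewrite eta_out// ltNge; apply: contra nB; rewrite ler_norml => /andP[? ?].
  by apply/andP; split; lra.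
rewrite (RintegralZl _ measurableT ieta).
have -> : \int[mu]_s eta (s + tau x) = 1.
  rewrite -eta1 /Rintegral; congr fine.
  have mE : measurable_fun setT (EFin \o eta) by exact/measurable_EFinP.
  exact: (integral_shift (tau x) mE).
by rewrite mulr1 fiber_pi.
Qed.

End fibers.

Lemma compact_bound (R : realType) d (f : 'rV[R]_d -> R) (K : set 'rV[R]_d) :
  continuous f -> compact K -> exists2 C, 0 < C & forall x, K x -> `|f x| <= C.
Proof.
move=> cf cK.
have /compact_bounded[M [Mreal MK]] : compact (f @` K).
  by apply: continuous_compact => //; exact: continuous_subspaceT.
exists (`|M| + 1) => [|x Kx]; first by rewrite ltr_wpDl.
by apply: MK; [rewrite ltr_pwDr// ler_norm|exists x].
Qed.

Section divergence.
Variables (R : realType) (d : nat).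
Local Notation leb := (lebesgue_rV R d).
Implicit Types (v h : 'rV[R]_d -> 'rV[R]_d) (phi psi : 'rV[R]_d -> R).

Lemma distr_div_linear v (a : R) phi psi : L2loc v -> test_function phi -> test_function psi ->
  distr_div v (fun x => a * phi x + psi x) = a * distr_div v phi + distr_div v psi.
Proof.
move=> lv tphi tpsi; rewrite /distr_div mulr_sumr -big_split/=; apply: eq_bigr => i _.
have lvi := L2loc_loc_int i lv.
have i1 := test_integrable lvi (test_derive (delta_mx 0 i) tphi).
have i2 := test_integrable lvi (test_derive (delta_mx 0 i) tpsi).
rewrite /distr_partial /distr_of mulrN -opprD; congr (- _).
have ia : leb.-integrable setT (EFin \o (fun x => a * (v x 0 i * partial i phi x))).
  exact: (integrableZl measurableT a i1).
rewrite -(RintegralZl _ measurableT i1) -(RintegralD measurableT ia i2).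
apply: eq_Rintegral => x _.
have dp : derivable phi x (delta_mx 0 i).
  by apply: diff_derivable; exact: ksmooth_diff (test_ksmooth 0 tphi) _.
have dq : derivable psi x (delta_mx 0 i).
  by apply: diff_derivable; exact: ksmooth_diff (test_ksmooth 0 tpsi) _.
rewrite /partial.
have -> : 'D_(delta_mx 0 i) (fun x => a * phi x + psi x) x =
    a * 'D_(delta_mx 0 i) phi x + 'D_(delta_mx 0 i) psi x.
  rewrite -[X in 'D__ X _]/(a *: phi + psi).
  have da : derivable (a *: phi) x (delta_mx 0 i) by exact: derivableZ.
  by rewrite (deriveD da dq) (deriveZ _ dp).
by rewrite mulrDr mulrCA.
Qed.

(** Exchanging the derivatives of [phi] moves the one along [F] next to [v]; the equation then
    leaves the divergence of [h]. *)
Lemma distr_div_flow v h F phi : L2loc v -> solves F v h ->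
  eq_distr (distr_div h) (fun=> 0) -> test_function phi ->
  distr_div v ('D_F phi) = 0.
Proof.
move=> lv sv h0 tphi; rewrite -[RHS]oppr0 -(h0 phi tphi) /distr_div -sumrN.
apply: eq_bigr => i _; rewrite /distr_partial opprK.
rewrite -[RHS](sv i _ (test_derive (delta_mx 0 i) tphi)).
rewrite (distr_directional F (L2loc_loc_int i lv) (test_derive _ tphi)).
have E x : 'D_(delta_mx 0 i) ('D_F phi) x = 'D_F ('D_(delta_mx 0 i) phi) x.
  exact: derive_comm (test_ksmooth 2 tphi).
rewrite /distr_of.
apply/eqP; rewrite eqr_opp; apply/eqP.
apply: eq_Rintegral => x _.
rewrite /partial E.
done.
Qed.

End divergence.

(** * The divergence as a distribution on the hypersurface *)

Section distribution_on_hypersurface.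
Variables (R : realType) (m : nat).
Local Notation d := m.+1.
Local Notation leb := (lebesgue_rV R d).
Variables (F : 'rV[R]_d) (S : set 'rV[R]_d).
Hypothesis hS : smooth_hypersurface S.
Variable n : 'rV[R]_d -> 'rV[R]_d.
Hypothesis hn : unit_normal S n.
Hypothesis hFn : forall x, S x -> dot F (n x) != 0.
Hypothesis hPhi : flow_C1_diffeo S F.
Variables (pi : 'rV[R]_d -> 'rV[R]_d) (tau : 'rV[R]_d -> R).
Hypothesis hpi : forall x, S (pi x) /\ x = pi x + tau x *: F.

(** Near [x0] the chart coordinate stays in a compact ball, on which [test_cvg0] is uniform and the
    coefficients of the chain rule are bounded. The joint [near] form is the one that the covering
    argument for compact sets takes. *)
Lemma test_cvg0_pi (phi_ : nat -> 'rV[R]_d -> R) (v x0 : 'rV[R]_d) (e : R) : 0 < e ->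
  (forall k, test_function_on S (phi_ k)) -> test_cvg0 S phi_ ->
  \forall x \near x0 & k \near \oo,
    `|phi_ k (pi x)| < e /\ `|'D_v (phi_ k \o pi) x| < e.
Proof.
move=> e0 tphi [_ phi0].
have [V [gamma [gP W0]]] := chart_cover hpi hS x0.
have [oV _ _ _ _] := gP.
have oW : open (chart_dom pi V gamma) by exact: (@open_chart_dom _ _ _ _ hPhi _ _ hpi _ _ gP).
pose th := theta pi V gamma.
have [Vu gu] := thetaP W0; set u0 := theta pi V gamma x0 in Vu gu.
pose c j (u : 'rV[R]_m) := \sum_l v 0 l * invmx (frame F gamma u) l (rshift 1 j).
have sc j : ksmooth 0 V (c j).
  apply: ksmooth_sum => // l _; apply: ksmooth_scale => //.
  exact: (ksmooth_frameV hn hFn gP).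
pose B := 1 + \sum_j `|c j u0|.
have B0 : 0 < B by rewrite ltr_pwDl// sumr_ge0.
have cB : \forall u \near u0, forall j, `|c j u| <= B.
  have := @filter_forall _ _ (fun j u => `|c j u| <= B) (nbhs u0) _; apply => j.
  have cc : {for u0, continuous (c j)}.
    by apply: differentiable_continuous; exact: ksmooth_diff (sc j) Vu.
  have cn : {for u0, continuous (fun u => `|c j u|)} by exact: (cvg_norm cc).
  have : `|c j u0| < B.
    rewrite /B (bigD1 j)//=.
    have : 0 <= \sum_(k < m | k != j) `|c k u0| by apply: sumr_ge0.
    by lra.
  by move=> /(cvgr_lt _ cn); apply: filterS => y /ltW.
have : nbhs u0 (V `&` [set u | forall j, `|c j u| <= B]).
  by apply: filterI => //; exact: open_nbhs_nbhs.
move=> /nbhs_ballP[r /= r0 rV].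
pose L := closed_ball u0 (r / 2).
have r2 : 0 < r / 2 by rewrite divr_gt0.
have Lr u : L u -> ball u0 r u.
  rewrite /L closed_ballE// /closed_ball_/= -ball_normE/= => /le_lt_trans; apply.
  by rewrite ltr_pdivrMr// ltr_pMr// ltr1n.
have cL : compact L by exact: compact_closed_ball.
have LV : L `<=` V by move=> u /Lr/rV[].
have nL : nbhs u0 L.
  by apply/nbhs_ballP; exists (r / 2) => //=; exact: subset_closed_ball.
have mB : 0 < m%:R * B + 1 by rewrite ltr_wpDl// mulr_ge0// ltW.
(* At most [e] itself, and small enough for [m] terms of size [B * e'] to add up to less than
   [e]. *)
pose e' := e / (m%:R * B + 1).
have e'0 : 0 < e' by rewrite divr_gt0.
have e'e : e' <= e by rewrite ler_pdivrMr// ler_pMr// lerDr mulr_ge0// ltW.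
have k1 := phi0 V gamma gP [::] L cL LV e' e'0.
have k2 : \forall k \near \oo, forall j u, L u ->
    `|'D_(delta_mx 0 j) (phi_ k \o gamma) u| < e'.
  have := @filter_forall _ _ (fun j k => forall u, L u ->
    `|'D_(delta_mx 0 j : 'rV[R]_m) (phi_ k \o gamma) u| < e') \oo _; apply => j.
  exact: (phi0 V gamma gP [:: delta_mx 0 j] L cL LV e' e'0).
have x1 : \forall x \near x0, chart_dom pi V gamma x by exact: open_nbhs_nbhs.
have x2 : nbhs x0 (theta pi V gamma @^-1` L).
  have ct : theta pi V gamma x @[x --> x0] --> u0.
    exact: (@theta_continuous _ _ _ _ hPhi _ _ hpi _ _ gP _ W0).
  by move: (L) nL => L' nL'; exact: (ct L' nL').
near=> x k.
have Wx : chart_dom pi V gamma x by near: x.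
have Lx : L (theta pi V gamma x) by near: x.
have K1 : forall u, L u -> `|iter_derive [::] (phi_ k \o gamma) u| < e' by near: k.
have K2 : forall j u, L u -> `|'D_(delta_mx 0 j) (phi_ k \o gamma) u| < e' by near: k.
have [Vx gx] := thetaP Wx.
split; first by rewrite -gx; apply: lt_le_trans e'e; exact: K1.
have -> : 'D_v (phi_ k \o pi) x = 'D_v ((phi_ k \o gamma) \o theta pi V gamma) x.
  apply: near_eq_derive_val; have := open_nbhs_nbhs (conj oW Wx).
  by apply: filterS => y Wy /=; case: (thetaP Wy) => _ ->.
have sa : ksmooth 0 V (phi_ k \o gamma).
  by have [_ sphi] := tphi k; have /ksmoothP := sphi V gamma gP.
have [_ ->] := derive_comp_theta hn hFn hPhi hpi gP Wx (ksmooth_diff sa Vx).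
apply: (le_lt_trans (ler_norm_sum _ _ _)).
apply: (@le_lt_trans _ _ (\sum_(j < m) B * e')).
  apply: ler_sum => j _; rewrite normrM; apply: ler_pM => //; last exact/ltW/K2.
  have [_ H] := rV _ (Lr _ Lx); apply: le_trans (H j).
  by rewrite /dTheta/= !mxE.
rewrite sumr_const card_ord -mulr_natl mulrA /e' mulrCA -[ltRHS]mulr1 ltr_pM2l//.
by rewrite ltr_pdivrMr// mul1r ltrDl.
Unshelve. all: by end_near. Qed.

Variable eta : R -> R.
Hypothesis seta : forall k, ksmooth k setT eta.
Hypothesis eta_out : forall t, 1 < `|t| -> eta t = 0.
Local Notation lft := (flow_lift pi tau eta).

(** Product rule with the fixed weight, bounded on [K] together with its derivative by [C1] and
    [C2]; compactness makes the local estimates uniform. *)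
Lemma test_cvg0_lift (phi_ : nat -> 'rV[R]_d -> R) (v : 'rV[R]_d) (K : set 'rV[R]_d) (e : R) :
  0 < e -> compact K ->
  (forall k, test_function_on S (phi_ k)) -> test_cvg0 S phi_ ->
  \forall k \near \oo, forall x, K x -> `|'D_v (lft (phi_ k)) x| <= e.
Proof.
move=> e0 cK tphi cphi.
pose W x := eta (tau x) * grad_norm tau x.
have sW k : ksmooth k setT W by exact: (ksmooth_bump_weight hS hn hFn hPhi hpi seta).
have [C1 C10 WC1] := compact_bound (ksmooth_continuous (sW 0%N)) cK.
have [C2 C20 WC2] := compact_bound (ksmooth_continuous (ksmoothD v (sW 1%N))) cK.
pose e' := e / (C1 + C2).
have C0 : 0 < C1 + C2 by rewrite addr_gt0.
have e'0 : 0 < e' by rewrite divr_gt0.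
have /compact_near_coveringP ncov := cK.
have := ncov _ (\oo : set_system nat) (fun k x =>
    `|phi_ k (pi x)| < e' /\ `|'D_v (phi_ k \o pi) x| < e') _.
move=> /(_ _ (fun x _ => test_cvg0_pi v x e'0 tphi cphi)).
apply: filterS => k kP x Kx; have [p1 p2] := kP x Kx.
have sp : ksmooth 0 setT (phi_ k \o pi).
  apply: (ksmooth_comp_pi hn hFn hPhi hpi hS) => V gamma gP.
  by have [_ sphi] := tphi k; have /ksmoothP := sphi V gamma gP.
have -> : 'D_v (lft (phi_ k)) x = phi_ k (pi x) * 'D_v W x + W x * 'D_v (phi_ k \o pi) x.
  rewrite -[X in 'D_v X x]/((phi_ k \o pi) * W) deriveM//.
  - by apply: diff_derivable; exact: ksmooth_diff sp _.
  - by apply: diff_derivable; exact: ksmooth_diff (sW 0%N) _.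
apply: (le_trans (ler_normD _ _)); rewrite normrM [`|W x * _|]normrM.
have -> : e = e' * C2 + C1 * e' by rewrite [C1 * _]mulrC -mulrDr addrC /e' divfK// gt_eqF.
have H1 := ler_pM (normr_ge0 _) (normr_ge0 _) (ltW p1) (WC2 x Kx).
have H2 := ler_pM (normr_ge0 _) (normr_ge0 _) (WC1 x Kx) (ltW p2).
exact: (lerD H1 H2).
Qed.

(** The lifts are all supported in one compact tube, where [v] is integrable and their first
    derivatives tend to 0 uniformly. *)
Lemma distribution_lift (v : 'rV[R]_d -> 'rV[R]_d) : L2loc v ->
  distribution_on S (fun phi => distr_div v (lft phi)).
Proof.
move=> lv; have tl := test_lift hS hn hFn hPhi hpi seta eta_out.
split=> [a phi1 phi2 t1 t2|phi_ tphi cphi].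
  rewrite -(distr_div_linear a lv (tl _ t1) (tl _ t2)); congr (distr_div v _).
  by apply/funext => x; rewrite /flow_lift mulrDl -mulrA.
have [[K [cK KS K0]] _] := cphi.
pose K' := tube F K.
have cK' : compact K' by exact: compact_tube.
have mK' := compact_measurable_rV cK'.
have -> : (0 : R) = \sum_(i < d) 0 by rewrite big1.
apply: (@cvg_sumr _ _ _ \oo _) => i.
apply/cvgrPdist_le => e e0.
have [mvi vK] := L2loc_loc_int i lv.
have iv := integrable_norm (vK _ cK').
pose A := \int[leb]_(x in K') `|v x 0 i|.
have A0 : 0 <= A by apply: Rintegral_ge0.
have e'0 : 0 < e / (A + 1) by rewrite divr_gt0// ltr_wpDl.
have := test_cvg0_lift (delta_mx 0 i) e'0 cK' tphi cphi.
apply: filterS => k kP.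
have td := test_derive (delta_mx 0 i) (tl _ (tphi k)).
have iI := test_integrable (L2loc_loc_int i lv) td.
rewrite sub0r normrN /distr_partial normrN /distr_of.
apply: (le_trans (le_normr_Rintegral measurableT iI)).
have D0 x : ~ K' x -> 'D_(delta_mx 0 i) (lft (phi_ k)) x = 0.
  move=> nK.
  have -> : 'D_(delta_mx 0 i) (lft (phi_ k)) x = 'D_(delta_mx 0 i) (cst 0 : 'rV[R]_d -> R) x.
    apply: near_eq_derive_val.
    have oK : open (~` K') by apply: closed_openC; exact: compact_closed.
    have := open_nbhs_nbhs (conj oK nK); apply: filterS => y.
    by apply: (lift_out hpi eta_out) => z; exact: K0.
  by rewrite derive_cst.
have -> : \int[leb]_x `|v x 0 i * partial i (lft (phi_ k)) x| =
    \int[leb]_(x in K') `|v x 0 i * partial i (lft (phi_ k)) x|.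
  rewrite [RHS]Rintegral_mkcond; apply: eq_Rintegral => x _.
  rewrite patchE; case: ifPn => //; rewrite notin_setE => /D0; rewrite /partial => ->.
  by rewrite mulr0 normr0.
have iK := integrableS measurableT mK' (@subsetT _ _) (integrable_norm iI).
have iZ : leb.-integrable K' (EFin \o (fun x => e / (A + 1) * `|v x 0 i|)).
  exact: (integrableZl mK' (e / (A + 1)) iv).
apply: (@le_trans _ _ (\int[leb]_(x in K') (e / (A + 1) * `|v x 0 i|))).
  apply: le_Rintegral => // x Kx.
  by rewrite normrM mulrC ler_wpM2r// kP.
rewrite (RintegralZl _ mK' iv) -/A mulrAC ler_pdivrMr ?ltr_wpDl//.
by rewrite ler_pM2l// lerDl.
Qed.

End distribution_on_hypersurface.

Section divergence_free.
Variables (R : realType) (m : nat).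
Local Notation d := m.+1.
Variables (F : 'rV[R]_d) (S : set 'rV[R]_d).
Hypothesis hS : smooth_hypersurface S.
Variable n : 'rV[R]_d -> 'rV[R]_d.
Hypothesis hn : unit_normal S n.
Hypothesis hFn : forall x, S x -> dot F (n x) != 0.
Hypothesis hPhi : flow_C1_diffeo S F.
Variables (pi : 'rV[R]_d -> 'rV[R]_d) (tau : 'rV[R]_d -> R).
Hypothesis hpi : forall x, S (pi x) /\ x = pi x + tau x *: F.
Local Notation g := (grad_norm tau).

Lemma test_cylinder psi : test_function_on_cylinder S psi ->
  test_function (fun x => psi (pi x, tau x)).
Proof.
move=> [[K [cK KS K0]] spsi]; split.
  apply/ksmoothP => k; apply: (ksmooth_comp_pi_tau hn hFn hPhi hpi hS) => V gamma gP.
  by have /ksmoothP := spsi V gamma gP.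
exists (flow F @` K).
  apply: continuous_compact => //; apply: continuous_subspaceT => p.
  by apply: cvgD; [exact: cvg_fst|apply: cvgZr_tmp; exact: cvg_snd].
move=> x nx; apply: K0 => Kx; apply: nx; exists (pi x, tau x) => //.
by rewrite /flow/= -(hpi x).2.
Qed.

(** On [S] this is the definition of the flow coordinates; off [S] both sides vanish because [psi]
    is supported over [S]. *)
Lemma fiber_cylinder psi : test_function_on_cylinder S psi ->
  fiber F S (fun x => psi (pi x, tau x)) = fun y => \int[lebesgue_measure]_s psi (y, s).
Proof.
move=> [[K [cK KS K0]] spsi]; apply/funext => y; rewrite /fiber.
case: asboolP => [Sy|nSy].
  by apply: eq_Rintegral => s _; have [-> ->] := pi_tau_flow hPhi hpi s Sy.
transitivity (\int[lebesgue_measure]_s (cst 0 s : R)); first by rewrite Rintegral_cst// mul0r.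
by apply: eq_Rintegral => s _; rewrite K0// => /KS [].
Qed.

(** By [fiber_lift], composing the divergence with [flow_lift] gives the distribution on [S] whose
    product with 1 is the pullback. It vanishes by assumption, and the same identity recovers the
    divergence from it. *)
Lemma divergence_free (v h : 'rV[R]_d -> 'rV[R]_d) : L2loc v -> solves F v h ->
  eq_distr (distr_div h) (fun=> 0) ->
  vanishes_on S F n pi tau (distr_div v) ->
  eq_distr (distr_div v) (fun=> 0).
Proof.
move=> lv sv h0 vS0 phi tphi.
have [eta [seta eta_out eta1]] := unit_bump R.
have TB f1 f2 : test_function f1 -> test_function f2 ->
    distr_div v (fun x => f1 x - f2 x) = distr_div v f1 - distr_div v f2.
  move=> t1 t2; have := distr_div_linear (-1) lv t2 t1.
  rewrite mulN1r addrC => <-; congr (distr_div v _); apply/funext => x.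
  by rewrite mulN1r addrC.
have TD X : test_function X -> distr_div v ('D_F X) = 0 by exact: (distr_div_flow lv sv h0).
have key f tf := @fiber_lift R m F S hS n hn hFn hPhi pi tau hpi eta seta eta_out eta1
  (distr_div v) f TB TD tf.
have TS0 := vS0 _ (distribution_lift hS hn hFn hPhi hpi seta eta_out lv).
have {}TS0 : forall phi, test_function_on S phi ->
    distr_div v (flow_lift pi tau eta phi) = 0.
  apply: TS0 => psi tpsi; rewrite /pullback /tensor_one -(fiber_cylinder tpsi) -key.
    by congr (distr_div v _); apply/funext => x; rewrite (dot_normal hn hFn hPhi hpi hS).
  exact: test_cylinder.
have g0 x : 0 < g x by exact: (grad_norm_gt0 hn hFn hPhi hpi hS).
(* Dividing by the Jacobian factor in advance turns the left side of [fiber_lift] into the value at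
   [phi] itself. *)
have tf : test_function (fun x => phi x * (g x)^-1).
  apply: test_mul => // k; apply: ksmooth_inv; first exact: openT.
    by move=> x _; rewrite gt_eqF.
  exact: (ksmooth_grad_norm hn hFn hPhi hpi hS).
have := key _ tf; rewrite TS0; last exact: (test_fiber hPhi hpi tf).
move=> <-; congr (distr_div v _); apply/funext => x.
by rewrite divfK// gt_eqF.
Qed.

End divergence_free.

Theorem theorem1 (R : realType) (d : nat) (hd : d = 2%N \/ d = 3%N)
    (F : 'rV[R]_d)
    (S : set 'rV[R]_d) (hS : smooth_hypersurface S)
    (n : 'rV[R]_d -> 'rV[R]_d) (hn : unit_normal S n)
    (hFn : forall x, S x -> dot F (n x) != 0)
    (hPhi : flow_C1_diffeo S F)
    (sigma : {measure set 'rV[R]_d -> \bar R}) (hsigma : surface_measure S sigma)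
    (pi : 'rV[R]_d -> 'rV[R]_d) (tau : 'rV[R]_d -> R)
    (hpi : forall x, S (pi x) /\ x = pi x + tau x *: F)
    (h : 'rV[R]_d -> 'rV[R]_d) (hh : L2 (lebesgue_rV R d) setT h) :
  [/\
    (exists v, L2loc v /\ solves F v h) /\
    (forall vS, L2 sigma S vS ->
       let v := transport F pi tau h vS in
       [/\ L2loc v, solves F v h & has_trace S sigma F v vS]),
    (forall vS, L2 sigma S vS ->
       forall v1 v2,
         L2loc v1 -> solves F v1 h -> has_trace S sigma F v1 vS ->
         L2loc v2 -> solves F v2 h -> has_trace S sigma F v2 vS ->
         {ae lebesgue_rV R d, forall x, v1 x = v2 x}) &
    (forall v, L2loc v -> solves F v h ->
       eq_distr (distr_div h) (fun=> 0) ->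
       vanishes_on S F n pi tau (distr_div v) ->
       eq_distr (distr_div v) (fun=> 0))
  ].
Proof.
(* With [d] written as [m.+1], the parameter space of dimension [d.-1] reduces to dimension [m] by
   computation. *)
have mh : d = d.-1.+1 by case: hd => ->.
move: (d.-1) mh => m E; subst d.
split.
- have sol vS : L2 sigma S vS -> let v := transport F pi tau h vS in
      [/\ L2loc v, solves F v h & has_trace S sigma F v vS].
    move=> hvS; split.
    + exact: (L2loc_transport hS hn hFn hPhi hpi hsigma hh hvS).
    + exact: (solves_transport hS hn hFn hPhi hpi hsigma hh hvS).
    + exact: (trace_transport hS hn hFn hPhi hpi hsigma hh).
  (* A solution without prescribed trace is the one with trace 0. *)
  split=> //; have hv0 : L2 sigma S (fun=> 0).
    split; first exact: measurable_cst.
    rewrite (eq_integral (cst 0%E)) ?integral0// => x _.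
    by rewrite /dot big1// => i _; rewrite mxE mul0r.
  by have [v1 v2 _] := sol _ hv0; exists (transport F pi tau h (fun=> 0)).
- move=> vS _ v1 v2; exact: (trace_unique hS hn hFn hPhi hpi hsigma).
- move=> v; exact: (divergence_free hS hn hFn hPhi hpi).
Qed.
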